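(* Fix a unit $n\in[N]$ and a counterfactual treatment assignment $\tilde a\in[D]^N$, with donor set $\mathcal I=\mathcal I^{(n)}$. Suppose: (1) $Y^{(a)}_{t,i}=Y^{(a_{\mathcal N(i)})}_{t,i}$ for all $t\in[T]$, $i\in[N]$, $a\in[D]^N$; (2) there are latent factors $u_{j,i},w_{t,b}\in\mathbb R^r$ such that for all $t,i,a$: $Y^{(a_{\mathcal N(i)})}_{t,i}=\sum_{j\in\mathcal N(i)}\langle u_{j,i},w_{t,a_j}\rangle+\epsilon^{(a_{\mathcal N(i)})}_{t,i}$ with $\mathbb E[\epsilon^{(a_{\mathcal N(i)})}_{t,i}\mid LF]=0$; (3) $Y^{(a_{\mathcal N(i)})}_{t,i}\perp A\mid LF$ for all $i,t,a$; (4) $\mathcal I$ is non-empty and $\tilde u_{n,\mathcal N(n)}$ lies in the linear span of $\{\tilde u_{i,\pi_i(\mathcal N(i))}\}_{i\in\mathcal I}$; (5) the rowspace of $\mathbb E[Z_{\mathrm{pr},\mathcal I}\mid LF,A]$ lies within the rowspace of $\mathbb E[Z_{\mathrm{tr},\mathcal I}\mid LF,A]$; (6) conditioned on $LF$, the $\epsilon^{(a_{\mathcal N(i)})}_{t,i}$ are independent sub-Gaussian with $\mathrm{Var}(\epsilon^{(a_{\mathcal N(i)})}_{t,i}\mid LF)=\sigma^2$ and $\|\epsilon^{(a_{\mathcal N(i)})}_{t,i}\mid LF\|_{\psi_2}\le\xi\sigma$ for some constant $\xi>0$ (for all $i,t,a$); (7) $\mathbb E[Y^{(a_{\mathcal N(i)})}_{t,i}\mid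 LF]\in[-1,1]$ for all $i,t$ (and all $a$); (8) for parameters $\xi',\xi''>0$: $s_{r_{\mathrm{tr}}}/s_1\ge\xi'$ and $\|\mathbb E[Z_{\mathrm{tr},\mathcal I}\mid LF,A]\|_F^2\ge\xi''\,T_{\mathrm{tr}}|\mathcal I|$; (9) the hyperparameter of the estimator is $\kappa=r_{\mathrm{tr}}$, where $r_{\mathrm{tr}}\le r|\mathcal N(n)|$. Then, with $\xi'''=\xi'\sqrt{\xi''}$, $$\big|\widehat{\mathrm{IPO}}_n-\mathrm{IPO}_n\big|=O_P\!\left(\log(T_{\mathrm{tr}}|\mathcal I|)\left(\frac{r_{\mathrm{tr}}^{3/4}}{(\xi''')^{3/2}T_{\mathrm{tr}}^{1/4}}+\frac{r_{\mathrm{tr}}^2}{(\xi''')^4}\max\left(\frac1{\sqrt{T_{\mathrm{tr}}}},\frac1{\sqrt{|\mathcal I|}},\frac{\sqrt{|\mathcal I|}}{T_{\mathrm{tr}}^{3/2}}\right)\right)\right).$$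
   Context: $[X]=\{1,\dots,X\}$. There are $N$ units, $D$ treatments, $T$ measurements. $\mathcal G=([N],\mathcal E)$ is a fixed, known undirected graph with all self-edges included; $\mathcal N(n)=\{j:(j,n)\in\mathcal E\}$ (so $n\in\mathcal N(n)$), with a fixed ordering of its elements. For $a\in[D]^N$, $a_S$ is the subvector indexed by $S$. $Y^{(a)}_{t,n}$ is the real random potential outcome of unit $n$ at measurement $t$ under treatments $a$. Data: $A=[a^1,\dots,a^T]\in[D]^{N\times T}$ is the observed treatment assignment; $Z\in\mathbb R^{T\times N}$, $Z_{t,n}=Y^{(a^t)}_{t,n}$. $\mathcal T_{\mathrm{tr}}=\{1,\dots,T_{\mathrm{tr}}\}$ and $\mathcal T_{\mathrm{pr}}=\{T_{\mathrm{tr}}+1,\dots,T\}$, $T_{\mathrm{pr}}=|\mathcal T_{\mathrm{pr}}|\ge1$; $a^t=a^{\mathrm{pr}}$ for all $t\in\mathcal T_{\mathrm{pr}}$. $M[S_1,S_2]$ is a submatrix. $LF=\{u_{j,i},w_{t,b}\}$ is the collection of latent factors. $\tilde u_{n,\mathcal N(n)}\in\mathbb R^{r|\mathcal N(n)|}$ concatenates $u_{j,n}$, $j\in\mathcal N(n)$, in the fixed order; $\tilde u_{i,\pi_i(\mathcal N(i))}$ does so for unit $i$ in the order given by $\pi_i$. Donor set $\mathcal I^{(n)}$: all units $i\ne n$ with $|\mathcal N(i)|=|\mathcal N(n)|$ for which there is a permutation $\pi_i$ of $\mathcal N(i)$ (fixed for each donor) with $A[\pi_i(\mathcal N(i)),\mathcal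 T_{\mathrm{tr}}]=A[\mathcal N(n),\mathcal T_{\mathrm{tr}}]$ and $a^{\mathrm{pr}}_{\pi_i(\mathcal N(i))}=\tilde a_{\mathcal N(n)}$. $z_{\mathrm{tr},n}=Z[\mathcal T_{\mathrm{tr}},n]$, $Z_{\mathrm{tr},\mathcal I}=Z[\mathcal T_{\mathrm{tr}},\mathcal I]$, $Z_{\mathrm{pr},\mathcal I}=Z[\mathcal T_{\mathrm{pr}},\mathcal I]$. $r_{\mathrm{tr}}$ is the rank of $\mathbb E[Z_{\mathrm{tr},\mathcal I}\mid LF,A]$ and $s_1\ge\dots\ge s_{r_{\mathrm{tr}}}$ its nonzero singular values. $\|\cdot\|_{\psi_2}$ is the sub-Gaussian Orlicz norm (of the conditional law). Estimand: $\mathrm{IPO}_n=\frac1{T_{\mathrm{pr}}}\sum_{t\in\mathcal T_{\mathrm{pr}}}\mathbb E[Y^{(\tilde a_{\mathcal N(n)})}_{t,n}\mid LF]$. NSI estimator with hyperparameter $\kappa$: let $(\hat s_\ell,\hat\mu_\ell,\hat\nu_\ell)$ be the singular values (in decreasing order), left and right singular vectors of $Z_{\mathrm{tr},\mathcal I}$; $\hat\alpha=\big(\sum_{\ell=1}^{\kappa}\hat s_\ell^{-1}\hat\nu_\ell\hat\mu_\ell^\top\big)z_{\mathrm{tr},n}$ and $\widehat{\mathrm{IPO}}_n=\frac1{T_{\mathrm{pr}}}\mathbf 1^\top Z_{\mathrm{pr},\mathcal I}\,\hat\alpha$. $X_m=O_P(\chi_m)$ means: for every $\varepsilon>0$ there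 are constants $c_\varepsilon,m_\varepsilon$ with $P(|X_m|>c_\varepsilon\chi_m)<\varepsilon$ for all $m\ge m_\varepsilon$. Here it is understood along sequences of problem instances with $T_{\mathrm{tr}},|\mathcal I|\to\infty$, with $\sigma$ and $\xi$ fixed, and with probability conditional on $LF$ and $A$.
   Formalization: Hypothesis (3) is taken jointly: the whole family of potential outcomes is independent of A given LF. With (3) only for each outcome separately the claim fails, since A may reveal all noises up to a common sign. *)

(* Defs.v *)
From HB Require Import structures.
From mathcomp Require Import all_boot all_order all_algebra all_fingroup.
From mathcomp Require Import all_classical all_reals all_analysis.
From mathcomp Require Import measurable_realfun.

Set Implicit Arguments.
Unset Strict Implicit.
Unset Printing Implicit Defensive.
Import Order.TTheory GRing.Theory Num.Theory.
Import numFieldNormedType.Exports.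

Local Open Scope classical_set_scope.
Local Open Scope ring_scope.

Section Probability.
Context {d : measure_display} {Om : measurableType d} {R : realType}.

(* [K w] is a regular conditional probability of [P] given the
   sigma-algebra generated by [G]. *)
Definition is_regular_cond_prob (P : probability Om R) (G : set (set Om))
    (K : Om -> probability Om R) : Prop :=
  (forall E : set Om, measurable E ->
     measurable_fun [set: g_sigma_algebraType G]
       (fun w : g_sigma_algebraType G => K w E)) /\
  (forall E B : set Om, measurable E -> <<s G >> B ->
     P (E `&` B) = (\int[P]_(w in B) K w E)%E).

(* For a finite family this is mutual independence: a subfamily is reached by
   taking [B x = setT] outside of it. *)
Definition mutually_independent (Q : probability Om R) (I : finType)
    (X : I -> Om -> R) : Prop :=
  forall B : I -> set R, (forall x, measurable (B x)) ->
    Q (\bigcap_(x in [set: I]) (X x @^-1` B x)) =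
    (\prod_(x : I) Q (X x @^-1` B x))%E.

(* [inf {k > 0 | E exp(X^2/k^2) <= 2}], equal to +oo when there is no such k *)
Definition psi2_norm (Q : probability Om R) (X : Om -> R) : \bar R :=
  ereal_inf [set k%:E | k in
    [set k : R | 0 < k /\
       ('E_Q[fun w => expR (X w ^+ 2 / k ^+ 2)] <= 2%:E)%E]].

End Probability.

(* [X_m = O_P(chi_m)], each [X_m] living on its own probability space *)
Definition bigO_P (R : realType) (d : nat -> measure_display)
    (Om : forall m, measurableType (d m)) (Q : forall m, probability (Om m) R)
    (X : forall m, Om m -> R) (chi : nat -> R) : Prop :=
  forall eps : R, 0 < eps -> exists (c : R) (m0 : nat),
    forall m, (m0 <= m)%N ->
      (Q m [set w | (c * chi m < `|X m w|)%R] < eps%:E)%E.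

Section LinearAlgebra.
Context {R : realType}.

(* A thin singular value decomposition of [Z]. The indices run from 0, so
   that the l-th largest singular value is [sv`_l.-1]. *)
Record svd (p q : nat) (Z : 'M[R]_(p, q)) := Svd {
  sv : (minn p q).-tuple R;
  lvec : 'I_(minn p q) -> 'cV[R]_p;
  rvec : 'I_(minn p q) -> 'cV[R]_q;
  sv_ge0 : forall l, 0 <= tnth sv l;
  sv_decr : sorted (fun x y : R => y <= x) sv;
  lvec_orthonormal :
    forall k l, (lvec k)^T *m lvec l = (k == l)%:R%:M;
  rvec_orthonormal :
    forall k l, (rvec k)^T *m rvec l = (k == l)%:R%:M;
  svdE : Z = \sum_(l < minn p q) tnth sv l *: (lvec l *m (rvec l)^T)
}.

(* Principal component regression of [z] on [Z] with [kappa] components.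
   Since [0^-1 = 0], a null singular value contributes nothing. *)
Definition pcr (p q : nat) (Z : 'M[R]_(p, q)) (S : svd Z) (kappa : nat)
    (z : 'cV[R]_p) : 'cV[R]_q :=
  (\sum_(l < minn p q | (l < kappa)%N)
     (tnth (sv S) l)^-1 *: (rvec S l *m (lvec S l)^T)) *m z.

Definition frobenius_sq (p q : nat) (Z : 'M[R]_(p, q)) : R :=
  \sum_(i < p) \sum_(j < q) Z i j ^+ 2.

End LinearAlgebra.

Section Network.
Context {N D : nat}.

Definition nbhd (edge : rel 'I_N) (i : 'I_N) : {set 'I_N} :=
  [set j | edge j i].

Definition treatment := {ffun 'I_N -> 'I_D}.

(* the elements of [D]^{N(i)} *)
Definition exposure (edge : rel 'I_N) (i : 'I_N) :=
  {ffun {j : 'I_N | j \in nbhd edge i} -> 'I_D}.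

Definition restrict (edge : rel 'I_N) (i : 'I_N) (a : treatment) :
    exposure edge i :=
  [ffun j => a (val j)].

End Network.
Arguments treatment : clear implicits.
Arguments exposure {N} D edge i.

(* generators of the sigma-algebra of LF: the u_{j,i} with j in N(i), and the
   w_{t,b} *)
Definition gen_LF {N D r T : nat} {d : measure_display} {Om : measurableType d}
    {R : realType} (edge : rel 'I_N)
    (ufac : 'I_N -> 'I_N -> 'I_r -> Om -> R)
    (wfac : 'I_T -> 'I_D -> 'I_r -> Om -> R) : set (set Om) :=
  [set E | exists (j i : 'I_N) (k : 'I_r) (B : set R),
     [/\ j \in nbhd edge i, measurable B & E = ufac j i k @^-1` B]] `|`
  [set E | exists (t : 'I_T) (b : 'I_D) (k : 'I_r) (B : set R),
     measurable B /\ E = wfac t b k @^-1` B].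

(* One problem instance. The measurements are [lshift Tpr t] for the training
   ones and [rshift Ttr t] for the prediction ones. *)
Record instance (R : realType) := Instance {
  units : nat;
  levels : nat;
  lrank : nat;
  Ttr : nat;
  Tpr : nat;
  Tpr_gt0 : (0 < Tpr)%N;
  edge : rel 'I_units;
  edge_sym : symmetric edge;
  edge_refl : reflexive edge;
  (* the fixed ordering of each neighbourhood *)
  nbseq : 'I_units -> seq 'I_units;
  nbseq_uniq : forall i, uniq (nbseq i);
  mem_nbseq : forall i, nbseq i =i nbhd edge i;
  disp : measure_display;
  Om : measurableType disp;
  Pr : probability Om R;
  (* [ufac j i k] and [wfac t b k] are the k-th coordinates of u_{j,i} and
     w_{t,b} *)
  ufac : 'I_units -> 'I_units -> 'I_lrank -> {RV Pr >-> R};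
  wfac : 'I_(Ttr + Tpr) -> 'I_levels -> 'I_lrank -> {RV Pr >-> R};
  (* [Y t i a] is indexed by the treatments of all the units, and [YN t i b]
     by those of the neighbours of [i] only *)
  Y : 'I_(Ttr + Tpr) -> 'I_units -> treatment units levels -> {RV Pr >-> R};
  YN : 'I_(Ttr + Tpr) ->
    forall i : 'I_units, exposure levels edge i -> {RV Pr >-> R};
  noise : 'I_(Ttr + Tpr) ->
    forall i : 'I_units, exposure levels edge i -> {RV Pr >-> R};
  (* [assign x t] is the vector a^t *)
  assign : Om -> {ffun 'I_(Ttr + Tpr) -> treatment units levels};
  assign_measurable : forall a, measurable (assign @^-1` [set a]);
  apr : Om -> treatment units levels;
  assign_apr : forall (x : Om) (t : 'I_Tpr), assign x (rshift Ttr t) = apr x;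
  condLF : Om -> probability Om R;
  condLF_rcp : is_regular_cond_prob Pr (gen_LF edge ufac wfac) condLF;
  condLFA : Om -> probability Om R;
  condLFA_rcp :
    is_regular_cond_prob Pr
      (gen_LF edge ufac wfac `|` [set E | exists a, E = assign @^-1` [set a]])
      condLFA
}.
Arguments edge {R} _ _ _.
Arguments nbseq {R} _ _.
Arguments Om {R} _.
Arguments Pr {R} _.
Arguments ufac {R} _ _ _ _.
Arguments wfac {R} _ _ _ _.
Arguments Y {R} _ _ _ _.
Arguments YN {R} _ _ _ _.
Arguments noise {R} _ _ _ _.
Arguments assign {R} _ _.
Arguments apr {R} _ _.
Arguments condLF {R} _ _.
Arguments condLFA {R} _ _.

Section Model.
Context {R : realType} (M : instance R).

Local Notation unit := 'I_(units M).
Local Notation time := 'I_(Ttr M + Tpr M).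
Local Notation treat := (treatment (units M) (levels M)).

(* The distinct variables among the Y_{t,i}^{(a_N(i))} are indexed by a
   measurement, a unit and an exposure of that unit. *)
Definition outcome_index : finType :=
  (time * {i : unit & exposure (levels M) (edge M) i})%type.

Definition outcome (o : outcome_index) : Om M -> R :=
  YN M o.1 (tag o.2) (tagged o.2).

Definition outcome_noise (o : outcome_index) : Om M -> R :=
  noise M o.1 (tag o.2) (tagged o.2).

Definition no_outside_interference : Prop :=
  forall (t : time) (i : unit) (a : treat) (x : Om M),
    Y M t i a x = YN M t i (restrict (edge M) i a) x.

Definition latent_factor_model : Prop :=
  (forall (t : time) (i : unit) (a : treat) (x : Om M),
    YN M t i (restrict (edge M) i a) x =
      \sum_(j in nbhd (edge M) i)
         \sum_(k < lrank M) ufac M j i k x * wfac M t (a j) k x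
      + noise M t i (restrict (edge M) i a) x) /\
  {ae Pr M, forall x, forall o : outcome_index,
    ('E_(condLF M x)[outcome_noise o] = 0)%E}.

(* The potential outcomes, as one family, are independent of the assignment
   given LF; the product sets are a pi-system generating its sigma-algebra. *)
Definition cond_ignorability : Prop :=
  {ae Pr M, forall x, forall (B : outcome_index -> set R) a,
    (forall o, measurable (B o)) ->
    let EY := \bigcap_(o in [set: outcome_index]) (outcome o @^-1` B o) in
    let EA := assign M @^-1` [set a] in
    condLF M x (EY `&` EA) = (condLF M x EY * condLF M x EA)%E}.

Definition subgaussian_noise (sigma xi : R) : Prop :=
  {ae Pr M, forall x,
    mutually_independent (condLF M x) outcome_noise /\
    forall o : outcome_index,
      variance (condLF M x) (outcome_noise o) = (sigma ^+ 2)%:E /\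
      (psi2_norm (condLF M x) (outcome_noise o) <= (xi * sigma)%:E)%E}.

Definition bounded_cond_mean : Prop :=
  {ae Pr M, forall x, forall o : outcome_index,
    ((-1)%:E <= 'E_(condLF M x)[outcome o] <= 1%:E)%E}.

Definition Z (t : time) (i : unit) (x : Om M) : R := Y M t i (assign M x t) x.

Definition ztr (n : unit) (x : Om M) : 'cV[R]_(Ttr M) :=
  \col_t Z (lshift (Tpr M) t) n x.

Definition Ztr (I : {set unit}) (x : Om M) : 'M[R]_(Ttr M, #|I|) :=
  \matrix_(t, l) Z (lshift (Tpr M) t) (enum_val l) x.

Definition Zpr (I : {set unit}) (x : Om M) : 'M[R]_(Tpr M, #|I|) :=
  \matrix_(t, l) Z (rshift (Ttr M) t) (enum_val l) x.

(* conditional expectations given LF and A, entry by entry *)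
Definition EZtr (I : {set unit}) (x : Om M) : 'M[R]_(Ttr M, #|I|) :=
  \matrix_(t, l)
    fine ('E_(condLFA M x)[Z (lshift (Tpr M) t) (enum_val l)])%E.

Definition EZpr (I : {set unit}) (x : Om M) : 'M[R]_(Tpr M, #|I|) :=
  \matrix_(t, l)
    fine ('E_(condLFA M x)[Z (rshift (Ttr M) t) (enum_val l)])%E.

Section Target.
Context (n : unit) (atilde : treat).

(* [p] is an admissible pi_i for the treatments realised at [x] *)
Definition matching (x : Om M) (i : unit) (p : {perm unit}) : bool :=
  [&& perm_on (nbhd (edge M) i) p,
      [forall t : 'I_(Ttr M),
         [seq assign M x (lshift (Tpr M) t) (p j) | j <- nbseq M i] ==
         [seq assign M x (lshift (Tpr M) t) j | j <- nbseq M n]] &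
      [seq apr M x (p j) | j <- nbseq M i] ==
      [seq atilde j | j <- nbseq M n]].

Definition donors (x : Om M) : {set unit} :=
  [set i | [&& i != n, #|nbhd (edge M) i| == #|nbhd (edge M) n| &
               [exists p : {perm unit}, matching x i p]]].

(* concatenation of the [u j i], for [j] running through the first
   [|N(n)|] terms of [s] *)
Definition utilde (x : Om M) (i : unit) (s : seq unit) :
    'rV[R]_(\sum_(k < #|nbhd (edge M) n|) lrank M) :=
  \mxrow_(k < #|nbhd (edge M) n|) \row_l ufac M (nth i s k) i l x.

Definition donors_span (x : Om M)
    (p : unit -> {perm unit}) : Prop :=
  donors x != finset.set0 /\
  utilde x n (nbseq M n)
    \in <<[seq utilde x i [seq p i j | j <- nbseq M i]
             | i in donors x]>>%VS.

Definition IPO (x : Om M) : R :=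
  (Tpr M)%:R^-1 * \sum_(t < Tpr M)
    fine ('E_(condLF M x)[YN M (rshift (Ttr M) t) n
                            (restrict (edge M) n atilde)])%E.

Definition IPO_hat (I : {set unit}) (S : forall y, svd (Ztr I y))
    (kappa : nat) (y : Om M) : R :=
  (Tpr M)%:R^-1 *
  ((const_mx 1 : 'rV[R]_(Tpr M)) *m Zpr I y *m pcr (S y) kappa (ztr n y)) 0 0.

End Target.
End Model.

Definition rate (R : realType) (Ttr card_I rtr : nat) (xi3 : R) : R :=
  ln ((Ttr * card_I)%:R) *
  (rtr%:R `^ (3 / 4) / (xi3 `^ (3 / 2) * Ttr%:R `^ (1 / 4)) +
   rtr%:R ^+ 2 / xi3 ^+ 4 *
   Num.max ((Num.sqrt Ttr%:R)^-1)
     (Num.max ((Num.sqrt card_I%:R)^-1)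
        (Num.sqrt card_I%:R / Ttr%:R `^ (3 / 2)))).

(* Main.v *)
Require Import Defs.
From HB Require Import structures.
From mathcomp Require Import all_boot all_order all_algebra all_fingroup.
From mathcomp Require Import all_classical all_reals all_analysis.
From mathcomp Require Import measurable_realfun.
From mathcomp Require Import ring lra zify.

Set Implicit Arguments.
Unset Strict Implicit.
Unset Printing Implicit Defensive.
Import Order.TTheory GRing.Theory Num.Theory.
Import numFieldNormedType.Exports.
Local Open Scope classical_set_scope.
Local Open Scope ring_scope.

(** Write [B = r_tr / xi'''^2], so that every nonzero singular value of the mean
    training matrix [E] of the donors is at least [sqrt (T_tr |I| / B)]. By the
    span condition and the matching of treatments, the means of unit [n] are the
    same linear combination [E *m be] of the means of the donors before and
    after the change of treatment. Given LF and A the noise matrix [W] of the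
    donors is centered, independent and sub-Gaussian, with operator norm
    [O(sqrt T_tr + sqrt |I|)].

    If this is less than half of the smallest nonzero singular value of [E], a
    perturbation argument bounds the error of principal component regression by
    [O(B (1 / sqrt T_tr + 1 / sqrt |I|))]. Otherwise [B] is at least a multiple of
    [mu = min (T_tr, |I|)], so that the rate is at least a multiple of
    [mu ^ (3/2)], and it is enough that the estimator does not blow up, i.e. that
    the smallest singular value of [E + W] is at least a multiple of
    [sqrt (max (T_tr, |I|)) / mu] with probability close to 1. This is proved by
    nets for very rectangular matrices, and by the invertibility method of
    Rudelson and Vershynin otherwise, the distance between a column and the span
    of the others being controlled by the characteristic function of the noise.

    The noise is independent under the conditional law given LF. That the laws of
    the potential outcomes given LF and given (LF, A) agree almost everywhere
    follows from ignorability by comparing both kernels on the events where one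
    is below a rational level and the other one above. *)

(** * Independence of disjoint subfamilies *)

(** All bounds are uniform in the instance: [xi1] and [xi2] may tend to 0 along the sequence, so
    nothing keeps the signal above the noise, and the estimator may invert singular values of the
    size of the noise. With [g = sqrt r_tr / xi'''], that is [B = g ^ 2], both regimes lead to the
    single bound [C * g ^ 4 / sqrt (min (T_tr, |I|))]. As [eps] is fixed, second moments and
    Markov's inequality suffice for the noise, except where a union bound over a net asks for
    exponential tails.

    The smallest singular value is delicate because [E] may have norm of order [sqrt (T_tr |I|)],
    far above that of [W], so that a net adapted to the noise alone is too coarse. The Frobenius
    norm of [E] leaves few large singular directions, which are encoded separately. Means are
    harmless in characteristic functions, whose modulus ignores translations. The vector normal to
    all columns but one is replaced by candidates from a finite grid, which avoids both a measurable
    choice of this vector and conditioning on the columns. If [sigma = 0] the characteristic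
    function gives nothing, but then the noise vanishes. *)

Lemma sigma_gens_sub (T : Type) (G1 G2 : set (set T)) :
  G1 `<=` G2 -> <<s G1 >> `<=` <<s G2 >>.
Proof. by apply: sub_smallest2r; exact: smallest_sigma_algebra. Qed.

Section Independence.
Context {d : measure_display} {Om : measurableType d} {R : realType}.
Context (Q : probability Om R).

Definition gens (I : Type) (X : I -> Om -> R) (J : set I) : set (set Om) :=
  [set A | exists i B, [/\ J i, measurable B & A = X i @^-1` B]].

Section Grouping.
Context (I : finType) (X : I -> Om -> R).
Context (mX : forall i, measurable_fun setT (X i)).
Context (indX : mutually_independent Q X).

Lemma mpreX i B : measurable B -> measurable (X i @^-1` B).
Proof. by move=> mB; rewrite -[_ @^-1` _]setTI; exact: mX. Qed.

(** Cylinders over [J] carry sides for all indices of [I], equal to [setT] outside of [J], because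
    [mutually_independent] is stated for the whole family. They form a pi-system generating the
    sigma-algebra of the subfamily. *)
Definition cylinders (J : set I) : set (set Om) :=
  [set A | exists B : I -> set R, [/\ forall i, measurable (B i),
     forall i, ~ J i -> B i = setT &
     A = \bigcap_(i in [set: I]) (X i @^-1` B i)]].

Lemma cylinders_measurable J : cylinders J `<=` measurable.
Proof.
move=> _ [B [mB _ ->]]; apply: fin_bigcap_measurable => // i _; exact: mpreX.
Qed.

Lemma cylinders_setI J : setI_closed (cylinders J).
Proof.
move=> _ _ [B [mB BT ->]] [C [mC CT ->]]; exists (fun i => B i `&` C i); split.
- by move=> i; exact: measurableI.
- by move=> i Ji; rewrite BT// CT// setTI.
- apply/seteqP; split => [w [Bw Cw] i _|w BCw]; first by split; [exact: Bw|exact: Cw].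
  by split=> i _; have [] := BCw i Logic.I.
Qed.

Lemma cylinders_setT J : cylinders J setT.
Proof.
exists (fun=> setT); split => //; apply/seteqP; split => // w _ i _; exact: Logic.I.
Qed.

Lemma gens_cylinders J : gens X J `<=` cylinders J.
Proof.
move=> _ [i [B [Ji mB ->]]].
exists (fun j => if j == i then B else setT); split.
- by move=> j; case: ifP.
- by move=> j Jj; case: eqP => // ji; rewrite ji in Jj.
- apply/seteqP; split => [w Bw j _ /=|w /(_ i Logic.I)/=]; last by rewrite eqxx.
  by case: eqP => [->|].
Qed.

Lemma gens_measurable J : gens X J `<=` measurable.
Proof. by move=> A /gens_cylinders; exact: cylinders_measurable. Qed.

Lemma sigma_gens_measurable J A : <<s gens X J >> A -> measurable A.
Proof.
apply: smallest_sub; first exact: sigma_algebra_measurable.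
exact: gens_measurable.
Qed.

(** The intersection is again a cylinder, whose side at [i] is that of [B1 i] and [B2 i]; at every
    index one of the two is [setT], so the product over [I] splits factor by factor. *)
Lemma indep_cylinders J1 J2 A1 A2 : (forall i, J1 i -> ~ J2 i) ->
  cylinders J1 A1 -> cylinders J2 A2 -> Q (A1 `&` A2) = (Q A1 * Q A2)%E.
Proof.
move=> J12 [B1 [mB1 B1T ->]] [B2 [mB2 B2T ->]].
have -> : \bigcap_(i in [set: I]) (X i @^-1` B1 i) `&`
    \bigcap_(i in [set: I]) (X i @^-1` B2 i) =
    \bigcap_(i in [set: I]) (X i @^-1` (B1 i `&` B2 i)).
  apply/seteqP; split => [w [Bw Cw] i _|w BCw].
    by split; [exact: Bw|exact: Cw].
  by split=> i _; have [] := BCw i Logic.I.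
rewrite !indX//; last by move=> i; exact: measurableI.
rewrite -big_split /=; apply: eq_bigr => i _.
have [Ji|/B1T ->] := pselect (J1 i); last first.
  by rewrite setTI preimage_setT probability_setT mul1e.
by rewrite (B2T i (J12 _ Ji)) setIT preimage_setT probability_setT mule1.
Qed.

(** For fixed [F] both sides are finite measures in [A] that agree on a pi-system. Applied once in
    each argument, this passes from cylinders to the generated sigma-algebras. *)
Let indep_extend (G : set (set Om)) (F : set Om) :
  G `<=` measurable -> setI_closed G -> G setT -> measurable F ->
  (forall A, G A -> Q (A `&` F) = (Q A * Q F)%E) ->
  forall A, <<s G >> A -> Q (A `&` F) = (Q A * Q F)%E.
Proof.
move=> Gm GI GT mF GF A sA.
have QF0 : 0 <= fine (Q F) by rewrite fine_ge0.
pose m1 := mrestr Q mF.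
pose m2 := mscale (NngNum QF0) Q.
have QFE : Q F = (fine (Q F))%:E by rewrite fineK// fin_num_measure.
have -> : (Q A * Q F)%E = m2 A by rewrite /m2 /= /mscale /= -QFE muleC.
apply: (g_sigma_algebra_measure_unique G Gm (fun=> setT) _ _ m1 m2) => //.
- by rewrite bigcup_const//; exists 0%N.
- by move=> B GB; rewrite /m1 /m2 /= /mrestr /mscale /= -QFE GF// muleC.
- by move=> _; rewrite /m1 /= /mrestr setTI ltey_eq fin_num_measure.
Qed.

Lemma indep_sigma J1 J2 A1 A2 : (forall i, J1 i -> ~ J2 i) ->
  <<s gens X J1 >> A1 -> <<s gens X J2 >> A2 ->
  Q (A1 `&` A2) = (Q A1 * Q A2)%E.
Proof.
move=> J12 sA1 sA2.
have cyl J B : <<s gens X J >> B -> <<s cylinders J >> B.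
  exact: sigma_gens_sub (@gens_cylinders J) B.
apply: (indep_extend (@cylinders_measurable J1) (@cylinders_setI J1)
  (@cylinders_setT J1)) => //; last exact: cyl.
  exact: sigma_gens_measurable sA2.
move=> B1 cB1; rewrite setIC muleC.
apply: (indep_extend (@cylinders_measurable J2) (@cylinders_setI J2)
  (@cylinders_setT J2)) => //; last exact: cyl.
  exact: cylinders_measurable cB1.
by move=> B2 cB2; rewrite setIC muleC; exact: (indep_cylinders J12).
Qed.

Definition jmeas (J : set I) (f : Om -> R) :=
  measurable_fun [set: g_sigma_algebraType (gens X J)]
    (f : g_sigma_algebraType (gens X J) -> R).

Lemma jmeasX J i : J i -> jmeas J (X i).
Proof.
move=> Ji _ B mB; rewrite setTI; apply: sub_sigma_algebra; by exists i, B.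
Qed.

Lemma jmeasS J1 J2 f : J1 `<=` J2 -> jmeas J1 f -> jmeas J2 f.
Proof.
move=> J12 mf _ B mB; have := mf measurableT B mB.
apply: sigma_gens_sub => _ [i [C [Ji mC ->]]].
by exists i, C; split => //; exact: J12.
Qed.

Lemma jmeas_measurable J f : jmeas J f -> measurable_fun setT f.
Proof. by move=> mf _ B mB; apply: sigma_gens_measurable; exact: mf. Qed.

End Grouping.

Local Open Scope ereal_scope.

(** Independence on Borel rectangles makes the law of the pair the product of the two laws, by
    uniqueness of the product measure; Tonelli's theorem then splits the integral. *)
Lemma indep_ge0_expectation (f g : Om -> R) :
  measurable_fun setT f -> measurable_fun setT g ->
  (forall x, 0 <= f x)%R -> (forall x, 0 <= g x)%R ->
  (forall A B, measurable A -> measurable B ->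
     Q (f @^-1` A `&` g @^-1` B) = Q (f @^-1` A) * Q (g @^-1` B)) ->
  \int[Q]_x (f x * g x)%:E = \int[Q]_x (f x)%:E * \int[Q]_x (g x)%:E.
Proof.
move=> mf mg f0 g0 fg.
pose h x := (f x, g x).
have mn : measurable_fun [set: R] (fun x : R => `|x|%:E).
  by apply/measurable_EFinP; exact: normr_measurable.
have mh : measurable_fun setT h by exact/measurable_fun_pair.
pose F : {mfun Om >-> R} := HB.pack f (isMeasurableFun.Build _ _ _ _ f mf).
pose G : {mfun Om >-> R} := HB.pack g (isMeasurableFun.Build _ _ _ _ g mg).
pose H : {mfun Om >-> (R * R)%type} :=
  HB.pack h (isMeasurableFun.Build _ _ _ _ h mh).
pose m1 := distribution Q F; pose m2 := distribution Q G.
(* Absolute values make the integrand nonnegative on the whole plane without changing it on the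
   range of [(f, g)]. *)
pose phi (z : R * R) : \bar R := (`|z.1| * `|z.2|)%:E.
have mphi : measurable_fun setT phi.
  apply/measurable_EFinP; apply: measurable_funM; apply: measurableT_comp => //.
have phi0 z : 0 <= phi z by rewrite lee_fin mulr_ge0.
have -> : \int[Q]_x (f x * g x)%:E = \int[distribution Q H]_z phi z.
  rewrite ge0_integral_distribution//; apply: eq_integral => x _.
  by rewrite /phi /= !ger0_norm.
rewrite (eq_measure_integral (m1 \x m2)%E); last first.
  by move=> A mA _; apply/esym; apply: product_measure_unique => // B C mB mC.
rewrite (fubini_tonelli1 phi)//.
transitivity (\int[m1]_x (`|x|%:E * \int[m2]_y `|y|%:E)).
  apply: eq_integral => x _; rewrite /fubini_F /phi /=.
  by rewrite -ge0_integralZl//; apply/measurable_EFinP; exact: normr_measurable.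
rewrite ge0_integralZr//; last first.
  by apply: integral_ge0 => y _; rewrite lee_fin.
have intE (h0 : {mfun Om >-> R}) : (forall x, (0 <= h0 x)%R) ->
    \int[distribution Q h0]_y `|y|%:E = \int[Q]_x (h0 x)%:E.
  move=> h00; rewrite ge0_integral_distribution//.
  by apply: eq_integral => x _ /=; rewrite ger0_norm.
by rewrite /m1 /m2 !intE.
Qed.

End Independence.

(** * Elementary real inequalities *)

Section RealInequalities.
Context {R : realType}.
Implicit Types x y : R.

(** Convexity of the exponential from its tangent at [th * u], taken at [u] and at [0] with weights
    [th] and [1 - th]. It replaces Jensen's inequality for small powers of
    [expR (X ^+ 2 / K ^+ 2)]. *)
Lemma expR_interp (th u : R) : 0 <= th <= 1 ->
  expR (th * u) <= 1 + th * (expR u - 1).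
Proof.
move=> /andP[th0 th1].
have e1 : expR (th * u) * (1 + (1 - th) * u) <= expR u.
  have -> : expR u = expR (th * u) * expR ((1 - th) * u).
    by rewrite -expRD; congr expR; ring.
  by rewrite ler_pM2l ?expR_gt0// expR_ge1Dx.
have e2 : expR (th * u) * (1 - th * u) <= 1.
  by rewrite -[leRHS](expRxMexpNx_1 (th * u)) ler_pM2l ?expR_gt0// expR_ge1Dx.
move: e1 e2; set a := expR (th * u); set b := expR u => e1 e2.
have := ler_wpM2l th0 e1; have : 0 <= 1 - th by rewrite subr_ge0.
by move=> th2; have := ler_wpM2l th2 e2; nra.
Qed.

(** The linear term stays apart because it integrates to zero for a centered variable; the square
    goes into an exponential, where the sub-Gaussian bound applies. *)
Lemma expR_le_quad x : expR x <= x + expR (2 * x ^+ 2).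
Proof.
have e2 := expR_ge1Dx (2 * x ^+ 2).
have [xh|xh] := leP x (1 / 2); last first.
  have : expR x <= expR (2 * x ^+ 2) by rewrite ler_expR; nra.
  by lra.
suff : expR x <= 1 + x + 2 * x ^+ 2 by lra.
have := expR_ge1Dx (- x); rewrite expRN => h.
have e0 : 0 < expR x by exact: expR_gt0.
have {h} : expR x * (1 - x) <= 1 by rewrite -ler_pdivlMl// mulr1.
move: e0; set a := expR x => a0 h.
have x1 : 0 < 1 - x by lra.
rewrite -(ler_pM2r x1) (le_trans h)//.
have : 0 <= x ^+ 2 * (1 - 2 * x) by apply: mulr_ge0; [exact: sqr_ge0|lra].
have -> : (1 + x + 2 * x ^+ 2) * (1 - x) = 1 + x ^+ 2 * (1 - 2 * x) by ring.
by lra.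
Qed.

Lemma le_MVT (f g : R -> R) x : (forall y, is_derive y 1 f (g y)) ->
  (forall y, 0 <= y -> 0 <= g y) -> 0 <= x -> f 0 <= f x.
Proof.
move=> df g0; rewrite le_eqVlt => /predU1P[<-//|x0].
have cf : {within `[0, x], continuous f}.
  apply: continuous_subspaceT => y; apply: differentiable_continuous.
  by apply/derivable1_diffP; exact: ex_derive.
have [c] := MVT x0 (fun y _ => df y) cf.
rewrite in_itv/= => /andP[c0 _]; rewrite subr0 => e.
by rewrite -subr_ge0 e mulr_ge0 ?g0// ltW.
Qed.

Lemma sin_le_ge0 x : 0 <= x -> sin x <= x.
Proof.
move=> x0; rewrite -subr_ge0.
have := @le_MVT (fun y => y - sin y) (fun y => 1 - cos y) x.
rewrite sin0 subrr; apply => // y _; by rewrite subr_ge0 cos_le1.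
Qed.

Lemma sin_ge_ge0 x : 0 <= x -> - x <= sin x.
Proof.
move=> x0; rewrite -subr_ge0.
have := @le_MVT (fun y => sin y - (- y)) (fun y => cos y - (- 1)) x.
by rewrite sin0 oppr0 subrr; apply => // y _; rewrite opprK -lerBlDr sub0r cos_geN1.
Qed.

Lemma sqr_sin_le x : sin x ^+ 2 <= x ^+ 2.
Proof.
wlog x0 : x / 0 <= x => [hw|].
  have [/hw//|/ltW x0] := leP 0 x.
  by have := hw (- x); rewrite oppr_ge0 sinN !sqrrN; exact.
by have := sin_le_ge0 x0; have := sin_ge_ge0 x0; nra.
Qed.

Lemma cos_half x : cos x = 1 - 2 * sin (x / 2) ^+ 2.
Proof.
have {1}-> : x = (x / 2) *+ 2 by rewrite -mulr_natr; field.
by rewrite cos_mulr2n cos2sin2 -mulr_natl; ring.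
Qed.

Lemma cos_ge_quad x : 1 - x ^+ 2 / 2 <= cos x.
Proof. by rewrite cos_half; have := sqr_sin_le (x / 2); nra. Qed.

Lemma sin_ge_cubic x : 0 <= x -> x - x ^+ 3 / 6 <= sin x.
Proof.
move=> x0; rewrite -subr_ge0.
pose f y : R := sin y - (y - y ^+ 3 * 6^-1).
have := @le_MVT f (fun y => cos y - (1 - (3 * y ^+ 2) * 6^-1)) x.
rewrite /f sin0 expr0n /= mul0r !subr0; apply => // y; last first.
  by move=> _; have := cos_ge_quad y; lra.
apply: is_derive_eq; rewrite /= !scaler1 /GRing.scale /=; ring.
Qed.

Lemma cos_le_quartic x : cos x <= 1 - x ^+ 2 / 2 + x ^+ 4 / 24.
Proof.
wlog x0 : x / 0 <= x => [hw|].
  have [/hw//|/ltW x0] := leP 0 x; have := hw (- x).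
  by rewrite oppr_ge0 cosN sqrrN -[4%N]/(2 * 2)%N !exprM sqrrN; exact.
rewrite cos_half; set h := x / 2; have -> : x = 2 * h by rewrite /h; field.
have h0 : 0 <= h by rewrite divr_ge0.
have sh := sin_ge_cubic h0.
suff : h ^+ 2 - h ^+ 4 / 3 <= sin h ^+ 2.
  have -> : (2 * h) ^+ 2 = 4 * h ^+ 2 by ring.
  have -> : (2 * h) ^+ 4 = 16 * h ^+ 4 by ring.
  by lra.
have [h3|h3] := leP 3 (h ^+ 2).
  apply: le_trans (sqr_ge0 _).
  have : 0 <= h ^+ 2 * (h ^+ 2 - 3) by apply: mulr_ge0; [exact: sqr_ge0|lra].
  have -> : h ^+ 2 * (h ^+ 2 - 3) = h ^+ 4 - 3 * h ^+ 2 by ring.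
  by lra.
have l0 : 0 <= h - h ^+ 3 / 6.
  have : 0 <= h * (6 - h ^+ 2) by apply: mulr_ge0; lra.
  have -> : h * (6 - h ^+ 2) = 6 * h - h ^+ 3 by ring.
  by lra.
have : (h - h ^+ 3 / 6) ^+ 2 <= sin h ^+ 2 by rewrite ler_sqr ?nnegrE// (le_trans l0).
have -> : (h - h ^+ 3 / 6) ^+ 2 = h ^+ 2 - h ^+ 4 / 3 + (h ^+ 3) ^+ 2 / 36 by field.
by have := sqr_ge0 (h ^+ 3); lra.
Qed.

Lemma sin_sub_le x : `|sin x - x| <= x ^+ 2.
Proof.
wlog x0 : x / 0 <= x => [hw|].
  have [/hw//|/ltW x0] := leP 0 x.
  by have := hw (- x); rewrite oppr_ge0 sinN sqrrN -opprD normrN; exact.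
rewrite distrC ger0_norm ?subr_ge0 ?sin_le_ge0//.
have [x6|x6] := leP x 6; last by have := sin_geN1 x; nra.
have := sin_ge_cubic x0; have : 0 <= x ^+ 2 * (6 - x) by apply: mulr_ge0; [exact: sqr_ge0|lra].
have -> : x ^+ 2 * (6 - x) = 6 * x ^+ 2 - x ^+ 3 by ring.
by lra.
Qed.

Lemma expRN_le_frac y : 0 <= y -> expR (- y) <= (1 + y)^-1.
Proof.
by move=> y0; rewrite expRN lef_pV2 ?posrE ?expR_gt0 ?expR_ge1Dx// ltr_wpDr.
Qed.

(** Dominates a Gaussian by a cosine, so that the Laplace transform of a square is controlled by a
    characteristic function. For [y ^+ 2 <= 1] it comes from [cos_ge_quad], beyond from
    [cos y >= -1]. *)
Lemma expRN_sqr_le_cos y : expR (- y ^+ 2) <= 1 - (1 - cos y) / 4.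
Proof.
set s := y ^+ 2; have s0 : 0 <= s by exact: sqr_ge0.
apply: (le_trans (expRN_le_frac s0)); rewrite -div1r ler_pdivrMr; last by lra.
have := cos_ge_quad y; have := cos_geN1 y; rewrite -/s => c1 c2.
by have [s1|s1] := leP s 1; nra.
Qed.

Lemma expR_sqr_ge4 x : x ^+ 4 <= 2 * expR (x ^+ 2).
Proof.
have := @expR_ge1Dxn _ (x ^+ 2) 1 (sqr_ge0 _).
by rewrite -exprM (_ : 2`!%:R = 2)//; lra.
Qed.

End RealInequalities.

(** * Expectations under mutual independence *)

Section Expectation.
Context {d : measure_display} {Om : measurableType d} {R : realType}.
Context (Q : probability Om R).
Local Notation intg f := (Q.-integrable [set: Om] (EFin \o f)).

Lemma integrable_le_fun (f g : Om -> R) : measurable_fun setT f ->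
  (forall x, `|f x| <= g x) -> intg g -> intg f.
Proof.
move=> mf fg; apply: le_integrable => //; first exact/measurable_EFinP.
by move=> x _; rewrite /= lee_fin (le_trans (fg x))// ler_norm.
Qed.

Lemma integrable_cst_fun (r : R) : intg (cst r).
Proof. exact: finite_measure_integrable_cst. Qed.

Lemma integrable_bounded (f : Om -> R) (r : R) : measurable_fun setT f ->
  (forall x, `|f x| <= r) -> intg f.
Proof. by move=> mf fr; apply: integrable_le_fun mf fr (integrable_cst_fun r). Qed.

Lemma integrable_addf (f g : Om -> R) : intg f -> intg g ->
  intg (fun x => f x + g x).
Proof. by move=> mf mg; exact: (integrableD _ mf mg). Qed.

Lemma integrable_scale (c : R) (f : Om -> R) : intg f -> intg (fun x => c * f x).
Proof. by move=> mf; exact: (integrableZl _ c mf). Qed.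

Lemma EFin_Rint (f : Om -> R) : intg f ->
  (\int[Q]_x (f x)%:E)%E = (\int[Q]_x f x)%:E.
Proof. by move=> mf; rewrite fineK//; exact: integrable_fin_num. Qed.

Lemma Rint_cst (r : R) : \int[Q]_(_ in setT) r = r.
Proof. rewrite Rintegral_cst//. by rewrite [X in fine X](@probability_setT _ _ _ Q) mulr1. Qed.

Lemma le_Rint (f g : Om -> R) : intg f -> intg g -> (forall x, f x <= g x) ->
  \int[Q]_x f x <= \int[Q]_x g x.
Proof. by move=> mf mg fg; exact: le_Rintegral. Qed.

Lemma RintD (f g : Om -> R) : intg f -> intg g ->
  \int[Q]_x (f x + g x) = \int[Q]_x f x + \int[Q]_x g x.
Proof. by move=> mf mg; rewrite RintegralD. Qed.

Lemma RintZ (c : R) (f : Om -> R) : intg f ->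
  \int[Q]_x (c * f x) = c * \int[Q]_x f x.
Proof. by move=> mf; rewrite RintegralZl. Qed.

Lemma prob_le_integral (A : set Om) (f : Om -> R) : measurable A ->
  measurable_fun setT f -> (forall x, 0 <= f x) -> (forall x, A x -> 1 <= f x) ->
  (Q A <= \int[Q]_x (f x)%:E)%E.
Proof.
move=> mA mf f0 f1; rewrite -[Q A]mul1e -integral_cst//.
apply: (@le_trans _ _ (\int[Q]_(x in A) (f x)%:E)%E).
  apply: ge0_le_integral => //.
  by apply/measurable_EFinP; exact: measurable_funTS.
apply: ge0_subset_integral => //; first exact/measurable_EFinP.
by move=> x _; rewrite lee_fin.
Qed.

(** Adding 1 makes both functions nonnegative; the extra terms of the expanded product cancel by
    linearity. *)
Lemma indep_bounded_Rint (f g : Om -> R) :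
  measurable_fun setT f -> measurable_fun setT g ->
  (forall x, `|f x| <= 1) -> (forall x, `|g x| <= 1) ->
  (forall A B, measurable A -> measurable B ->
     Q (f @^-1` A `&` g @^-1` B) = (Q (f @^-1` A) * Q (g @^-1` B))%E) ->
  \int[Q]_x (f x * g x) = (\int[Q]_x f x) * \int[Q]_x g x.
Proof.
move=> mf mg f1 g1 fg.
have if_ : intg f by exact: integrable_bounded f1.
have ig : intg g by exact: integrable_bounded g1.
have ic := integrable_cst_fun.
have mF : measurable_fun setT (fun x => f x + 1) by exact: measurable_funD.
have mG : measurable_fun setT (fun x => g x + 1) by exact: measurable_funD.
have iF : intg (fun x => f x + 1) by apply: integrable_addf => //; exact: ic.
have iG : intg (fun x => g x + 1) by apply: integrable_addf => //; exact: ic.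
have ifg : intg (fun x => f x * g x).
  apply: (@integrable_bounded _ 1); first exact: measurable_funM.
  by move=> x; rewrite normrM mulr_ile1.
have F0 x : 0 <= f x + 1 by have := f1 x; rewrite ler_norml => /andP[]; lra.
have G0 x : 0 <= g x + 1 by have := g1 x; rewrite ler_norml => /andP[]; lra.
have shift (h : Om -> R) A : (fun x => h x + 1) @^-1` A =
    h @^-1` ((fun y => y + 1) @^-1` A) by [].
have mshift A : measurable A -> measurable ((fun y : R => y + 1) @^-1` A).
  by move=> mA; rewrite -[X in measurable X]setTI; exact: measurable_funD.
have iFG : intg (fun x => (f x + 1) * (g x + 1)).
  apply: (@integrable_bounded _ 4); first exact: measurable_funM.
  move=> x; rewrite normrM !ger0_norm//.
  have := f1 x; have := g1 x; rewrite !ler_norml => /andP[g2 g3] /andP[f2 f3].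
  by rewrite (_ : 4 = 2 * 2 :> R) ?ler_pM//; lra.
have : (\int[Q]_x ((f x + 1) * (g x + 1)))%:E =
    ((\int[Q]_x (f x + 1))%:E * (\int[Q]_x (g x + 1))%:E)%E.
  rewrite -(EFin_Rint iFG) -(EFin_Rint iF) -(EFin_Rint iG).
  apply: indep_ge0_expectation => // A B mA mB.
  by rewrite !shift; apply: fg; exact: mshift.
rewrite -EFinM => -[].
rewrite !RintD ?Rint_cst//; try exact: ic.
have -> : \int[Q]_x ((f x + 1) * (g x + 1)) =
    \int[Q]_x (f x * g x) + (\int[Q]_x f x + (\int[Q]_x g x + 1)).
  rewrite -[X in _ + (_ + (_ + X))](Rint_cst 1) -!RintD//; try exact: ic.
  - by apply: eq_Rintegral => x _; ring.
  - by apply: integrable_addf => //; exact: iG.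
by move=> h; lra.
Qed.

Section ModSq.
Context (I : finType) (X : I -> Om -> R).
Context (mX : forall i, measurable_fun setT (X i)).
Context (indX : mutually_independent Q X).

Lemma indep_jmeas (J1 J2 : set I) (f g : Om -> R) : (forall i, J1 i -> ~ J2 i) ->
  jmeas X J1 f -> jmeas X J2 g -> forall A B, measurable A -> measurable B ->
  Q (f @^-1` A `&` g @^-1` B) = (Q (f @^-1` A) * Q (g @^-1` B))%E.
Proof.
move=> J12 mf mg A B mA mB; apply: (indep_sigma mX indX J12).
  by have := mf measurableT A mA; rewrite setTI.
by have := mg measurableT B mB; rewrite setTI.
Qed.

(** The map [blk] cuts the family into blocks: the identity gives one factor per variable
    ([mgf_lincomb]), the first projection one factor per row of a matrix ([small_ball]). *)
Lemma prod_expectation (K : eqType) (blk : I -> K) (h : K -> Om -> R) (s : seq K) :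
  (forall k, jmeas X [set i | blk i = k] (h k)) ->
  (forall k x, 0 <= h k x) -> uniq s ->
  (\int[Q]_x (\prod_(k <- s) h k x)%:E = \prod_(k <- s) \int[Q]_x (h k x)%:E)%E.
Proof.
move=> mh h0.
have mp (t : seq K) : jmeas X [set i | blk i \in t] (fun x => \prod_(k <- t) h k x).
  elim: t => [|k t IH].
    have -> : (fun x => \prod_(k <- [::]) h k x) = cst 1.
      by apply/funext => x; rewrite big_nil.
    exact: measurable_cst.
  have -> : (fun x => \prod_(k0 <- k :: t) h k0 x) =
      (fun x => h k x * \prod_(k0 <- t) h k0 x).
    by apply/funext => x; rewrite big_cons.
  apply: measurable_funM.
    by apply: jmeasS (mh k) => i /= ->; rewrite mem_head.
  by apply: jmeasS IH => i /=; rewrite inE orbC => ->.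
elim: s => [_|k s IH /= /andP[ks us]].
  under eq_integral do rewrite big_nil.
  by rewrite big_nil integral_cst// mul1e; exact: probability_setT.
rewrite big_cons -IH//; under eq_integral do rewrite big_cons.
apply: indep_ge0_expectation.
- exact: jmeas_measurable (mh k).
- exact: jmeas_measurable (mp s).
- exact: h0.
- by move=> x; apply: prodr_ge0.
- apply: indep_jmeas (mh k) (mp s) => i /= -> ks'; by rewrite ks' in ks.
Qed.

End ModSq.

(** The squared modulus of the characteristic function of [f] at frequency 1, written with real
    integrals only. *)
Definition modsq (f : Om -> R) : R :=
  (\int[Q]_x cos (f x)) ^+ 2 + (\int[Q]_x sin (f x)) ^+ 2.

Lemma measurable_cosf (f : Om -> R) : measurable_fun setT f ->
  measurable_fun setT (fun x => cos (f x)).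
Proof.
move=> mf; apply: measurableT_comp mf; apply: continuous_measurable_fun.
exact: continuous_cos.
Qed.

Lemma measurable_sinf (f : Om -> R) : measurable_fun setT f ->
  measurable_fun setT (fun x => sin (f x)).
Proof.
move=> mf; apply: measurableT_comp mf; apply: continuous_measurable_fun.
exact: continuous_sin.
Qed.

Lemma integrable_cosf (f : Om -> R) : measurable_fun setT f ->
  intg (fun x => cos (f x)).
Proof.
move=> /measurable_cosf mf; apply: (integrable_bounded mf) => x; exact: cos_max.
Qed.

Lemma integrable_sinf (f : Om -> R) : measurable_fun setT f ->
  intg (fun x => sin (f x)).
Proof.
move=> /measurable_sinf mf; apply: (integrable_bounded mf) => x; exact: sin_max.
Qed.

Lemma modsq_ge0 (f : Om -> R) : 0 <= modsq f.
Proof. by rewrite addr_ge0// sqr_ge0. Qed.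

(** A translation multiplies the characteristic function by a complex number of modulus 1. This is
    why the means never hinder anti-concentration. *)
Lemma modsq_shift (f : Om -> R) (a : R) : measurable_fun setT f ->
  modsq (fun x => a + f x) = modsq f.
Proof.
move=> mf; have ic := integrable_cosf mf; have is_ := integrable_sinf mf.
rewrite /modsq.
have -> : \int[Q]_x cos (a + f x) =
    cos a * \int[Q]_x cos (f x) + (- sin a) * \int[Q]_x sin (f x).
  rewrite -!RintZ// -RintD; [|exact: integrable_scale..].
  by apply: eq_Rintegral => x _; rewrite cosD; ring.
have -> : \int[Q]_x sin (a + f x) =
    sin a * \int[Q]_x cos (f x) + cos a * \int[Q]_x sin (f x).
  rewrite -!RintZ// -RintD; [|exact: integrable_scale..].
  by apply: eq_Rintegral => x _; rewrite sinD; ring.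
have := cos2Dsin2 a; set u := \int[Q]_x _; set v := \int[Q]_x _ => h.
transitivity ((cos a ^+ 2 + sin a ^+ 2) * (u ^+ 2 + v ^+ 2)); first by ring.
by rewrite h mul1r.
Qed.

Lemma sqr_Rint_le (f : Om -> R) : measurable_fun setT f ->
  (forall x, `|f x| <= 1) -> (\int[Q]_x f x) ^+ 2 <= \int[Q]_x (f x ^+ 2).
Proof.
move=> mf f1; set m := \int[Q]_x f x.
have if_ : intg f by exact: integrable_bounded f1.
have if2 : intg (fun x => f x ^+ 2).
  apply: (@integrable_bounded _ 1); first exact: measurable_funX.
  by move=> x; rewrite normrX expr_le1.
have : 0 <= \int[Q]_x (f x ^+ 2 + ((- 2 * m) * f x + m ^+ 2)).
  apply: Rintegral_ge0 => x _.
  by rewrite (_ : _ + _ = (f x - m) ^+ 2) ?sqr_ge0//; ring.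
rewrite RintD//; last first.
  apply: integrable_addf; [exact: integrable_scale|exact: integrable_cst_fun].
rewrite RintD; [|exact: integrable_scale|exact: integrable_cst_fun].
by rewrite RintZ// Rint_cst -/m; lra.
Qed.

Lemma modsq_le1 (f : Om -> R) : measurable_fun setT f -> modsq f <= 1.
Proof.
move=> mf; have mc := measurable_cosf mf; have ms := measurable_sinf mf.
have -> : 1 = \int[Q]_x (cos (f x) ^+ 2 + sin (f x) ^+ 2).
  by under eq_Rintegral do rewrite cos2Dsin2; rewrite Rint_cst.
rewrite RintD; first by apply: lerD; apply: sqr_Rint_le => // x;
  [exact: cos_max|exact: sin_max].
- apply: (@integrable_bounded _ 1); first exact: measurable_funX.
  by move=> x; rewrite normrX expr_le1// cos_max.
- apply: (@integrable_bounded _ 1); first exact: measurable_funX.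
  by move=> x; rewrite normrX expr_le1// sin_max.
Qed.

Lemma norm_Rint_cos_le (f : Om -> R) : `|\int[Q]_x cos (f x)| <= Num.sqrt (modsq f).
Proof. by rewrite -sqrtr_sqr ler_wsqrtr// lerDl sqr_ge0. Qed.

Section ModSqProd.
Context (I : finType) (X : I -> Om -> R).
Context (mX : forall i, measurable_fun setT (X i)).
Context (indX : mutually_independent Q X).

Lemma modsqD (J1 J2 : set I) (f g : Om -> R) : (forall i, J1 i -> ~ J2 i) ->
  jmeas X J1 f -> jmeas X J2 g ->
  modsq (fun x => f x + g x) = modsq f * modsq g.
Proof.
move=> J12 jf jg.
have mf := jmeas_measurable mX jf; have mg := jmeas_measurable mX jg.
have ind (u v : R -> R) : continuous u -> continuous v ->
    (forall x, `|u x| <= 1) -> (forall x, `|v x| <= 1) ->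
    \int[Q]_x (u (f x) * v (g x)) = (\int[Q]_x u (f x)) * \int[Q]_x v (g x).
  move=> /continuous_measurable_fun mu /continuous_measurable_fun mv u1 v1.
  apply: indep_bounded_Rint => //; [exact: measurableT_comp|exact: measurableT_comp|].
  move=> A B mA mB.
  apply: (indep_jmeas mX indX J12 jf jg (A := u @^-1` A) (B := v @^-1` B)).
    by rewrite -[X in measurable X]setTI; exact: mu.
  by rewrite -[X in measurable X]setTI; exact: mv.
have ib (u v : R -> R) : continuous u -> continuous v ->
    (forall x, `|u x| <= 1) -> (forall x, `|v x| <= 1) ->
    intg (fun x => u (f x) * v (g x)).
  move=> /continuous_measurable_fun mu /continuous_measurable_fun mv u1 v1.
  apply: (@integrable_bounded _ 1); last by move=> x; rewrite normrM mulr_ile1.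
  by apply: measurable_funM; exact: measurableT_comp.
have cc := @continuous_cos R; have cs := @continuous_sin R.
have c1 := @cos_max R; have s1 := @sin_max R.
rewrite /modsq.
have -> : \int[Q]_x cos (f x + g x) =
  (\int[Q]_x cos (f x)) * (\int[Q]_x cos (g x)) -
  (\int[Q]_x sin (f x)) * (\int[Q]_x sin (g x)).
  rewrite -!ind// -RintegralB//; [|exact: ib..].
  by apply: eq_Rintegral => x _; rewrite cosD.
have -> : \int[Q]_x sin (f x + g x) =
  (\int[Q]_x sin (f x)) * (\int[Q]_x cos (g x)) +
  (\int[Q]_x cos (f x)) * (\int[Q]_x sin (g x)).
  rewrite -!ind// -RintD//; [|exact: ib..].
  by apply: eq_Rintegral => x _; rewrite sinD.
ring.
Qed.

Lemma jmeas_lincomb (s : seq I) (c : I -> R) :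
  jmeas X [set i | i \in s] (fun x => \sum_(i <- s) c i * X i x).
Proof.
elim: s => [|i s IH].
  have -> : (fun x => \sum_(i <- [::]) c i * X i x) = cst 0.
    by apply/funext => x; rewrite big_nil.
  exact: measurable_cst.
have -> : (fun x => \sum_(j <- i :: s) c j * X j x) =
    (fun x => c i * X i x + \sum_(j <- s) c j * X j x).
  by apply/funext => x; rewrite big_cons.
apply: measurable_funD.
  apply: measurable_funM; first exact: measurable_cst.
  by apply: jmeasX => /=; rewrite mem_head.
by apply: jmeasS IH => j /=; rewrite inE orbC => ->.
Qed.

Lemma modsq_lincomb (s : seq I) (c : I -> R) : uniq s ->
  modsq (fun x => \sum_(i <- s) c i * X i x) =
  \prod_(i <- s) modsq (fun x => c i * X i x).
Proof.
elim: s => [_|i s IH /= /andP[is_ us]].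
  rewrite big_nil /modsq; under eq_Rintegral do rewrite big_nil cos0.
  under [in X in _ + X ^+ 2]eq_Rintegral do rewrite big_nil sin0.
  by rewrite !Rint_cst expr1n expr0n addr0.
rewrite big_cons -IH//.
have -> : (fun x => \sum_(j <- i :: s) c j * X j x) =
    (fun x => c i * X i x + \sum_(j <- s) c j * X j x).
  by apply/funext => x; rewrite big_cons.
apply: (@modsqD [set i] [set j | j \in s]).
- by move=> j /= -> js; rewrite js in is_.
- apply: measurable_funM; first exact: measurable_cst.
  by apply: jmeasX.
- exact: jmeas_lincomb.
Qed.

End ModSqProd.

End Expectation.

(** * Sub-Gaussian variables and their linear combinations *)

Section SubGaussian.
Context {d : measure_display} {Om : measurableType d} {R : realType}.
Context (Q : probability Om R).
Local Notation intg f := (Q.-integrable [set: Om] (EFin \o f)).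

(** The exponential bound is required at [K] itself, rather than at scales tending to an infimum as
    in [psi2_norm]. *)
Definition centered_subgauss (K : R) (X : Om -> R) : Prop :=
  [/\ measurable_fun setT X,
      (\int[Q]_w (expR (X w ^+ 2 / K ^+ 2))%:E <= 2%:E)%E &
      \int[Q]_w X w = 0].

Section OneVariable.
Context (K : R) (K0 : 0 < K) (X : Om -> R) (hX : centered_subgauss K X).

Let G w := expR (X w ^+ 2 / K ^+ 2).

Let mX : measurable_fun setT X. Proof. by case: hX. Qed.

Lemma measurable_expf (f : Om -> R) : measurable_fun setT f ->
  measurable_fun setT (fun w => expR (f w)).
Proof. by move=> mf; exact: measurableT_comp. Qed.

Lemma integrable_subgauss_exp : intg G.
Proof.
have mG : measurable_fun setT G.
  apply: measurable_expf; apply: measurable_funM; first exact: measurable_funX.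
  exact: measurable_cst.
apply/integrableP; split; first exact/measurable_EFinP.
under eq_integral do rewrite /= ger0_norm ?expR_ge0//.
by case: hX => _ /le_lt_trans h _; apply: h; rewrite ltry.
Qed.

Lemma Rint_subgauss_exp : \int[Q]_w G w <= 2.
Proof. by rewrite -lee_fin -(EFin_Rint integrable_subgauss_exp); case: hX. Qed.

Lemma integrable_dom (f : Om -> R) (c : R) : measurable_fun setT f ->
  (forall w, `|f w| <= c * G w) -> intg f.
Proof.
move=> mf fG; apply: integrable_le_fun mf fG _.
exact: integrable_scale integrable_subgauss_exp.
Qed.

Let XG w : X w ^+ 2 <= K ^+ 2 * G w.
Proof.
rewrite mulrC -ler_pdivrMr ?exprn_gt0//.
by rewrite (le_trans _ (expR_ge1Dx _))// lerDr.
Qed.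

Lemma integrable_subgauss : intg X.
Proof.
apply: (@integrable_dom _ (1 + K ^+ 2)) => // w.
have G1 : 1 <= G w by rewrite -expR0 ler_expR divr_ge0// sqr_ge0.
have := XG w; have : `|X w| <= 1 + X w ^+ 2.
  by rewrite -real_normK ?num_real//; have := sqr_ge0 (`|X w| - 1); nra.
by nra.
Qed.

Lemma integrable_subgauss_sqr : intg (fun w => X w ^+ 2).
Proof.
apply: (@integrable_dom _ (K ^+ 2)); first exact: measurable_funX.
by move=> w; rewrite ger0_norm ?sqr_ge0.
Qed.

Let X4G w : X w ^+ 4 <= 2 * K ^+ 4 * G w.
Proof.
have := expR_sqr_ge4 (X w / K); rewrite !expr_div_n -/(G w).
by rewrite ler_pdivrMr ?exprn_gt0// mulrAC.
Qed.

Lemma integrable_subgauss_pow4 : intg (fun w => X w ^+ 4).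
Proof.
apply: (@integrable_dom _ (2 * K ^+ 4)); first exact: measurable_funX.
by move=> w; rewrite ger0_norm ?exprn_even_ge0.
Qed.

Lemma Rint_subgauss_pow4 : \int[Q]_w X w ^+ 4 <= 4 * K ^+ 4.
Proof.
apply: (@le_trans _ _ (\int[Q]_w (2 * K ^+ 4 * G w))).
  apply: le_Rint => //; first exact: integrable_subgauss_pow4.
  exact: integrable_scale integrable_subgauss_exp.
rewrite RintZ; last exact: integrable_subgauss_exp.
have := Rint_subgauss_exp; have : 0 < K ^+ 4 by rewrite exprn_gt0.
by nra.
Qed.

Lemma integrable_subgauss_expf (s : R) : intg (fun w => expR (s * X w)).
Proof.
apply: (@integrable_dom _ (expR (s ^+ 2 * K ^+ 2))).
  by apply: measurable_expf; apply: measurable_funM => //; exact: measurable_cst.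
move=> w; rewrite ger0_norm ?expR_ge0// -expRD ler_expR.
have -> : X w ^+ 2 / K ^+ 2 = (X w / K) ^+ 2 by rewrite expr_div_n.
have -> : s * X w = (s * K) * (X w / K) by field; rewrite gt_eqF.
by have := sqr_ge0 (s * K - X w / K); have := sqr_ge0 (s * K + X w / K); nra.
Qed.

(** Two ranges of [t = 2 s^2 K^2]. For [t <= 1], [expR_le_quad] and the zero mean leave the
    exponential of [t X^2 / K^2], to which [expR_interp] applies. For [t > 1], it suffices that
    [s X <= s^2 K^2 / 2 + X^2 / (2 K^2)], the remaining factor [3 / 2] being at most
    [exp (t / 2)]. *)
Lemma mgf_subgauss (s : R) :
  \int[Q]_w expR (s * X w) <= expR (2 * s ^+ 2 * K ^+ 2).
Proof.
have iG := integrable_subgauss_exp; have G2 := Rint_subgauss_exp.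
have sK w : (s * X w) ^+ 2 = s ^+ 2 * K ^+ 2 * (X w ^+ 2 / K ^+ 2).
  by field; rewrite gt_eqF.
set t := 2 * s ^+ 2 * K ^+ 2.
have t0 : 0 <= t by apply: mulr_ge0; [apply: mulr_ge0 => //|]; exact: sqr_ge0.
have [t1|t1] := leP t 1.
  apply: (@le_trans _ _ (\int[Q]_w (s * X w + ((1 - t) + t * G w)))).
    apply: le_Rint; first exact: integrable_subgauss_expf.
      apply: integrable_addf; first exact: integrable_scale integrable_subgauss.
      apply: integrable_addf; first exact: integrable_cst_fun.
      exact: integrable_scale iG.
    move=> w; rewrite (le_trans (expR_le_quad _))// lerD2l sK.
    have := @expR_interp _ t (X w ^+ 2 / K ^+ 2); rewrite t0 t1 => /(_ isT).
    rewrite /t /G; set e := expR (X w ^+ 2 / K ^+ 2) => h.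
    have -> : 2 * (s ^+ 2 * K ^+ 2 * (X w ^+ 2 / K ^+ 2)) =
      2 * s ^+ 2 * K ^+ 2 * (X w ^+ 2 / K ^+ 2) by ring.
    by lra.
  rewrite RintD; last 2 first.
  - exact: integrable_scale integrable_subgauss.
  - apply: integrable_addf; first exact: integrable_cst_fun.
    exact: integrable_scale iG.
  rewrite RintD; [|exact: integrable_cst_fun|exact: integrable_scale iG].
  rewrite !RintZ//; last exact: integrable_subgauss.
  case: hX => _ _ ->; rewrite mulr0 add0r Rint_cst.
  have := expR_ge1Dx t; set e := expR t => et.
  by nra.
apply: (@le_trans _ _ (\int[Q]_w (expR (t / 4) * (1 / 2 + 1 / 2 * G w)))).
  apply: le_Rint; first exact: integrable_subgauss_expf.
    apply: integrable_scale; apply: integrable_addf; first exact: integrable_cst_fun.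
    exact: integrable_scale iG.
  move=> w.
  have h1 : s * X w <= t / 4 + 1 / 2 * (X w ^+ 2 / K ^+ 2).
    have -> : X w ^+ 2 / K ^+ 2 = (X w / K) ^+ 2 by rewrite expr_div_n.
    have -> : s * X w = (s * K) * (X w / K) by field; rewrite gt_eqF.
    rewrite /t; have -> : 2 * s ^+ 2 * K ^+ 2 = 2 * (s * K) ^+ 2 by ring.
    by have := sqr_ge0 (s * K - X w / K); nra.
  apply: (@le_trans _ _ (expR (t / 4 + 1 / 2 * (X w ^+ 2 / K ^+ 2)))).
    by rewrite ler_expR.
  rewrite expRD ler_pM2l ?expR_gt0//.
  have := @expR_interp _ (1 / 2) (X w ^+ 2 / K ^+ 2).
  have -> : (0 <= 1 / 2 :> R) && (1 / 2 <= 1 :> R) by apply/andP; split; lra.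
  by move=> /(_ isT); rewrite -/(G w); lra.
rewrite RintZ; last first.
  apply: integrable_addf; first exact: integrable_cst_fun.
  exact: integrable_scale iG.
rewrite RintD; [|exact: integrable_cst_fun|exact: integrable_scale iG].
rewrite Rint_cst RintZ//.
apply: (@le_trans _ _ (expR (t / 4) * expR (t / 2))); last first.
  by rewrite -expRD ler_expR; lra.
rewrite ler_pM2l ?expR_gt0//.
by have := expR_ge1Dx (t / 2); lra.
Qed.

(** Taylor expansion with [a = t^2 v]: the cosine integral is at most [1 - a / 2 + b], where [b]
    bounds the fourth-order term and [b <= a / 12]. The sine integral is at most [a] because [X] is
    centered, so its square is at most [a / 8]. *)
Lemma modsq_subgauss (v t : R) : 0 < v -> \int[Q]_w X w ^+ 2 = v ->
  t ^+ 2 * v <= 1 / 8 -> t ^+ 2 * K ^+ 4 <= v / 2 ->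
  modsq Q (fun w => t * X w) <= expR (- (t ^+ 2 * v) / 2).
Proof.
move=> v0 vE tv tK.
have mtX : measurable_fun setT (fun w => t * X w).
  by apply: measurable_funM => //; exact: measurable_cst.
have ic := integrable_cosf Q mtX; have is_ := integrable_sinf Q mtX.
have i1 := integrable_subgauss; have i2 := integrable_subgauss_sqr.
have i4 := integrable_subgauss_pow4.
set a := t ^+ 2 * v; set b := t ^+ 4 / 24 * (4 * K ^+ 4).
have t20 : 0 <= t ^+ 2 by exact: sqr_ge0.
have cu : \int[Q]_w cos (t * X w) <= 1 - a / 2 + b.
  apply: (@le_trans _ _ (\int[Q]_w (1 + ((- t ^+ 2 / 2) * X w ^+ 2 +
      (t ^+ 4 / 24) * X w ^+ 4)))).
    apply: le_Rint => //.
      apply: integrable_addf; first exact: integrable_cst_fun.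
      by apply: integrable_addf; exact: integrable_scale.
    by move=> w; rewrite (le_trans (cos_le_quartic _))// !exprMn; lra.
  rewrite RintD; [|exact: integrable_cst_fun|]; last first.
    by apply: integrable_addf; exact: integrable_scale.
  rewrite RintD; [|exact: integrable_scale..].
  rewrite !RintZ// Rint_cst vE.
  have h4 : t ^+ 4 / 24 * \int[Q]_w X w ^+ 4 <= b.
    apply: ler_wpM2l Rint_subgauss_pow4.
    by rewrite divr_ge0// exprn_even_ge0.
  by rewrite /a; lra.
(* This makes the cosine integral nonnegative, so that its upper bound can be squared. *)
have cl : 1 - a / 2 <= \int[Q]_w cos (t * X w).
  apply: (@le_trans _ _ (\int[Q]_w (1 + (- t ^+ 2 / 2) * X w ^+ 2))).
    rewrite RintD; [|exact: integrable_cst_fun|exact: integrable_scale].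
    by rewrite RintZ// Rint_cst vE /a; lra.
  apply: le_Rint => //.
    by apply: integrable_addf; [exact: integrable_cst_fun|exact: integrable_scale].
  by move=> w; rewrite (le_trans _ (cos_ge_quad _))// exprMn; lra.
have su : `|\int[Q]_w sin (t * X w)| <= a.
  have -> : \int[Q]_w sin (t * X w) = \int[Q]_w (sin (t * X w) + (- t) * X w).
    by rewrite RintD//; [rewrite RintZ//; case: hX => _ _ ->; rewrite mulr0 addr0|
      exact: integrable_scale].
  have isub : intg (fun w => sin (t * X w) + (- t) * X w).
    by apply: integrable_addf => //; exact: integrable_scale.
  apply: (le_trans (le_normr_Rintegral measurableT isub)).
  apply: (@le_trans _ _ (\int[Q]_w (t ^+ 2 * X w ^+ 2))).
    apply: le_Rint; [exact: integrable_norm|exact: integrable_scale|].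
    by move=> w; rewrite mulNr -exprMn sin_sub_le.
  by rewrite RintZ// vE.
have a0 : 0 <= a by rewrite mulr_ge0// ltW.
have b0 : 0 <= b by apply: mulr_ge0; [apply: divr_ge0 => //|apply: mulr_ge0 => //]; exact: exprn_even_ge0.
have ba : b <= a / 12.
  rewrite /b /a; have -> : t ^+ 4 / 24 * (4 * K ^+ 4) =
    t ^+ 2 * (t ^+ 2 * K ^+ 4) / 6 by field.
  by have := ler_wpM2l t20 tK; lra.
apply: (@le_trans _ _ (1 - a / 2)); last first.
  by rewrite (le_trans _ (expR_ge1Dx _))//; lra.
rewrite /modsq.
rewrite -/a in tv.
have h1 : (\int[Q]_w cos (t * X w)) ^+ 2 <= (1 - a / 2 + b) ^+ 2.
  by rewrite ler_sqr ?nnegrE//; lra.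
have h2 : (\int[Q]_w sin (t * X w)) ^+ 2 <= a ^+ 2.
  by rewrite -real_normK ?num_real// ler_sqr ?nnegrE.
apply: (le_trans (lerD h1 h2)).
have -> : (1 - a / 2 + b) ^+ 2 + a ^+ 2 =
  1 - a + 2 * b + (a * a * (5 / 4) - a * b + b * b) by field.
have : a * a <= a / 8 by rewrite [leRHS]mulrC -{1}[a]mul1r ler_wpM2r//; lra.
have : b * b <= b by rewrite -{3}[b]mul1r ler_wpM2r//; lra.
have : 0 <= a * b by exact: mulr_ge0.
by lra.
Qed.

End OneVariable.

Section Family.
Context (K : R) (K0 : 0 < K).
Context (I : finType) (X : I -> Om -> R).
Context (hX : forall i, centered_subgauss K (X i)).
Context (indX : mutually_independent Q X).

Let mX i : measurable_fun setT (X i). Proof. by case: (hX i). Qed.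

Definition lincomb (c : I -> R) (w : Om) := \sum_i c i * X i w.

Lemma measurable_lincomb (c : I -> R) : measurable_fun setT (lincomb c).
Proof.
apply: measurable_sum => i; apply: measurable_funM => //; exact: measurable_cst.
Qed.

Lemma mgf_lincomb (c : I -> R) :
  (\int[Q]_w (expR (lincomb c w))%:E <= (expR (2 * K ^+ 2 * \sum_i c i ^+ 2))%:E)%E.
Proof.
under eq_integral do rewrite /lincomb expR_sum.
rewrite (prod_expectation mX indX (blk := id) (h := fun i w => expR (c i * X i w))).
- rewrite mulr_sumr expR_sum.
  have : forall s : seq I, (0 <= \prod_(i <- s) \int[Q]_w (expR (c i * X i w))%:E <=
      (\prod_(i <- s) expR (2 * K ^+ 2 * c i ^+ 2))%:E)%E.
    elim=> [|i s /andP[IH0 IH1]]; first by rewrite !big_nil lee01 lexx.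
    rewrite !big_cons mule_ge0//=; last first.
      by apply: integral_ge0 => w _; rewrite lee_fin expR_ge0.
    rewrite EFinM lee_pmul//.
      by apply: integral_ge0 => w _; rewrite lee_fin expR_ge0.
    rewrite (EFin_Rint (integrable_subgauss_expf K0 (hX i) _)) lee_fin.
    by rewrite (le_trans (mgf_subgauss K0 (hX i) _))// ler_expR; lra.
  by move=> /(_ (index_enum I))/andP[].
- move=> i; apply: (measurableT_comp (f := expR)) => //.
  apply: measurable_funM; first exact: measurable_cst.
  exact: jmeasX.
- by move=> i w; exact: expR_ge0.
- exact: index_enum_uniq.
Qed.

(** From [y^2 <= 2 (e^y + e^-y)] at [y = lincomb c w / a] with [a = K sqrt V], for which both
    exponential moments are at most [e^2]. The case [V = 0] is separate because of the division by
    [a]. *)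
Lemma sqr_lincomb (c : I -> R) :
  (\int[Q]_w (lincomb c w ^+ 2)%:E <= (4 * expR 2 * K ^+ 2 * \sum_i c i ^+ 2)%:E)%E.
Proof.
set V := \sum_i c i ^+ 2.
have V0 : 0 <= V by apply: sumr_ge0 => i _; exact: sqr_ge0.
move: V0; rewrite le_eqVlt => /predU1P[V0|V0].
  rewrite -V0 mulr0.
  under eq_integral => w _.
    rewrite /lincomb big1 ?expr0n/=; last first.
      move=> i _; have /eqP : V = 0 by [].
      rewrite psumr_eq0; last by move=> *; exact: sqr_ge0.
      by move=> /allP/(_ i (mem_index_enum _)); rewrite sqrf_eq0 => /eqP ->; rewrite mul0r.
    over.
  by rewrite integral0.
set a := K * Num.sqrt V.
have a0 : 0 < a by rewrite mulr_gt0// sqrtr_gt0.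
have aE : a ^+ 2 = K ^+ 2 * V by rewrite exprMn sqr_sqrtr// ltW.
have lE b w : lincomb c w * b = lincomb (fun i => c i * b) w.
  by rewrite /lincomb mulr_suml; apply: eq_bigr => i _; rewrite mulrAC.
apply: (@le_trans _ _ (\int[Q]_w ((2 * a ^+ 2)%:E *
   ((expR (lincomb (fun i => c i * a^-1) w))%:E +
    (expR (lincomb (fun i => c i * - a^-1) w))%:E)))%E).
  apply: ge0_le_integral => //.
  - by move=> w _; rewrite lee_fin sqr_ge0.
  - by apply/measurable_EFinP; apply: measurable_funX; exact: measurable_lincomb.
  - apply/measurable_EFinP; apply: measurable_funM; first exact: measurable_cst.
    by apply: measurable_funD; apply: measurable_expf; exact: measurable_lincomb.
  - move=> w _; rewrite -!lE -EFinD -EFinM lee_fin.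
    rewrite -mulrA mulrCA -ler_pdivrMl ?exprn_gt0// mulrC -expr_div_n mulrN expRN.
    set y := lincomb c w / a.
    wlog y0 : y / 0 <= y => [hw|].
      have [/hw//|/ltW y0] := leP 0 y.
      by have := hw (- y); rewrite oppr_ge0 sqrrN expRN invrK addrC; exact.
    have ey : 0 <= (expR y)^-1 by rewrite invr_ge0 expR_ge0.
    have := expR_ge1Dxn 1 y0; rewrite (_ : 2`!%:R = 2)// => h1.
    by lra.
rewrite ge0_integralZl//; last 3 first.
- by apply/measurable_EFinP; apply: measurable_funD; apply: measurable_expf;
    exact: measurable_lincomb.
- by move=> w _; rewrite adde_ge0// lee_fin expR_ge0.
- by rewrite lee_fin mulr_ge0// sqr_ge0.
rewrite ge0_integralD//; last 2 first.
- by apply/measurable_EFinP; apply: measurable_expf; exact: measurable_lincomb.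
- by apply/measurable_EFinP; apply: measurable_expf; exact: measurable_lincomb.
have h b : b ^+ 2 = a ^- 2 ->
    (\int[Q]_w (expR (lincomb (fun i => (c i * b)%R) w))%:E <= (expR 2)%:E)%E.
  move=> bE; apply: (le_trans (mgf_lincomb _)); rewrite lee_fin ler_expR.
  have -> : \sum_i (c i * b) ^+ 2 = V * b ^+ 2.
    by rewrite /V mulr_suml; apply: eq_bigr => i _; rewrite exprMn.
  rewrite bE aE (_ : 2 * K ^+ 2 * (V / (K ^+ 2 * V)) = 2)//; field.
  by rewrite !gt_eqF.
apply: (@le_trans _ _ ((2 * a ^+ 2)%:E * ((expR 2)%:E + (expR 2)%:E))%E).
  apply: lee_pmul => //.
  - by rewrite lee_fin mulr_ge0// sqr_ge0.
  - by rewrite adde_ge0//; apply: integral_ge0 => w _; rewrite lee_fin expR_ge0.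
  - by apply: leeD; apply: h; rewrite ?sqrrN exprVn.
by rewrite -EFinD -EFinM lee_fin aE; lra.
Qed.

(** Only the coefficients in [P] are small enough for the expansion of [modsq_subgauss]; the other
    factors are bounded by 1. *)
Lemma modsq_lincomb_subgauss (v : R) (c : I -> R) (P : pred I) : 0 < v ->
  (forall i, \int[Q]_w X i w ^+ 2 = v) ->
  (forall i, P i -> c i ^+ 2 * v <= 1 / 8 /\ c i ^+ 2 * K ^+ 4 <= v / 2) ->
  modsq Q (lincomb c) <= expR (- (v / 2) * \sum_(i | P i) c i ^+ 2).
Proof.
move=> v0 vE hP.
rewrite (modsq_lincomb mX indX)//; last exact: index_enum_uniq.
rewrite mulr_sumr expR_sum (bigID P) /=.
have mt i : measurable_fun setT (fun w => c i * X i w).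
  by apply: measurable_funM => //; exact: measurable_cst.
rewrite -[leRHS]mulr1 ler_pM//.
- by apply: prodr_ge0 => i _; exact: modsq_ge0.
- by apply: prodr_ge0 => i _; exact: modsq_ge0.
- apply: ler_prod => i /hP[h1 h2]; rewrite modsq_ge0/=.
  by rewrite (le_trans (modsq_subgauss K0 (hX i) v0 (vE i) h1 h2))// ler_expR; lra.
- apply: prodr_ile1 => i _; rewrite modsq_ge0/=; exact: modsq_le1.
Qed.

End Family.

End SubGaussian.

(** * Vectors and singular values *)

Section Vectors.
Context {R : realType}.

Section Dot.
Context {n : nat}.
Implicit Types x y z : 'cV[R]_n.

Definition dot x y : R := \sum_i x i 0 * y i 0.
Definition nsq x : R := dot x x.
Definition nrm x : R := Num.sqrt (nsq x).

Lemma dotC x y : dot x y = dot y x.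
Proof. by apply: eq_bigr => i _; rewrite mulrC. Qed.

Lemma dotDl x y z : dot (x + y) z = dot x z + dot y z.
Proof. by rewrite /dot -big_split; apply: eq_bigr => i _; rewrite mxE mulrDl. Qed.

Lemma dotZl a x y : dot (a *: x) y = a * dot x y.
Proof. by rewrite /dot mulr_sumr; apply: eq_bigr => i _; rewrite mxE mulrA. Qed.

Lemma dotNl x y : dot (- x) y = - dot x y.
Proof. by rewrite -scaleN1r dotZl mulN1r. Qed.

Lemma dotBl x y z : dot (x - y) z = dot x z - dot y z.
Proof. by rewrite dotDl dotNl. Qed.

Lemma dotDr x y z : dot x (y + z) = dot x y + dot x z.
Proof. by rewrite dotC dotDl !(dotC x). Qed.

Lemma dotZr a x y : dot x (a *: y) = a * dot x y.
Proof. by rewrite dotC dotZl dotC. Qed.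

Lemma dotNr x y : dot x (- y) = - dot x y.
Proof. by rewrite dotC dotNl dotC. Qed.

Lemma dotBr x y z : dot x (y - z) = dot x y - dot x z.
Proof. by rewrite dotDr dotNr. Qed.

Lemma dot0l x : dot 0 x = 0.
Proof. by rewrite /dot big1// => i _; rewrite mxE mul0r. Qed.

Lemma dot0r x : dot x 0 = 0.
Proof. by rewrite dotC dot0l. Qed.

Lemma dot_suml (L : Type) (r : seq L) (P : pred L) (F : L -> 'cV[R]_n) x :
  dot (\sum_(l <- r | P l) F l) x = \sum_(l <- r | P l) dot (F l) x.
Proof. by elim/big_rec2: _ => [|l u v _ <-]; rewrite ?dot0l ?dotDl. Qed.

Lemma dot_sumr (L : Type) (r : seq L) (P : pred L) (F : L -> 'cV[R]_n) x :
  dot x (\sum_(l <- r | P l) F l) = \sum_(l <- r | P l) dot x (F l).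
Proof. by rewrite dotC dot_suml; apply: eq_bigr => l _; rewrite dotC. Qed.

Lemma nsqE x : nsq x = \sum_i x i 0 ^+ 2.
Proof. by []. Qed.

Lemma nsq_ge0 x : 0 <= nsq x.
Proof. by apply: sumr_ge0 => i _; exact: sqr_ge0. Qed.

Lemma nrm_ge0 x : 0 <= nrm x. Proof. exact: sqrtr_ge0. Qed.

Lemma sqr_nrm x : nrm x ^+ 2 = nsq x.
Proof. by rewrite sqr_sqrtr// nsq_ge0. Qed.

Lemma nsq_eq0 x : (nsq x == 0) = (x == 0).
Proof.
apply/idP/eqP => [|->]; last by rewrite /nsq dot0l.
rewrite nsqE psumr_eq0; last by move=> i _; exact: sqr_ge0.
move=> /allP x0; apply/colP => i; rewrite mxE.
by have := x0 i (mem_index_enum i); rewrite /= sqrf_eq0 => /eqP.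
Qed.

Lemma nrm_eq0 x : (nrm x == 0) = (x == 0).
Proof. by rewrite sqrtr_eq0 -nsq_eq0 eq_le nsq_ge0 andbT. Qed.

Lemma nrm_gt0 x : (0 < nrm x) = (x != 0).
Proof. by rewrite lt0r nrm_ge0 andbT nrm_eq0. Qed.

Lemma nrm0 : nrm 0 = 0.
Proof. by apply/eqP; rewrite nrm_eq0. Qed.

Lemma nsqZ a x : nsq (a *: x) = a ^+ 2 * nsq x.
Proof. by rewrite /nsq dotZl dotZr mulrA. Qed.

Lemma nrmZ a x : nrm (a *: x) = `|a| * nrm x.
Proof. by rewrite /nrm nsqZ sqrtrM ?sqr_ge0// sqrtr_sqr. Qed.

Lemma nrmN x : nrm (- x) = nrm x.
Proof. by rewrite -scaleN1r nrmZ normrN1 mul1r. Qed.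

Lemma dot_le x y : dot x y <= nrm x * nrm y.
Proof.
have [->|y0] := eqVneq y 0; first by rewrite dot0r nrm0 mulr0.
have ny : 0 < nsq y by rewrite lt0r nsq_eq0 y0 nsq_ge0.
have [xy|/ltW xy] := leP (dot x y) 0.
  by rewrite (le_trans xy)// mulr_ge0// nrm_ge0.
rewrite -(@ler_sqr _ (dot x y)) ?nnegrE ?mulr_ge0 ?nrm_ge0//.
rewrite exprMn !sqr_nrm -subr_ge0 -(pmulr_rge0 _ ny).
have := nsq_ge0 (nsq y *: x - dot x y *: y).
rewrite {1}/nsq dotBl !dotBr !dotZl !dotZr (dotC y x) -!/(nsq _) => h.
by apply: (le_trans h); rewrite le_eqVlt; apply/orP; left; apply/eqP; ring.
Qed.

Lemma normr_dot_le x y : `|dot x y| <= nrm x * nrm y.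
Proof.
by rewrite ler_norml dot_le andbT lerNl -dotNl -(nrmN x) dot_le.
Qed.

Lemma nrmD x y : nrm (x + y) <= nrm x + nrm y.
Proof.
rewrite -ler_sqr ?nnegrE ?nrm_ge0// ?addr_ge0 ?nrm_ge0//.
rewrite sqr_nrm {1}/nsq dotDl !dotDr (dotC y x) -!/(nsq _) -!sqr_nrm.
by have := dot_le x y; lra.
Qed.

Lemma nrmB x y : nrm (x - y) <= nrm x + nrm y.
Proof. by rewrite -(nrmN y) nrmD. Qed.

Lemma nrm_sub_ge x y : nrm x - nrm y <= nrm (x + y).
Proof. by rewrite lerBlDr -(nrmN y) -{1}[x](addrK y) nrmD. Qed.

Lemma nrm_le_of_nsq x a : 0 <= a -> nsq x <= a ^+ 2 -> nrm x <= a.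
Proof. by move=> a0; rewrite -sqr_nrm ler_sqr// nnegrE nrm_ge0. Qed.

End Dot.

Lemma dot_mulmx p q (A : 'M[R]_(p, q)) x y : dot (A *m x) y = dot x (A^T *m y).
Proof.
rewrite /dot; under eq_bigr do rewrite mxE mulr_suml.
rewrite exchange_big; apply: eq_bigr => j _; rewrite mxE mulr_sumr.
by apply: eq_bigr => i _; rewrite mxE; ring.
Qed.

Definition opbound p q (A : 'M[R]_(p, q)) (w : R) :=
  forall x, nrm (A *m x) <= w * nrm x.

Lemma opbound_bilin p q (A : 'M[R]_(p, q)) w : 0 <= w ->
  (forall x y, dot (A *m x) y <= w * nrm x * nrm y) -> opbound A w.
Proof.
move=> w0 h x; have [->|x0] := eqVneq (A *m x) 0; last first.
  by have := h x (A *m x); rewrite -[dot _ _]sqr_nrm expr2 ler_pM2r ?nrm_gt0.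
by rewrite nrm0 mulr_ge0// nrm_ge0.
Qed.

Lemma opbound_tr p q (A : 'M[R]_(p, q)) w : 0 <= w -> opbound A w -> opbound A^T w.
Proof.
move=> w0 h; apply: opbound_bilin => // x y; rewrite dot_mulmx trmxK.
rewrite (le_trans (dot_le _ _))//.
by rewrite -mulrA mulrCA ler_wpM2l ?nrm_ge0.
Qed.

Section Orthonormal.
Context (n : nat) (L : finType) (f : L -> 'cV[R]_n).
Context (fo : forall k l, dot (f k) (f l) = (k == l)%:R).

Lemma dot_comb (P : pred L) (c : L -> R) k :
  dot (f k) (\sum_(l | P l) c l *: f l) = if P k then c k else 0.
Proof.
rewrite dot_sumr; under eq_bigr do rewrite dotZr fo.
case: ifPn => Pk; last first.
  rewrite big1// => l Pl; case: eqP => [kl|]; last by rewrite mulr0.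
  by rewrite -kl (negPf Pk) in Pl.
rewrite (bigD1 k)//= eqxx mulr1 big1 ?addr0// => l /andP[_ lk].
by rewrite eq_sym (negPf lk) mulr0.
Qed.

Lemma nsq_comb (P : pred L) (c : L -> R) :
  nsq (\sum_(l | P l) c l *: f l) = \sum_(l | P l) c l ^+ 2.
Proof.
rewrite {1}/nsq dot_suml; apply: eq_bigr => l Pl.
by rewrite dotZl dot_comb Pl.
Qed.

Definition proj (P : pred L) (x : 'cV[R]_n) := \sum_(l | P l) dot (f l) x *: f l.

Lemma dot_proj P x y : dot (proj P x) y = dot x (proj P y).
Proof.
rewrite dot_suml dot_sumr; apply: eq_bigr => l _.
by rewrite dotZl dotZr (dotC x) mulrC.
Qed.

Lemma nsq_proj P x : nsq (proj P x) = \sum_(l | P l) dot (f l) x ^+ 2.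
Proof. exact: nsq_comb. Qed.

Lemma dot_proj_self P x : dot x (proj P x) = nsq (proj P x).
Proof.
rewrite nsq_proj dot_sumr; apply: eq_bigr => l _.
by rewrite dotZr (dotC x).
Qed.

Lemma nsq_subproj P x : nsq (x - proj P x) = nsq x - nsq (proj P x).
Proof.
rewrite {1}/nsq dotBl !dotBr -!/(nsq _) dot_proj_self (dotC (proj P x)).
by rewrite dot_proj_self; ring.
Qed.

Lemma bessel P x : \sum_(l | P l) dot (f l) x ^+ 2 <= nsq x.
Proof. by rewrite -nsq_proj -subr_ge0 -nsq_subproj nsq_ge0. Qed.

Lemma nrm_subproj P x : nrm (x - proj P x) <= nrm x.
Proof. by rewrite ler_wsqrtr// nsq_subproj gerBl nsq_ge0. Qed.

Lemma dot_f_proj P x k : dot (f k) (proj P x) = if P k then dot (f k) x else 0.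
Proof. exact: dot_comb. Qed.

Lemma projD P x y : proj P (x + y) = proj P x + proj P y.
Proof.
by rewrite /proj -big_split; apply: eq_bigr => l _; rewrite dotDr scalerDl.
Qed.

Lemma projN P x : proj P (- x) = - proj P x.
Proof.
by rewrite /proj -sumrN; apply: eq_bigr => l _; rewrite dotNr scaleNr.
Qed.

Lemma proj_proj P x : proj P (proj P x) = proj P x.
Proof. by apply: eq_bigr => l Pl; rewrite dot_f_proj Pl. Qed.

End Orthonormal.

(** More unknowns than equations. Predicates on index types fit its uses: vectors in the span of
    [l + 1] singular vectors that are orthogonal to fewer others, and a normal to all columns but
    one. *)
Lemma exists_kernel (L1 L2 : finType) (P : pred L1) (Q : pred L2) (a : L1 -> L2 -> R) :
  (#|P| < #|Q|)%N -> exists c : L2 -> R, (exists2 j, Q j & c j != 0) /\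
    forall i, P i -> \sum_(j | Q j) a i j * c j = 0.
Proof.
move=> PQ; pose A := \matrix_(i < #|P|, j < #|Q|) a (enum_val i) (enum_val j).
have : kermx A^T != 0.
  rewrite kermx_eq0 /row_free neq_ltn; apply/orP; left.
  by rewrite (leq_ltn_trans (rank_leq_col _)).
move=> /rowV0Pn[u /sub_kermxP uA u0].
have [j0 uj0] : exists j, u 0 j != 0.
  by move/rV0Pn : u0 => [j]; exists j.
exists (fun j => if [pick k | enum_val k == j] is Some k then u 0 k else 0).
have cE k : (if [pick k' | enum_val k' == enum_val k] is Some k' then u 0 k' else 0) = u 0 k.
  by case: pickP => [k' /eqP/enum_val_inj ->//|/(_ k)]; rewrite eqxx.
split; first by exists (enum_val j0); rewrite ?cE//; exact: enum_valP.
move=> i Pi; have iP : i \in P by [].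
rewrite (reindex_onto (enum_val : 'I_#|Q| -> L2) (enum_rank_in (enum_valP j0))) /=; last first.
  by move=> j Qj; rewrite enum_rankK_in.
under eq_bigl => k do rewrite enum_valK_in eqxx andbT.
have /matrixP/(_ 0 (enum_rank_in iP i)) := uA.
rewrite !mxE => e; rewrite -[RHS]e [RHS](eq_bigl (fun k => Q (enum_val k))); last first.
  by move=> k; apply/esym; exact: (enum_valP k).
by apply: eq_bigr => k _; rewrite cE !mxE enum_rankK_in// mulrC.
Qed.

Section SVD.
Context (p q : nat) (Z : 'M[R]_(p, q)) (S : svd Z).
Local Notation L := 'I_(minn p q).
Local Notation s := (tnth (sv S)).
Local Notation u := (lvec S).
Local Notation v := (rvec S).

Lemma dot_lvec k l : dot (u k) (u l) = (k == l)%:R.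
Proof.
have /matrixP/(_ 0 0) := lvec_orthonormal S k l; rewrite !mxE mulr1n => <-.
by apply: eq_bigr => i _; rewrite mxE.
Qed.

Lemma dot_rvec k l : dot (v k) (v l) = (k == l)%:R.
Proof.
have /matrixP/(_ 0 0) := rvec_orthonormal S k l; rewrite !mxE mulr1n => <-.
by apply: eq_bigr => i _; rewrite mxE.
Qed.

Lemma mul_outer m n (a : 'cV[R]_m) (b x : 'cV[R]_n) :
  a *m b^T *m x = dot b x *: a.
Proof.
rewrite -mulmxA; apply/matrixP => i j; rewrite (ord1 j) !mxE big_ord1 mulrC; congr (_ * _).
by rewrite mxE; apply: eq_bigr => k _; rewrite mxE.
Qed.

Lemma svd_mul x : Z *m x = \sum_l (s l * dot (v l) x) *: u l.
Proof.
rewrite {1}(svdE S) mulmx_suml; apply: eq_bigr => l _.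
by rewrite -scalemxAl mul_outer scalerA.
Qed.

Lemma svd_mul_tr y : Z^T *m y = \sum_l (s l * dot (u l) y) *: v l.
Proof.
rewrite {1}(svdE S) linear_sum mulmx_suml; apply: eq_bigr => l _ /=.
by rewrite linearZ /= trmx_mul trmxK -scalemxAl mul_outer scalerA.
Qed.

Lemma nsq_svd_mul x : nsq (Z *m x) = \sum_l (s l * dot (v l) x) ^+ 2.
Proof. by rewrite svd_mul (nsq_comb dot_lvec). Qed.

Lemma nsq_svd_mul_tr y : nsq (Z^T *m y) = \sum_l (s l * dot (u l) y) ^+ 2.
Proof. by rewrite svd_mul_tr (nsq_comb dot_rvec). Qed.

Lemma sum_sqr_sv : \sum_l s l ^+ 2 = frobenius_sq Z.
Proof.
rewrite /frobenius_sq exchange_big /=.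
transitivity (\sum_(j < q) nsq (Z *m (delta_mx j 0 : 'cV_q))).
  under [RHS]eq_bigr do rewrite nsq_svd_mul.
  rewrite exchange_big /=; apply: eq_bigr => l _.
  under [RHS]eq_bigr do rewrite exprMn.
  rewrite -mulr_sumr -[LHS]mulr1; congr (_ * _).
  have <- : dot (v l) (v l) = 1 by rewrite dot_rvec eqxx.
  apply: eq_bigr => j _; rewrite expr2; congr (_ * _);
  by rewrite /dot (bigD1 j)//= mxE !eqxx mulr1 big1 ?addr0// => k kj;
    rewrite mxE (negPf kj) mulr0.
by apply: eq_bigr => j _; rewrite -colE nsqE; apply: eq_bigr => i _; rewrite mxE.
Qed.

Lemma sv_le (k l : L) : (k <= l)%N -> s l <= s k.
Proof.
move=> kl; rewrite !(tnth_nth 0).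
apply: (sorted_leq_nth (leT := fun x y => y <= x)) => //.
- by move=> a b c ab bc; exact: le_trans ab.
- exact: sv_decr.
- by rewrite inE size_tuple.
- by rewrite inE size_tuple.
Qed.

End SVD.
End Vectors.

(** * Perturbation of principal component regression *)

Section Perturbation.
Context {R : realType}.

Lemma card_ltn_ord m k : (k <= m)%N -> #|[pred l : 'I_m | (l < k)%N]| = k.
Proof.
by move=> km; rewrite -sum1_card (big_ord_narrow km) /= sum1_card card_ord.
Qed.

Section Pcr.
Context (p q : nat) (Z : 'M[R]_(p, q)) (S : svd Z) (k : nat).
Local Notation s := (tnth (sv S)).
Local Notation u := (lvec S).
Local Notation v := (rvec S).

Lemma pcrE z : pcr S k z =
  \sum_(l < minn p q | (l < k)%N) ((s l)^-1 * dot (u l) z) *: v l.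
Proof.
rewrite /pcr mulmx_suml; apply: eq_bigr => l _.
by rewrite -scalemxAl mul_outer scalerA.
Qed.

Lemma nrm_comb_inv (f : 'I_(minn p q) -> 'cV[R]_q) (c : 'I_(minn p q) -> R)
    (sig a : R) :
  (forall k l, dot (f k) (f l) = (k == l)%:R) ->
  0 < sig -> (forall l : 'I_(minn p q), (l < k)%N -> sig <= s l) ->
  0 <= a -> \sum_(l < minn p q | (l < k)%N) c l ^+ 2 <= a ^+ 2 ->
  nrm (\sum_(l < minn p q | (l < k)%N) ((s l)^-1 * c l) *: f l) <= a / sig.
Proof.
move=> fo s0 ss a0 ca; apply: nrm_le_of_nsq; first by rewrite divr_ge0// ltW.
rewrite (nsq_comb fo) expr_div_n.
apply: (@le_trans _ _ (\sum_(l < minn p q | (l < k)%N) c l ^+ 2 / sig ^+ 2)).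
  apply: ler_sum => l lk; rewrite exprMn mulrC ler_wpM2l ?sqr_ge0//.
  have sl := ss l lk; have sl0 : 0 < s l by exact: lt_le_trans sl.
  rewrite exprVn lef_pV2 ?posrE ?exprn_gt0//.
  by rewrite ler_sqr ?nnegrE ?(ltW s0) ?(ltW sl0).
by rewrite -mulr_suml ler_wpM2r// invr_ge0 sqr_ge0.
Qed.

Lemma nrm_pcr sig z : 0 < sig ->
  (forall l : 'I_(minn p q), (l < k)%N -> sig <= s l) ->
  nrm (pcr S k z) <= nrm z / sig.
Proof.
move=> s0 ss; rewrite pcrE; apply: nrm_comb_inv => //; first exact: dot_rvec.
  exact: nrm_ge0.
by rewrite sqr_nrm; exact: bessel (@dot_lvec _ _ _ _ S) _ _.
Qed.

Lemma mul_pcr z : (forall l : 'I_(minn p q), (l < k)%N -> 0 < s l) ->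
  Z *m pcr S k z = proj u (fun l : 'I_(minn p q) => (l < k)%N) z.
Proof.
move=> s0; rewrite (svd_mul S) /proj [RHS]big_mkcond /=; apply: eq_bigr => l _.
rewrite pcrE (dot_comb (@dot_rvec _ _ _ _ S)).
case: ifPn => lk; last by rewrite mulr0 scale0r.
by rewrite mulVKf// gt_eqF// s0.
Qed.

Lemma mul_tr_pcr z : (forall l : 'I_(minn p q), (l < k)%N -> 0 < s l) ->
  pcr S k z = Z^T *m
   \sum_(l < minn p q | (l < k)%N) ((s l)^-1 * ((s l)^-1 * dot (u l) z)) *: u l.
Proof.
move=> s0; rewrite (svd_mul_tr S) pcrE big_mkcond /=; apply: eq_bigr => l _.
rewrite (dot_comb (@dot_lvec _ _ _ _ S)).
case: ifPn => lk; last by rewrite mulr0 scale0r.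
by rewrite mulVKf// gt_eqF// s0.
Qed.

End Pcr.

(** If the singular value at [l] were positive, so would be the first [l + 1] ones (indices start at
    0), and [E] compressed to their singular vectors and rescaled would be the identity of size
    [l + 1], which exceeds the rank. *)
Lemma sv_rank0 p q (E : 'M[R]_(p, q)) (S : svd E) (l : 'I_(minn p q)) :
  (\rank E <= l)%N -> tnth (sv S) l = 0.
Proof.
move=> rl; apply/eqP; rewrite eq_le sv_ge0 andbT leNgt; apply/negP => sl.
have sk (k : 'I_(minn p q)) : (k <= l)%N -> 0 < tnth (sv S) k.
  by move=> kl; exact: lt_le_trans sl (sv_le S kl).
pose V := \matrix_(i < l.+1, j < q) rvec S (widen_ord (ltn_ord l) i) j 0.
pose U := \matrix_(i < l.+1, j < p)
  ((tnth (sv S) (widen_ord (ltn_ord l) i))^-1 * lvec S (widen_ord (ltn_ord l) i) j 0).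
have UEV : U *m E *m V^T = 1%:M.
  apply/matrixP => i j; rewrite -mulmxA [LHS]mxE.
  under eq_bigr => k _.
    rewrite (_ : (E *m V^T) k j = (E *m rvec S (widen_ord (ltn_ord l) j)) k 0); last first.
      by rewrite !mxE; apply: eq_bigr => k' _; rewrite !mxE.
    rewrite mxE -mulrA; over.
  rewrite -mulr_sumr -/(dot _ _) (svd_mul S).
  rewrite (dot_comb (@dot_lvec _ _ _ _ S)) /= dot_rvec !mxE.
  rewrite -[widen_ord _ i == _]/(i == j).
  have [->|] := eqVneq i j; last by rewrite !mulr0.
  by rewrite mulr1 mulVf// gt_eqF// sk//= -ltnS.
have : (\rank (1%:M : 'M[R]_l.+1) <= \rank E)%N.
  rewrite -UEV (leq_trans (mxrankM_maxl _ _))// mxrankM_maxr//.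
by rewrite mxrank1 leqNgt ltnS rl.
Qed.

Section GoodRegime.
Context (p q r : nat) (E W : 'M[R]_(p, q)) (S : svd E) (T : svd (E + W)).
Context (s w : R).
Local Notation L := 'I_(minn p q).
Local Notation v := (rvec S).
Local Notation u := (lvec S).
Local Notation v' := (rvec T).
Local Notation u' := (lvec T).
Local Notation Pr := (fun l : L => (l < r)%N).
Context (rm : (r <= minn p q)%N) (s0 : 0 < s) (w0 : 0 <= w).
Context (svr : forall l : L, (l < r)%N -> s <= tnth (sv S) l).
Context (sv0 : forall l : L, (r <= l)%N -> tnth (sv S) l = 0).
Context (hW : opbound W w) (ws : 2 * w <= s).

Let vo k l : dot (v k) (v l) = (k == l)%:R. Proof. exact: dot_rvec. Qed.
Let uo k l : dot (u k) (u l) = (k == l)%:R. Proof. exact: dot_lvec. Qed.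
Let vo' k l : dot (v' k) (v' l) = (k == l)%:R. Proof. exact: dot_rvec. Qed.
Let uo' k l : dot (u' k) (u' l) = (k == l)%:R. Proof. exact: dot_lvec. Qed.

Lemma nrm_mul_proj_ge x : s * nrm (proj v Pr x) <= nrm (E *m x).
Proof.
rewrite -ler_sqr ?nnegrE ?mulr_ge0 ?nrm_ge0 ?(ltW s0)//.
rewrite exprMn !sqr_nrm (nsq_proj vo) (nsq_svd_mul S) mulr_sumr.
rewrite [leRHS](bigID Pr) /= -[leLHS]addr0 lerD//; last first.
  by apply: sumr_ge0 => l _; exact: sqr_ge0.
apply: ler_sum => l lr; rewrite exprMn ler_wpM2r ?sqr_ge0//.
by rewrite ler_sqr ?nnegrE ?sv_ge0 ?(ltW s0)// svr.
Qed.

Lemma mul_kernel x : (forall l : L, (l < r)%N -> dot (v l) x = 0) -> E *m x = 0.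
Proof.
move=> h; rewrite (svd_mul S) big1// => l _.
have [lr|rl] := ltnP l r; first by rewrite h// mulr0 scale0r.
by rewrite sv0// mul0r scale0r.
Qed.

(** Weyl's inequality by a dimension count: a nonzero [x] in the span of the first [l + 1] right
    singular vectors of [E], orthogonal to the first [l] ones of [E + W], satisfies [s |x| <= |E x|
    <= (tnth (sv T) l + w) |x|], and [s - w >= s / 2]. *)
Lemma perturbed_sv_ge (l : L) : (l < r)%N -> s / 2 <= tnth (sv T) l.
Proof.
move=> lr.
have [c [[j lj cj] hc]] : exists c : L -> R,
    (exists2 j : L, (j <= l)%N & c j != 0) /\ forall i : L, (i < l)%N ->
      \sum_(j : L | (j <= l)%N) dot (v' i) (v j) * c j = 0.
  have [|c hc] := @exists_kernel R L L (fun i => (i < l)%N) (fun i => (i < l.+1)%N)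
     (fun i j => dot (v' i) (v j)); last by exists c.
  by rewrite !card_ltn_ord// ltnW.
pose x := \sum_(j : L | (j <= l)%N) c j *: v j.
have x0 : 0 < nrm x.
  rewrite nrm_gt0 -nsq_eq0 (nsq_comb vo) psumr_neq0//; last by move=> *; exact: sqr_ge0.
  by apply/hasP; exists j; rewrite ?mem_index_enum//= lj exprn_even_gt0.
have vx (i : L) : (i < l)%N -> dot (v' i) x = 0.
  by move=> il; rewrite dot_sumr -[RHS](hc i il); apply: eq_bigr => k _; rewrite dotZr mulrC.
have Px : proj v Pr x = x.
  rewrite /proj [RHS](_ : _ = \sum_(k < minn p q | (k < r)%N && (k <= l)%N) c k *: v k).
    rewrite big_mkcondr; apply: eq_bigr => k kr; rewrite (dot_comb vo).
    by case: ifP => //; rewrite scale0r.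
  apply: eq_bigl => k; have [kl|_] := leqP k l; last by rewrite andbF.
  by rewrite (leq_ltn_trans kl lr).
have Zx : nrm ((E + W) *m x) <= tnth (sv T) l * nrm x.
  rewrite -ler_sqr ?nnegrE ?mulr_ge0 ?nrm_ge0 ?sv_ge0//.
  rewrite exprMn !sqr_nrm (nsq_svd_mul T).
  apply: (@le_trans _ _ (tnth (sv T) l ^+ 2 * \sum_k dot (v' k) x ^+ 2)); last first.
    by rewrite ler_wpM2l ?sqr_ge0// (bessel vo' xpredT).
  rewrite mulr_sumr; apply: ler_sum => k _; rewrite exprMn.
  have [kl|lk] := ltnP k l; first by rewrite vx// expr0n /= !mulr0.
  by rewrite ler_wpM2r ?sqr_ge0// ler_sqr ?nnegrE ?sv_ge0// sv_le.
have := nrm_mul_proj_ge x; rewrite Px => Ex.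
have := nrm_sub_ge (E *m x) (W *m x); rewrite -mulmxDl => h.
have := hW x => hWx.
rewrite -(ler_pM2r x0); apply: le_trans Zx; apply: le_trans h.
have : w * nrm x <= s / 2 * nrm x.
  by rewrite ler_wpM2r ?(ltW x0)// ler_pdivlMr// mulrC.
by lra.
Qed.

(** The dual count: a nonzero [x] in the span of the first [l + 1] right singular vectors of [E + W]
    can be orthogonal to the first [r] ones of [E], and then only [W] acts on it. *)
Lemma perturbed_sv_le (l : L) : (r <= l)%N -> tnth (sv T) l <= w.
Proof.
move=> rl.
have [c [[j lj cj] hc]] : exists c : L -> R,
    (exists2 j : L, (j <= l)%N & c j != 0) /\ forall i : L, (i < r)%N ->
      \sum_(j : L | (j <= l)%N) dot (v i) (v' j) * c j = 0.
  have [|c hc] := @exists_kernel R L L (fun i => (i < r)%N) (fun i => (i < l.+1)%N)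
     (fun i j => dot (v i) (v' j)); last by exists c.
  by rewrite !card_ltn_ord.
pose x := \sum_(j : L | (j <= l)%N) c j *: v' j.
have x0 : 0 < nrm x.
  rewrite nrm_gt0 -nsq_eq0 (nsq_comb vo') psumr_neq0//; last by move=> *; exact: sqr_ge0.
  by apply/hasP; exists j; rewrite ?mem_index_enum//= lj exprn_even_gt0.
have Ex : E *m x = 0.
  apply: mul_kernel => i ir; rewrite dot_sumr -[RHS](hc i ir).
  by apply: eq_bigr => k _; rewrite dotZr mulrC.
have Zx : tnth (sv T) l * nrm x <= nrm ((E + W) *m x).
  rewrite -ler_sqr ?nnegrE ?mulr_ge0 ?nrm_ge0 ?sv_ge0//.
  rewrite exprMn !sqr_nrm (nsq_svd_mul T) (nsq_comb vo') mulr_sumr.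
  rewrite [leRHS](bigID (fun k : L => (k <= l)%N)) /= -[leLHS]addr0 lerD//; last first.
    by apply: sumr_ge0 => k _; exact: sqr_ge0.
  apply: ler_sum => k kl; rewrite (dot_comb vo') kl exprMn ler_wpM2r ?sqr_ge0//.
  by rewrite ler_sqr ?nnegrE ?sv_ge0// sv_le.
rewrite -(ler_pM2r x0); apply: le_trans Zx _.
by rewrite mulmxDl Ex add0r.
Qed.

(** As [e] only sees the row space of [E], the error splits into the product of [e + eta] with the
    projection of [ah - a], the term [dot eta a], and the part of [ah] outside this row space, seen
    by [eta] alone. The projection is read off [E *m (ah - a)], since [E] is bounded below by [s]
    there. *)
Lemma good_regime_bound (a : 'cV[R]_q) (nz z : 'cV[R]_p) (e eta : 'cV[R]_q) (lam : R) :
  proj v Pr a = a -> (forall y, dot e y = dot e (proj v Pr y)) ->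
  z = E *m a + nz ->
  lam = (nrm (proj u Pr nz) + 2 * w * nrm nz / s + 2 * w * nrm a +
         2 * w * nrm z / s) / s ->
  `|dot (e + eta) (pcr T r z) - dot e a| <=
    (nrm e + nrm eta) * lam + `|dot eta a| + nrm eta * (4 * w * nrm z / s ^+ 2).
Proof.
move=> aP eP zE lamE; set ah := pcr T r z.
have sh := perturbed_sv_ge; have s20 : 0 < s / 2 by rewrite divr_gt0.
have sT (l : L) : (l < r)%N -> 0 < tnth (sv T) l.
  by move=> lr; exact: lt_le_trans s20 (sh l lr).
have nah : nrm ah <= 2 * nrm z / s.
  rewrite (le_trans (nrm_pcr z s20 sh))// le_eqVlt; apply/orP; left; apply/eqP.
  by field; rewrite gt_eqF.
have Psub y : E *m (y - proj v Pr y) = 0.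
  apply: mul_kernel => l lr; rewrite dotBr (dot_f_proj vo) lr subrr //.
(* [ah] is in the row space of [E + W], and only [W] contributes to its part
   outside the row space of [E] *)
have f4 : nrm (ah - proj v Pr ah) <= 4 * w * nrm z / s ^+ 2.
  set y := ah - proj v Pr ah.
  pose qq := \sum_(l < minn p q | (l < r)%N)
    ((tnth (sv T) l)^-1 * ((tnth (sv T) l)^-1 * dot (u' l) z)) *: u' l.
  have nq : nrm qq <= 4 * nrm z / s ^+ 2.
    have zs : nrm z / (s / 2) / (s / 2) = 4 * nrm z / s ^+ 2.
      by field; rewrite gt_eqF.
    rewrite -zs; apply: nrm_le_of_nsq.
      by rewrite !divr_ge0 ?nrm_ge0// ltW.
    rewrite (nsq_comb uo') (expr_div_n (nrm z / _)) (expr_div_n (nrm z)) sqr_nrm.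
    apply: (@le_trans _ _ (\sum_(l < minn p q | (l < r)%N)
        dot (u' l) z ^+ 2 / (s / 2) ^+ 2 / (s / 2) ^+ 2)).
      apply: ler_sum => l lr; rewrite mulrA exprMn mulrC.
      rewrite -[leRHS]mulrA ler_wpM2l ?sqr_ge0// exprMn exprVn.
      have hl : (tnth (sv T) l ^+ 2)^-1 <= ((s / 2) ^+ 2)^-1.
        rewrite lef_pV2 ?posrE ?exprn_gt0 ?sT//.
        by rewrite ler_sqr ?nnegrE ?(ltW s20) ?(ltW (sT l lr)) ?sh.
      by rewrite ler_pM// invr_ge0 sqr_ge0.
    rewrite -!mulr_suml !ler_wpM2r ?invr_ge0 ?sqr_ge0//.
    exact: bessel uo' _ _.
  have y2 : nsq y <= w * nrm y * nrm qq.
    have -> : nsq y = dot y ah.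
      have Py : proj v Pr y = 0 by rewrite /y projD projN (proj_proj vo) subrr.
      by rewrite /nsq {2}/y dotBr -(dot_proj v) Py dot0l subr0.
    rewrite /ah (mul_tr_pcr _ sT) -dot_mulmx.
    rewrite mulmxDl Psub add0r (le_trans (dot_le _ _))//.
    by rewrite ler_wpM2r ?nrm_ge0.
  have [y0|y0] := eqVneq y 0.
    rewrite y0 nrm0 !mulr_ge0 ?nrm_ge0 ?invr_ge0 ?sqr_ge0//.
  rewrite -sqr_nrm expr2 mulrAC ler_pM2r ?nrm_gt0// in y2.
  by rewrite (le_trans y2)// -!mulrA [leRHS]mulrCA ler_wpM2l// mulrA.
(* [h = (E + W) *m g], and [E *m g] only sees the projection of [nz] on the
   column space of [E] *)
have f5 : nrm (proj u' Pr nz) <= nrm (proj u Pr nz) + 2 * w * nrm nz / s.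
  set h := proj u' Pr nz.
  pose g := pcr T r h.
  have hE : (E + W) *m g = h by rewrite /g (mul_pcr _ sT) /h (proj_proj uo').
  have ng : nrm g <= 2 * nrm h / s.
    rewrite (le_trans (nrm_pcr h s20 sh))// le_eqVlt; apply/orP; left; apply/eqP.
    by field; rewrite gt_eqF.
  have hn : nsq h = dot h (proj u Pr nz) + dot (W *m g - proj u Pr (W *m g)) nz.
    have -> : nsq h = dot h nz by rewrite dotC (dot_proj_self uo').
    rewrite -(dot_proj u) -[X in dot X nz](subrK (proj u Pr h)) dotDl addrC.
    congr (_ + dot _ _); rewrite -hE mulmxDl (projD u).
    have -> : proj u Pr (E *m g) = E *m g.
      rewrite (svd_mul S) /proj [RHS](bigID Pr) /= [X in _ = _ + X]big1 ?addr0; last first.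
        by move=> l; rewrite -leqNgt => lr; rewrite sv0// mul0r scale0r.
      by apply: eq_bigr => l _; rewrite (dot_comb uo).
    by rewrite opprD addrACA subrr add0r.
  have : nsq h <= nrm h * (nrm (proj u Pr nz) + 2 * w * nrm nz / s).
    rewrite hn mulrDr lerD ?dot_le// (le_trans (dot_le _ _))//.
    apply: (@le_trans _ _ (w * (2 * nrm h / s) * nrm nz)); last first.
      by rewrite le_eqVlt; apply/orP; left; apply/eqP; ring.
    rewrite ler_wpM2r ?nrm_ge0// (le_trans (nrm_subproj uo _ _))//.
    by rewrite (le_trans (hW g))// ler_wpM2l.
  have [->|h0] := eqVneq h 0.
    rewrite nrm0 => _; rewrite addr_ge0 ?nrm_ge0// !mulr_ge0 ?nrm_ge0 ?invr_ge0//.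
    exact: ltW.
  by rewrite -sqr_nrm expr2 ler_pM2l// nrm_gt0.
(* Write [E *m a] as [(E + W) *m a - W *m a]. The discarded left singular vectors of [E + W] carry
   singular values at most [w], by [perturbed_sv_le]. *)
have f6 : nrm (E *m a - proj u' Pr (E *m a)) <= 2 * w * nrm a.
  have Ea : E *m a = (E + W) *m a + (- (W *m a)) by rewrite mulmxDl addrK.
  rewrite Ea projD opprD addrACA (le_trans (nrmD _ _))//.
  have : nrm (- (W *m a) - proj u' Pr (- (W *m a))) <= w * nrm a.
    by rewrite (le_trans (nrm_subproj uo' _ _))// nrmN.
  have : nrm ((E + W) *m a - proj u' Pr ((E + W) *m a)) <= w * nrm a.
    apply: nrm_le_of_nsq; first by rewrite mulr_ge0// nrm_ge0.
    rewrite (nsq_subproj uo') (nsq_proj uo') (nsq_svd_mul T) (bigID Pr) /=.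
    rewrite [X in X + _ - _](_ : _ = \sum_(l < minn p q | (l < r)%N)
        dot (u' l) ((E + W) *m a) ^+ 2); last first.
      by apply: eq_bigr => l _; rewrite (svd_mul T) (dot_comb uo').
    rewrite addrAC subrr add0r exprMn sqr_nrm.
    apply: (@le_trans _ _ (w ^+ 2 * \sum_(l < minn p q | ~~ (l < r)%N) dot (v' l) a ^+ 2)).
      rewrite mulr_sumr; apply: ler_sum => l; rewrite -leqNgt => lr.
      rewrite exprMn ler_wpM2r ?sqr_ge0// ler_sqr ?nnegrE ?sv_ge0//.
      exact: perturbed_sv_le.
    by rewrite ler_wpM2l ?sqr_ge0//; exact: bessel vo' _ _.
  by lra.
have f8 : nrm (proj v Pr (ah - a)) <= lam.
  rewrite lamE ler_pdivlMr// mulrC (le_trans (nrm_mul_proj_ge _))//.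
  (* Since [(E + W) *m ah] is the projection of [z], there are three sources of error: the projected
     noise, the part of [E *m a] lost by the projection, and [W *m ah]. *)
  have -> : E *m (ah - a) = proj u' Pr nz + (- (E *m a - proj u' Pr (E *m a)) - W *m ah).
    have : (E + W) *m ah = proj u' Pr z by exact: mul_pcr.
    rewrite mulmxDl {1}zE projD => h.
    have Eah : E *m ah = proj u' Pr (E *m a) + proj u' Pr nz - W *m ah.
      by rewrite -h addrK.
    rewrite mulmxBr Eah; 
    by apply/matrixP => i j; rewrite !mxE; ring.
  rewrite (le_trans (nrmD _ _))//.
  have := nrmB (- (E *m a - proj u' Pr (E *m a))) (W *m ah); rewrite nrmN.
  have Wah : nrm (W *m ah) <= 2 * w * nrm z / s.
    rewrite (le_trans (hW _))//.
    have -> : 2 * w * nrm z / s = w * (2 * nrm z / s) by ring.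
    by rewrite ler_wpM2l.
  by move=> h; lra.
have -> : dot (e + eta) ah - dot e a =
    dot (e + eta) (proj v Pr (ah - a)) + dot eta a + dot eta (ah - proj v Pr ah).
  have e1 : dot e ah - dot e a = dot e (proj v Pr (ah - a)) by rewrite -dotBr eP.
  rewrite !dotDl -e1 (projD v) (projN v) aP !dotBr; ring.
rewrite (le_trans (ler_normD _ _))// lerD//; last first.
  by rewrite (le_trans (normr_dot_le _ _))// ler_wpM2l ?nrm_ge0.
rewrite (le_trans (ler_normD _ _))// lerD2r (le_trans (normr_dot_le _ _))//.
by rewrite ler_pM ?nrm_ge0// nrmD.
Qed.

End GoodRegime.

End Perturbation.

(** * Finite nets and the operator norm of the noise *)

Section Codes.
Context {R : realType}.

(** Stands for the integers from [-M] to [M], shifted by [M] to form a finite type. *)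
Definition code (M : nat) := 'I_(M.*2.+1).
Definition cval M (k : code M) : R := (k : nat)%:R - M%:R.

Lemma sum_cval_weight M (x : R) : 0 <= x -> x <= 1 / 2 ->
  \sum_(k < M.*2.+1) x ^+ `|(k : nat) - M|%N <= 1 + 4 * x.
Proof.
move=> x0 x1.
have -> : \sum_(k < M.*2.+1) x ^+ `|(k : nat) - M|%N = 1 + 2 * \sum_(k < M) x ^+ k.+1.
  elim: M => [|M IH]; first by rewrite big_ord_recl !big_ord0 /= mulr0.
  rewrite doubleS big_ord_recr big_ord_recl /=.
  under eq_bigr => k _ do rewrite /bump /= -[X in (_ - X%:Z)%R]add1n distnDl.
  rewrite IH big_ord_recr /= subn0.
  have -> : `|M.*2.+2 - M.+1|%N = M.+1 by rewrite distnEl -?addnn; lia.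
  by ring.
suff : \sum_(k < M) x ^+ k.+1 <= 2 * x by lra.
elim: M => [|M IH]; first by rewrite big_ord0; lra.
rewrite big_ord_recl /= expr1; under eq_bigr do rewrite /bump /= add1n exprS.
rewrite -mulr_sumr; nra.
Qed.

Lemma expR_weight M (la : R) (k : code M) :
  expR (- (la * `|cval k|)) = expR (- la) ^+ `|(k : nat) - M|%N.
Proof.
rewrite -expRM_natl; congr expR.
have -> : `|cval k| = `|(k : nat) - M|%N%:R.
  rewrite /cval; have [kM|Mk] := leqP M k.
    by rewrite -natrB// normr_nat distnEl.
  by rewrite distrC -natrB ?(ltnW Mk)// normr_nat distnEr// ltnW.
by rewrite mulrN mulrC.
Qed.

(** Exponential counting: the indicator that the sum is at most [B] is bounded by
    [exp (la (B - sum))], whose total over all codes factorises over [J]. A large [la] makes the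
    cost per coordinate tiny, which pays when [B] is small compared with [#|J|]. *)
Lemma card_codes (J : finType) M (la B : R) : 0 <= la -> expR (- la) <= 1 / 2 ->
  #|[set c : {ffun J -> code M} | \sum_i `|cval (c i)| <= B]%SET|%:R <=
  expR (la * B + 4 * #|J|%:R * expR (- la)).
Proof.
move=> la0 lae.
apply: (@le_trans _ _ (\sum_(c : {ffun J -> code M})
   expR (la * B) * \prod_i expR (- (la * `|cval (c i)|)))).
  rewrite -sum1_card natr_sum [leLHS]big_mkcond /=; apply: ler_sum => c _.
  case: ifPn => [|_]; last first.
    by rewrite mulr_ge0 ?expR_ge0// prodr_ge0// => i _; exact: expR_ge0.
  rewrite inE => cB; rewrite -expR_sum -expRD -expR0 ler_expR.
  by rewrite sumrN -mulr_sumr -mulrBr mulr_ge0// subr_ge0.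
rewrite -mulr_sumr expRD ler_pM2l ?expR_gt0//.
rewrite -(bigA_distr_bigA (fun i k => expR (- (la * `|cval k|)))) /=.
rewrite prodr_const.
apply: (@le_trans _ _ ((1 + 4 * expR (- la)) ^+ #|J|)).
  apply: lerXn2r; rewrite ?nnegrE ?addr_ge0 ?mulr_ge0 ?expR_ge0//.
    by apply: sumr_ge0 => k _; exact: expR_ge0.
  under eq_bigr do rewrite expR_weight.
  by apply: sum_cval_weight => //; exact: expR_ge0.
have -> : 4 * #|J|%:R * expR (- la) = (4 * expR (- la)) * #|J|%:R by ring.
rewrite expRM_natr; apply: lerXn2r; rewrite ?nnegrE ?expR_ge0 ?expR_ge1Dx//.
Qed.

(** Rounding toward zero for both signs: it never increases the absolute value, and values of
    modulus less than 1 become 0, so that vectors with few large entries get sparse codes. *)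
Definition rnd M (y : R) : code M :=
  inord (if (0 <= y)%R then M + Num.truncn y else M - Num.truncn (- y)%R)%N.

Lemma rndP M (y : R) : `|y| <= M%:R ->
  `|cval (rnd M y)| <= `|y| /\ `|y - cval (rnd M y)| <= 1.
Proof.
rewrite /cval /rnd => yM; case: ifPn => y0.
  have /andP[t1 t2] := truncn_itv y0.
  have tM : (Num.truncn y <= M)%N.
    by rewrite -(ler_nat R) (le_trans t1)// (le_trans _ yM)// ler_norm.
  rewrite inordK; last by rewrite ltnS -addnn leq_add2l.
  rewrite natrD addrAC subrr add0r normr_nat (ger0_norm y0); split => //.
  by rewrite ger0_norm ?subr_ge0//; rewrite -addn1 natrD in t2; lra.
rewrite -ltNge in y0; have y1 : 0 <= - y by rewrite oppr_ge0 ltW.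
have /andP[t1 t2] := truncn_itv y1.
have tM : (Num.truncn (- y) <= M)%N.
  by rewrite -(ler_nat R) (le_trans t1)// (le_trans _ yM)// ltr0_norm.
rewrite inordK; last by rewrite ltnS (leq_trans (leq_subr _ _))// -addnn leq_addr.
rewrite natrB// addrAC subrr add0r normrN normr_nat (ltr0_norm y0); split => //.
rewrite opprK -normrN opprD ger0_norm ?subr_ge0//.
by rewrite -addn1 natrD in t2; lra.
Qed.

End Codes.

Section Whp.
Context {d : measure_display} {Om : measurableType d} {R : realType}.
Context (Q : probability Om R).

(* [P] itself need not be measurable. *)
Definition whp (dl : R) (P : Om -> Prop) : Prop :=
  exists B : set Om, [/\ measurable B, (Q B <= dl%:E)%E & forall w, ~ B w -> P w].

Lemma whpS dl (P P' : Om -> Prop) : (forall w, P w -> P' w) -> whp dl P -> whp dl P'.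
Proof. by move=> PP [B [mB QB hB]]; exists B; split => // w /hB /PP. Qed.

Lemma whp_le dl dl' (P : Om -> Prop) : dl <= dl' -> whp dl P -> whp dl' P.
Proof.
move=> h [B [mB QB hB]]; exists B; split => //.
by rewrite (le_trans QB)// lee_fin.
Qed.

Lemma whpI dl dl' (P P' : Om -> Prop) : whp dl P -> whp dl' P' ->
  whp (dl + dl') (fun w => P w /\ P' w).
Proof.
move=> [B [mB QB hB]] [C [mC QC hC]]; exists (B `|` C); split.
- exact: measurableU.
- rewrite EFinD (le_trans (measureU2 _ _ _))//; exact: leeD.
- move=> w /not_orP[Bw Cw]; split; [exact: hB|exact: hC].
Qed.

Lemma whp_fin (C : finType) (S : {set C}) dl (P : C -> Om -> Prop) : 0 <= dl ->
  (forall c, c \in S -> whp dl (P c)) ->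
  whp (#|S|%:R * dl) (fun w => forall c, c \in S -> P c w).
Proof.
move=> dl0 h; rewrite cardE.
have {}h : forall c, c \in enum S -> whp dl (P c) by move=> c; rewrite mem_enum => /h.
suff : whp ((size (enum S))%:R * dl) (fun w => forall c, c \in enum S -> P c w).
  by move=> hh; apply: (whpS _ hh) => w hw c cS; apply: hw; rewrite mem_enum.
elim: (enum S) h => [|c s IH] {}h; first by exists set0; rewrite measure0 mul0r.
rewrite /= -addn1 natrD mulrDl mul1r addrC.
have hc : whp dl (P c) by apply: h; rewrite mem_head.
have hs : whp ((size s)%:R * dl) (fun w => forall c, c \in s -> P c w).
  by apply: IH => c' c's; apply: h; rewrite inE c's orbT.
apply: (whpS _ (whpI hc hs)) => w [Pc Ps] c'; rewrite inE => /predU1P[->//|]; exact: Ps.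
Qed.

End Whp.

Section OperatorNorm.
Context {d : measure_display} {Om : measurableType d} {R : realType}.
Context (Q : probability Om R).

(** Chernoff's bound with exponential parameter 1; another parameter is obtained by scaling [c] and
    [h]. *)
Lemma tail_lincomb (K : R) (I : finType) (X : I -> Om -> R) (c : I -> R) (h : R) :
  0 < K -> (forall i, centered_subgauss Q K (X i)) -> mutually_independent Q X ->
  whp Q (expR (- h + 2 * K ^+ 2 * \sum_i c i ^+ 2)) (fun w => lincomb X c w <= h).
Proof.
move=> K0 hX indX.
have mL := measurable_lincomb hX c.
exists [set w | h < lincomb X c w]; split.
- rewrite -[X in measurable X]setTI; apply: measurable_fun_ltr => //.
- apply: (@le_trans _ _ (\int[Q]_w (expR (- h) * expR (lincomb X c w))%:E)%E).
    apply: prob_le_integral.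
    + by rewrite -[X in measurable X]setTI; apply: measurable_fun_ltr.
    + by apply: measurable_funM; [exact: measurable_cst|exact: measurable_expf].
    + by move=> w; rewrite mulr_ge0 ?expR_ge0.
    + move=> w /= hw; rewrite -expRD -expR0 ler_expR; lra.
  under eq_integral do rewrite EFinM.
  rewrite ge0_integralZl//; last first.
    by apply/measurable_EFinP; exact: measurable_expf.
  rewrite expRD EFinM lee_pmul2l ?lte_fin ?expR_gt0//.
  exact: mgf_lincomb.
- by move=> w /= /negP; rewrite -leNgt.
Qed.

Lemma dot_mulmxE p q (A : 'M[R]_(p, q)) (x : 'cV[R]_q) (y : 'cV[R]_p) :
  dot (A *m x) y = \sum_(ij : 'I_p * 'I_q) (y ij.1 0 * x ij.2 0) * A ij.1 ij.2.
Proof.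
rewrite -(pair_bigA _ (fun i j => (y i 0 * x j 0) * A i j)) /=.
apply: eq_bigr => i _; rewrite mxE mulr_suml; apply: eq_bigr => j _; ring.
Qed.

Lemma nsqM_pair p q (x : 'cV[R]_q) (y : 'cV[R]_p) :
  \sum_(ij : 'I_p * 'I_q) (y ij.1 0 * x ij.2 0) ^+ 2 = nsq y * nsq x.
Proof.
rewrite -(pair_bigA _ (fun i j => (y i 0 * x j 0) ^+ 2)) /=.
rewrite !nsqE mulr_suml; apply: eq_bigr => i _; rewrite mulr_sumr.
by apply: eq_bigr => j _; rewrite exprMn.
Qed.

Lemma opbound_frobenius p q (A : 'M[R]_(p, q)) :
  opbound A (Num.sqrt (frobenius_sq A)).
Proof.
have F0 : 0 <= frobenius_sq A.
  by apply: sumr_ge0 => i _; apply: sumr_ge0 => j _; exact: sqr_ge0.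
move=> x; apply: nrm_le_of_nsq; first by rewrite mulr_ge0 ?sqrtr_ge0 ?nrm_ge0.
rewrite exprMn sqr_sqrtr// sqr_nrm nsqE /frobenius_sq mulr_suml.
apply: ler_sum => i _.
have -> : (A *m x) i 0 = dot (\col_j A i j) x.
  by rewrite mxE; apply: eq_bigr => j _; rewrite mxE.
have -> : \sum_j A i j ^+ 2 = nsq (\col_j A i j).
  by rewrite nsqE; apply: eq_bigr => j _; rewrite mxE.
rewrite -!sqr_nrm -exprMn -real_normK ?num_real//.
by rewrite ler_sqr ?nnegrE ?mulr_ge0 ?nrm_ge0// normr_dot_le.
Qed.

Definition cvec n M (c : {ffun 'I_n -> code M}) : 'cV[R]_n := \col_i cval (c i).
Definition rvecM n M (x : 'cV[R]_n) : {ffun 'I_n -> code M} :=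
  [ffun i => rnd M (x i 0)].

Lemma entry_le_nrm n (x : 'cV[R]_n) i : `|x i 0| <= nrm x.
Proof.
rewrite -sqrtr_sqr ler_wsqrtr// nsqE (bigD1 i)//= lerDl.
by apply: sumr_ge0 => j _; exact: sqr_ge0.
Qed.

Lemma sum_norm_le n (x : 'cV[R]_n) : \sum_i `|x i 0| <= Num.sqrt n%:R * nrm x.
Proof.
pose y : 'cV[R]_n := \col_i `|x i 0|; pose o : 'cV[R]_n := const_mx 1.
have -> : \sum_i `|x i 0| = dot o y.
  by apply: eq_bigr => i _; rewrite !mxE mul1r.
have -> : nrm x = nrm y.
  by congr Num.sqrt; rewrite !nsqE; apply: eq_bigr => i _; rewrite mxE real_normK ?num_real.
have -> : Num.sqrt n%:R = nrm o.
  congr Num.sqrt; rewrite nsqE -[n in LHS]card_ord -sum1_card natr_sum.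
  by apply: eq_bigr => i _; rewrite mxE expr1n.
exact: dot_le.
Qed.

Lemma rvecMP n M (x : 'cV[R]_n) : nrm x <= M%:R ->
  let z := cvec (rvecM M x) in
  [/\ nrm z <= nrm x, nrm (x - z) <= Num.sqrt n%:R &
      \sum_i `|cval (rvecM M x i)| <= \sum_i (`|x i 0| : R)].
Proof.
move=> xM z.
have h i : `|z i 0| <= `|x i 0| /\ `|x i 0 - z i 0| <= 1.
  rewrite mxE ffunE; apply: rndP; exact: le_trans (entry_le_nrm x i) xM.
split.
- rewrite ler_wsqrtr// !nsqE; apply: ler_sum => i _.
  rewrite -[leLHS]real_normK ?num_real// -[leRHS]real_normK ?num_real//.
  by rewrite ler_sqr ?nnegrE//; have [] := h i.
- rewrite ler_wsqrtr// nsqE -[n in leRHS]card_ord -sum1_card natr_sum.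
  apply: ler_sum => i _; rewrite !mxE -real_normK ?num_real// expr_le1//.
  by have [] := h i; rewrite mxE.
- by apply: ler_sum => i _; have [] := h i; rewrite mxE.
Qed.

Lemma geometric_limit (D a b : R) : 0 <= b ->
  (forall k, D <= a + b / 2 ^+ k) -> D <= a.
Proof.
move=> b0 h; rewrite leNgt; apply/negP => aD.
have e0 : 0 < D - a by rewrite subr_gt0.
have := h (Num.truncn (b / (D - a))).+1.
set k := (Num.truncn _).+1.
have kb : b / (D - a) < k%:R by rewrite truncnS_gt.
have k2 : k%:R < 2 ^+ k :> R by rewrite -natrX ltr_nat ltn_expl.
apply/negP; rewrite -ltNge -ltrBrDl ltr_pdivrMr ?exprn_gt0//.
by rewrite mulrC -ltr_pdivrMr// (lt_trans kb).
Qed.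

Section Bound.
Context (p q : nat) (K : R) (W : 'I_p -> 'I_q -> Om -> R).
Context (p0 : (0 < p)%N) (q0 : (0 < q)%N) (K0 : 0 < K).
Context (hW : forall i j, centered_subgauss Q K (W i j)).
Context (indW : mutually_independent Q (fun ij : 'I_p * 'I_q => W ij.1 ij.2)).

Definition rmx (w : Om) : 'M[R]_(p, q) := \matrix_(i, j) W i j w.

Let P : R := Num.sqrt p%:R.
Let q' : R := Num.sqrt q%:R.
Let n : R := p%:R + q%:R.

(** For vectors scaled to norms [4 * P] and [4 * q'], rounding to integers loses at most a quarter
    of the norm in each argument. So a bilinear bound [N] improves to [a / 2 + N / 2], and iteration
    from the Frobenius norm tends to [a]; no supremum over the sphere is involved. *)
Let net_to_opbound (A : 'M[R]_(p, q)) (H : R) M1 M2 :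
  4 * P <= M1%:R -> 4 * q' <= M2%:R -> 0 <= H ->
  (forall (c1 : {ffun 'I_p -> code M1}) (c2 : {ffun 'I_q -> code M2}),
     \sum_i `|cval (c1 i)| <= 4 * p%:R :> R -> \sum_i `|cval (c2 i)| <= 4 * q%:R :> R ->
     nrm (cvec c1) <= 4 * P -> nrm (cvec c2) <= 4 * q' ->
     dot (A *m cvec c2) (cvec c1) <= H) ->
  opbound A (H / (8 * (P * q'))).
Proof.
move=> M1P M2q H0 net.
have P0 : 0 < P by rewrite sqrtr_gt0 ltr0n.
have q'0 : 0 < q' by rewrite sqrtr_gt0 ltr0n.
have PP : P * P = p%:R by rewrite -expr2 sqr_sqrtr.
have qq : q' * q' = q%:R by rewrite -expr2 sqr_sqrtr.
set N0 := Num.sqrt (frobenius_sq A).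
have N00 : 0 <= N0 by exact: sqrtr_ge0.
set a := H / (8 * (P * q')).
have a0 : 0 <= a by rewrite divr_ge0// !mulr_ge0// ltW.
pose good N := forall x y, dot (A *m x) y <= N * nrm x * nrm y.
have step N : 0 <= N -> good N -> good (a / 2 + N / 2).
  move=> N1 gN x y.
  have [->|x0] := eqVneq x 0; first by rewrite mulmx0 dot0l nrm0 mulr0 mul0r.
  have [->|y0] := eqVneq y 0; first by rewrite dot0r nrm0 mulr0.
  have nx : 0 < nrm x by rewrite nrm_gt0.
  have ny : 0 < nrm y by rewrite nrm_gt0.
  pose tx := 4 * q' / nrm x; pose ty := 4 * P / nrm y.
  have tx0 : 0 < tx by rewrite divr_gt0 ?mulr_gt0.
  have ty0 : 0 < ty by rewrite divr_gt0 ?mulr_gt0.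
  have nX : nrm (tx *: x) = 4 * q' by rewrite nrmZ gtr0_norm// divfK// gt_eqF.
  have nY : nrm (ty *: y) = 4 * P by rewrite nrmZ gtr0_norm// divfK// gt_eqF.
  have X2 : nrm (tx *: x) <= M2%:R by rewrite nX.
  have Y2 : nrm (ty *: y) <= M1%:R by rewrite nY.
  have [v1 v2 v3] := rvecMP X2; have [u1 u2 u3] := rvecMP Y2.
  rewrite nX in v1; rewrite nY in u1.
  set X := tx *: x in nX v1 v2 v3; set Y := ty *: y in nY u1 u2 u3.
  set c2 := rvecM M2 X in v1 v2 v3; set c1 := rvecM M1 Y in u1 u2 u3.
  have h1 : dot (A *m cvec c2) (cvec c1) <= H.
    apply: net => //.
    - by rewrite (le_trans u3)// (le_trans (sum_norm_le _))// nY -/P -PP; lra.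
    - by rewrite (le_trans v3)// (le_trans (sum_norm_le _))// nX -/q' -qq; lra.
  have h2 : dot (A *m (X - cvec c2)) (cvec c1) <= N * q' * (4 * P).
    rewrite (le_trans (gN _ _))// ler_pM ?mulr_ge0 ?nrm_ge0//.
    by rewrite ler_wpM2l.
  have h3 : dot (A *m X) (Y - cvec c1) <= N * (4 * q') * P.
    by rewrite (le_trans (gN _ _))// nX ler_wpM2l// !mulr_ge0// ltW.
  have hXY : dot (A *m X) Y <= H + 8 * N * (P * q').
    have -> : dot (A *m X) Y = dot (A *m cvec c2) (cvec c1) +
      dot (A *m (X - cvec c2)) (cvec c1) + dot (A *m X) (Y - cvec c1).
      by rewrite mulmxBr dotBl dotBr; ring.
    by lra.
  have : tx * ty * dot (A *m x) y <= H + 8 * N * (P * q').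
    by move: hXY; rewrite -scalemxAr dotZl dotZr mulrA.
  move=> h; rewrite -(ler_pM2l (mulr_gt0 tx0 ty0)); apply: (le_trans h).
  rewrite le_eqVlt; apply/orP; left; apply/eqP; rewrite /a /tx /ty.
  by field; rewrite !gt_eqF.
have gk k : good (a + N0 / 2 ^+ k).
  elim: k => [|k IH].
    move=> x y; rewrite (le_trans (dot_le _ _))// ler_wpM2r ?nrm_ge0//.
    rewrite (le_trans (opbound_frobenius A x))// ler_wpM2r ?nrm_ge0//.
    by rewrite expr0 divr1 lerDr.
  have -> : a + N0 / 2 ^+ k.+1 = a / 2 + (a + N0 / 2 ^+ k) / 2.
    by rewrite exprS; field; rewrite expf_neq0.
  by apply: step => //; rewrite addr_ge0// divr_ge0// exprn_ge0.
apply: opbound_bilin => // x y.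
apply: (@geometric_limit _ _ (N0 * nrm x * nrm y)).
  by rewrite !mulr_ge0 ?nrm_ge0.
move=> k; rewrite (le_trans (gk k x y))// le_eqVlt; apply/orP; left; apply/eqP.
by field; rewrite expf_neq0.
Qed.

Lemma opbound_whp : whp Q (expR (- 2 * n))
  (fun w => opbound (rmx w) (20 * K * Num.sqrt n)).
Proof.
have P0 : 0 < P by rewrite sqrtr_gt0 ltr0n.
have q'0 : 0 < q' by rewrite sqrtr_gt0 ltr0n.
have PP : P ^+ 2 = p%:R by rewrite sqr_sqrtr.
have qq : q' ^+ 2 = q%:R by rewrite sqr_sqrtr.
have n0 : 0 < n by rewrite addr_gt0// ltr0n.
set sn := Num.sqrt n; have sn0 : 0 < sn by rewrite sqrtr_gt0.
have snn : sn ^+ 2 = n by rewrite sqr_sqrtr// ltW.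
(* The Chernoff parameter: it makes the variance term [2 K^2 s^2 (4 P)^2 (4 q')^2] equal to [2 n],
   while [s H = 10 n]. Each pair of the net fails with probability at most [exp (- 8 n)], and there
   are at most [exp (6 n)] pairs. *)
pose s := sn / (16 * K * (P * q')).
have s0 : 0 < s by rewrite divr_gt0 ?mulr_gt0.
pose H := 10 * n / s.
pose M1 := (Num.truncn (4 * P)).+1; pose M2 := (Num.truncn (4 * q')).+1.
pose C1 := [set c : {ffun 'I_p -> code M1} | \sum_i `|cval (c i)| <= 4 * p%:R :> R]%SET.
pose C2 := [set c : {ffun 'I_q -> code M2} | \sum_i `|cval (c i)| <= 4 * q%:R :> R]%SET.
have e2 : expR (- 1) <= 1 / 2 :> R.
  by have := expRN_le_frac (@ler01 R); rewrite -[1 + 1]/(2%:R) => h; lra.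
have card k M : #|[set c : {ffun 'I_k -> code M} |
    \sum_i `|cval (c i)| <= 4 * k%:R :> R]%SET|%:R <= expR (6 * k%:R) :> R.
  apply: (le_trans (card_codes _ _ _ ler01 e2)); rewrite card_ord ler_expR.
  have : 4 * k%:R * expR (- 1) <= 4 * k%:R * (1 / 2) :> R by rewrite ler_wpM2l// mulr_ge0.
  by lra.
have := @whp_fin _ _ _ Q _ (finset.setX C1 C2) (expR (- 8 * n))
  (fun c w => nrm (cvec c.1) <= 4 * P -> nrm (cvec c.2) <= 4 * q' ->
     dot (rmx w *m cvec c.2) (cvec c.1) <= H) (expR_ge0 _).
move=> /(_ _)[]; last move=> B [mB QB hB].
  move=> [c1 c2] _ /=.
  have [n1|n1] := leP (nrm (cvec c1)) (4 * P); last first.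
    exists set0; rewrite measure0; split => //; rewrite ?lee_fin ?expR_ge0//.
  have [n2|n2] := leP (nrm (cvec c2)) (4 * q'); last first.
    exists set0; rewrite measure0; split => //; rewrite ?lee_fin ?expR_ge0//.
  pose c (ij : 'I_p * 'I_q) := s * (cvec c1 ij.1 0 * cvec c2 ij.2 0).
  have H2 := tail_lincomb c (s * H) K0 (fun ij => hW ij.1 ij.2) indW.
  apply: (whp_le _ (whpS _ H2)).
    rewrite ler_expR /c; under eq_bigr do rewrite exprMn.
    rewrite -mulr_sumr nsqM_pair -!sqr_nrm.
    have sH : s * H = 10 * n by rewrite /H mulrCA divff ?mulr1// gt_eqF.
    rewrite sH.
    have : nrm (cvec c1) ^+ 2 * nrm (cvec c2) ^+ 2 <= (4 * P) ^+ 2 * (4 * q') ^+ 2.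
      by rewrite ler_pM ?sqr_ge0// ler_sqr ?nnegrE ?nrm_ge0// mulr_ge0// ltW.
    move=> h; have : 2 * K ^+ 2 * s ^+ 2 * (nrm (cvec c1) ^+ 2 * nrm (cvec c2) ^+ 2)
        <= 2 * K ^+ 2 * s ^+ 2 * ((4 * P) ^+ 2 * (4 * q') ^+ 2).
      by apply: ler_wpM2l h; apply: mulr_ge0; [apply: mulr_ge0 => //|]; exact: sqr_ge0.
    have -> : 2 * K ^+ 2 * s ^+ 2 * ((4 * P) ^+ 2 * (4 * q') ^+ 2) = 2 * n.
      by rewrite /s -snn; field; rewrite !gt_eqF.
    by lra.
  move=> w; rewrite /lincomb /c => h _ _.
  rewrite -(ler_pM2l s0); apply: le_trans h.
  rewrite dot_mulmxE mulr_sumr le_eqVlt; apply/orP; left; apply/eqP.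
  by apply: eq_bigr => ij _; rewrite /rmx !mxE; ring.
exists B; split => //.
  apply: (le_trans QB); rewrite lee_fin cardsX natrM.
  have -> : - 2 * n = 6 * p%:R + 6 * q%:R + - 8 * n by rewrite /n; ring.
  by rewrite !expRD ler_wpM2r ?expR_ge0// ler_pM// card.
move=> w /hB h.
have H8 : H / (8 * (P * q')) = 20 * K * sn.
  by rewrite /H /s -snn; field; rewrite !gt_eqF.
rewrite -H8; apply: (@net_to_opbound _ _ M1 M2).
- by rewrite ltW// truncnS_gt.
- by rewrite ltW// truncnS_gt.
- apply: divr_ge0; last exact: ltW.
  by apply: mulr_ge0 => //; exact: ltW.
- by move=> c1 c2 k1 k2; apply: (h (c1, c2)); rewrite !inE; apply/andP.
Qed.

End Bound.
End OperatorNorm.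

(** * Lower bounds on compressible vectors *)

Section SubFamily.
Context {d : measure_display} {Om : measurableType d} {R : realType}.
Context (Q : probability Om R).

Lemma mutually_independent_inj (I J : finType) (X : I -> Om -> R) (f : J -> I) :
  injective f -> mutually_independent Q X ->
  mutually_independent Q (fun j => X (f j)).
Proof.
move=> finj indX B mB.
pose B' i := if [pick j | f j == i] is Some j then B j else setT.
have B'f j : B' (f j) = B j.
  by rewrite /B'; case: pickP => [j' /eqP/finj ->//|/(_ j)]; rewrite eqxx.
have B'T i : i \notin f @: [set: J]%SET -> B' i = setT.
  rewrite /B'; case: pickP => // j /eqP <- /negP[]; exact: imset_f.
have mB' i : measurable (B' i) by rewrite /B'; case: pickP.
have := indX B' mB'.
have -> : \bigcap_(x in [set: I]) (X x @^-1` B' x) =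
    \bigcap_(j in [set: J]) (X (f j) @^-1` B j).
  apply/seteqP; split => w /= h i _.
    by rewrite -B'f; exact: h.
  have [/imsetP[j _ ->]|/B'T ->//] := boolP (i \in f @: [set: J]%SET).
  by rewrite B'f; exact: h.
move=> ->; rewrite (bigID (fun i => i \in f @: [set: J]%SET)) /=.
rewrite [X in (_ * X)%E]big1 ?mule1; last first.
  by move=> i /B'T ->; rewrite preimage_setT probability_setT.
rewrite big_imset /=; last by move=> i j _ _; exact: finj.
by apply: eq_big => j; rewrite ?finset.in_setT// B'f.
Qed.

End SubFamily.

(** * Small ball estimates for a fixed vector *)

Section SmallBall.
Context {d : measure_display} {Om : measurableType d} {R : realType}.
Context (Q : probability Om R) (K v th : R).
Local Notation intg f := (Q.-integrable [set: Om] (EFin \o f)).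

(** Frequencies [th] for which [modsq_subgauss] applies to [th] times any coefficient of modulus at
    most 1. *)
Definition small_freq := [/\ 0 < th, th ^+ 2 * v <= 1 / 8 & th ^+ 2 * K ^+ 4 <= v / 2].

Context (K0 : 0 < K) (v0 : 0 < v) (hth : small_freq).

(** Chosen so that one row contributes a factor [1 - 2 * sb_rate] in [row_small_ball]; half of the
    resulting exponent is spent on the threshold in [small_ball]. *)
Definition sb_rate : R := (1 - expR (- (v * th ^+ 2 / 4))) / 8.

Lemma sb_rate_gt0 : 0 < sb_rate.
Proof.
have [th0 _ _] := hth.
rewrite divr_gt0// subr_gt0 -expR0 ltr_expR oppr_lt0.
by rewrite divr_gt0// mulr_gt0// exprn_gt0.
Qed.

(** The Gaussian is dominated by [3 / 4 + cos / 4], whose mean is controlled by the characteristic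
    function of a unit combination of the noise, uniformly in the shift [a]. *)
Lemma row_small_ball (J : finType) (X : J -> Om -> R) (a : R) (x : J -> R) :
  (forall j, centered_subgauss Q K (X j)) ->
  (forall j, \int[Q]_w X j w ^+ 2 = v) ->
  mutually_independent Q X -> \sum_j x j ^+ 2 = 1 ->
  \int[Q]_w expR (- (th * (a + lincomb X x w)) ^+ 2) <= 1 - 2 * sb_rate.
Proof.
move=> hX vX indX x1; have [th0 th1 th2] := hth.
have mL := measurable_lincomb hX x.
have mS : measurable_fun setT (fun w => th * (a + lincomb X x w)).
  apply: measurable_funM; first exact: measurable_cst.
  by apply: measurable_funD; first exact: measurable_cst.
have mc := measurable_cosf mS.
have ic : intg (fun w => cos (th * (a + lincomb X x w))) by exact: integrable_cosf.
apply: (@le_trans _ _ (\int[Q]_w (3 / 4 + 1 / 4 * cos (th * (a + lincomb X x w))))).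
  apply: le_Rint.
  - apply: (@integrable_bounded _ _ _ _ _ 1).
      by apply: measurable_expf; apply: measurableT_comp => //; exact: measurable_funX.
    move=> w; rewrite ger0_norm ?expR_ge0// -expR0 ler_expR oppr_le0; exact: sqr_ge0.
  - apply: integrable_addf; [exact: integrable_cst_fun|exact: integrable_scale].
  - by move=> w; rewrite (le_trans (expRN_sqr_le_cos _))//; lra.
rewrite RintD; [|exact: integrable_cst_fun|exact: integrable_scale].
rewrite Rint_cst RintZ//.
suff : \int[Q]_w cos (th * (a + lincomb X x w)) <= expR (- (v * th ^+ 2 / 4)).
  by rewrite /sb_rate; lra.
apply: (le_trans (ler_norm _)); apply: (le_trans (norm_Rint_cos_le _ _)).
have -> : (fun w => th * (a + lincomb X x w)) =
    (fun w => th * a + lincomb X (fun j => th * x j) w).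
  apply/funext => w; rewrite mulrDr; congr (_ + _); rewrite /lincomb mulr_sumr.
  by apply: eq_bigr => j _; rewrite mulrA.
rewrite modsq_shift; last exact: measurable_lincomb.
have xj j : x j ^+ 2 <= 1.
  by rewrite -x1 (bigD1 j)//= lerDl sumr_ge0// => i _; exact: sqr_ge0.
have := @modsq_lincomb_subgauss _ _ _ Q K K0 J X hX indX v (fun j => th * x j) xpredT v0 vX.
have -> : - (v / 2) * \sum_i (th * x i) ^+ 2 = - (v * th ^+ 2 / 2).
  by under eq_bigr do rewrite exprMn; rewrite -mulr_sumr x1; field.
move=> h; have {h} : modsq Q (lincomb X (fun j => th * x j)) <= expR (- (v * th ^+ 2 / 2)).
  apply: h => j _; rewrite exprMn.
  have t20 : 0 <= th ^+ 2 by exact: sqr_ge0.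
  have h : th ^+ 2 * x j ^+ 2 <= th ^+ 2 by rewrite -[leRHS]mulr1 ler_wpM2l.
  split; first by apply: le_trans th1; rewrite ler_wpM2r// ltW.
  by apply: le_trans th2; rewrite ler_wpM2r// exprn_ge0// ltW.
have -> : expR (- (v * th ^+ 2 / 2)) = expR (- (v * th ^+ 2 / 4)) ^+ 2.
  by rewrite -expRM_natl; congr expR; field.
by move=> /ler_wsqrtr; rewrite sqrtr_sqr ger0_norm// expR_ge0.
Qed.

Section Matrix.
Context (p q : nat) (W : 'I_p -> 'I_q -> Om -> R).
Context (hW : forall i j, centered_subgauss Q K (W i j)).
Context (vW : forall i j, \int[Q]_w W i j w ^+ 2 = v).
Context (indW : mutually_independent Q (fun ij : 'I_p * 'I_q => W ij.1 ij.2)).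

(** Markov's inequality for the exponential of [- th^2 |(E + W) x|^2], which factorises over the
    independent rows. *)
Lemma small_ball (E : 'M[R]_(p, q)) (x : 'cV[R]_q) : nsq x = 1 ->
  whp Q (expR (- (sb_rate * p%:R)))
    (fun w => sb_rate / th ^+ 2 * p%:R <= nsq ((E + rmx W w) *m x)).
Proof.
move=> x1; have [th0 _ _] := hth; have c20 := sb_rate_gt0.
pose X ij : Om -> R := W (ij : 'I_p * 'I_q).1 ij.2.
pose a i := (E *m x) i 0.
pose S i w := a i + lincomb (W i) (fun j => x j 0) w.
have SE w i : ((E + rmx W w) *m x) i 0 = S i w.
  rewrite mulmxDl mxE; congr (_ + _); rewrite mxE; apply: eq_bigr => j _.
  by rewrite mxE mulrC.
have mX (ij : 'I_p * 'I_q) : measurable_fun setT (X ij) by have [] := hW ij.1 ij.2.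
have mS i : measurable_fun setT (S i).
  by apply: measurable_funD; [exact: measurable_cst|exact: measurable_lincomb].
pose h i w := expR (- (th * S i w) ^+ 2).
have mh i : measurable_fun setT (h i).
  apply: measurable_expf; apply: measurableT_comp => //; apply: measurable_funX.
  by apply: measurable_funM => //; exact: measurable_cst.
have h0 i w : 0 <= h i w by exact: expR_ge0.
pose N w := nsq ((E + rmx W w) *m x).
have NE w : N w = \sum_i S i w ^+ 2 by rewrite /N nsqE; apply: eq_bigr => i _; rewrite SE.
have mN : measurable_fun setT N.
  rewrite (_ : N = fun w => \sum_i S i w ^+ 2); last exact/funext.
  by apply: measurable_sum => i; exact: measurable_funX.
set t := sb_rate / th ^+ 2 * p%:R.
have mB : measurable [set w | N w < t].
  by rewrite -[X in measurable X]setTI; apply: measurable_fun_ltr.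
exists [set w | N w < t]; split => //; last by move=> w /= /negP; rewrite -leNgt.
pose c := expR (th ^+ 2 * t).
apply: (@le_trans _ _ (\int[Q]_w (c * \prod_(i < p) h i w)%:E)%E).
  apply: prob_le_integral => //.
  - apply: measurable_funM; [exact: measurable_cst|exact: measurable_prod].
  - by move=> w; rewrite mulr_ge0 ?expR_ge0// prodr_ge0.
  - move=> w /= Nt; rewrite /h -expR_sum -expRD -expR0 ler_expR.
    rewrite sumrN; under eq_bigr do rewrite exprMn.
    by rewrite -mulr_sumr -NE -mulrBr mulr_ge0 ?sqr_ge0// subr_ge0 ltW.
under eq_integral do rewrite EFinM.
rewrite ge0_integralZl//; last 3 first.
- by apply/measurable_EFinP; apply: measurable_prod.
- by move=> w _; rewrite lee_fin prodr_ge0.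
- by rewrite lee_fin expR_ge0.
rewrite (prod_expectation mX indW (blk := fst) (h := h)) ?index_enum_uniq//; last first.
  move=> i; apply: (measurableT_comp (f := expR)) => //.
  apply: measurableT_comp => //; apply: measurable_funX.
  apply: measurable_funM; first exact: measurable_cst.
  apply: measurable_funD; first exact: measurable_cst.
  apply: measurable_sum => j; apply: measurable_funM; first exact: measurable_cst.
  by apply: (jmeasX (X := X) (i := (i, j))).
have ih i : intg (h i).
  apply: (@integrable_bounded _ _ _ _ _ 1) => // w.
  by rewrite ger0_norm// -expR0 ler_expR oppr_le0 sqr_ge0.
under eq_bigr do rewrite EFin_Rint//.
rewrite prodEFin -EFinM lee_fin.
apply: (@le_trans _ _ (c * \prod_(i < p) expR (- (2 * sb_rate)))).
  rewrite ler_pM2l ?expR_gt0//; apply: ler_prod => i _.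
  rewrite Rintegral_ge0//=; apply: (@le_trans _ _ (1 - 2 * sb_rate)).
    apply: row_small_ball => //.
    by apply: (@mutually_independent_inj _ _ _ Q _ _ X (fun j => (i, j))) => // j k [].
  exact: expR_ge1Dx.
rewrite prodr_const card_ord -expRM_natl -expRD ler_expR /t.
by rewrite le_eqVlt; apply/orP; left; apply/eqP; field; rewrite gt_eqF.
Qed.

End Matrix.
End SmallBall.

Section Compressible.
Context {R : realType}.

(* [nsq (E *m x)] diagonalised in an orthonormal family; the two instances are
   the singular value decompositions of [E] and of its transpose. *)
Record diagonalised p q (E : 'M[R]_(p, q)) (L : finType) (s : L -> R)
    (f : L -> 'cV[R]_q) : Prop := Diagonalised {
  diag_ge0 : forall l, 0 <= s l;
  diag_card : (#|L| <= q)%N;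
  diag_orth : forall k l, dot (f k) (f l) = (k == l)%:R;
  diag_nsq : forall x, nsq (E *m x) = \sum_l (s l * dot (f l) x) ^+ 2;
  diag_sum : \sum_l s l ^+ 2 <= p%:R * q%:R
}.

(** The entries at least [tau] times the quadratic mean [nrm x / sqrt n] in size. Few such entries
    is the notion of compressible vector used here. *)
Definition spread n (tau : R) (x : 'cV[R]_n) : {set 'I_n} :=
  [set i | tau * nrm x <= `|x i 0| * Num.sqrt n%:R]%SET.

Lemma cval_eq0 M (k : code M) : `|cval k| < 1 :> R -> cval k = 0 :> R.
Proof.
rewrite /cval => h; have : (k : nat) = M; last by move=> ->; rewrite subrr.
apply/eqP; move: h; rewrite ltr_norml => /andP[h1 h2].
have k1 : (k : nat)%:R < (M + 1)%:R :> R by rewrite natrD; lra.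
have k2 : M%:R < ((k : nat) + 1)%:R :> R by rewrite natrD; lra.
by move: k1 k2; rewrite !ltr_nat; lia.
Qed.

Lemma rnd_close M (a b : R) : `|a| <= M%:R -> `|b| <= M%:R ->
  rnd M a = rnd M b -> `|a - b| <= 2.
Proof.
move=> aM bM ab; have [_ h1] := rndP aM; have [_ h2] := rndP bM.
rewrite -ab in h2; have -> : a - b = (a - cval (rnd M a)) - (b - cval (rnd M a)) by ring.
by rewrite (le_trans (ler_normB _ _))//; lra.
Qed.

Lemma sum_norm_subset n (x : 'cV[R]_n) (P : {set 'I_n}) (k : nat) : (#|P| <= k)%N ->
  \sum_(i in P) `|x i 0| <= Num.sqrt k%:R * nrm x.
Proof.
move=> Pk; pose y : 'cV[R]_n := \col_i `|x i 0|.
pose o : 'cV[R]_n := \col_i (i \in P)%:R.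
have -> : \sum_(i in P) `|x i 0| = dot o y.
  rewrite big_mkcond; apply: eq_bigr => i _; rewrite !mxE.
  by case: ifP; rewrite ?mul1r ?mul0r.
have -> : nrm x = nrm y.
  by congr Num.sqrt; rewrite !nsqE; apply: eq_bigr => i _; rewrite mxE real_normK ?num_real.
rewrite (le_trans (dot_le _ _))// ler_wpM2r ?nrm_ge0// ler_wsqrtr// nsqE.
rewrite (_ : \sum_i _ = #|P|%:R) ?ler_nat//.
rewrite -sum1_card natr_sum [RHS]big_mkcond; apply: eq_bigr => i _; rewrite mxE.
by case: ifP; rewrite ?expr1n ?expr0n.
Qed.

Context (K v th : R) (K0 : 0 < K) (v0 : 0 < v) (hth : small_freq K v th).
Let c2 := sb_rate v th.
Let c0 := Num.min 1 (Num.sqrt (c2 / th ^+ 2)).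

Let th0 : 0 < th. Proof. by case: hth. Qed.
Let c20 : 0 < c2. Proof. exact: sb_rate_gt0 hth. Qed.
Let c00 : 0 < c0.
Proof. by rewrite lt_min ltr01 sqrtr_gt0 divr_gt0// exprn_gt0. Qed.
Let c01 : c0 <= 1. Proof. by rewrite ge_min lexx. Qed.
Let c0c2 : c0 ^+ 2 <= c2 / th ^+ 2.
Proof.
have h : 0 <= c2 / th ^+ 2 by rewrite divr_ge0 ?exprn_ge0// ltW.
rewrite -[leRHS]sqr_sqrtr// ler_sqr ?nnegrE ?sqrtr_ge0 ?(ltW c00)//.
by rewrite ge_min lexx orbT.
Qed.

Section Net.
Context {d : measure_display} {Om : measurableType d} (Q : probability Om R).
Context (p q k : nat) (W : 'I_p -> 'I_q -> Om -> R).
Context (p0 : (0 < p)%N) (q0 : (0 < q)%N).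
Context (hW : forall i j, centered_subgauss Q K (W i j)).
Context (vW : forall i j, \int[Q]_w W i j w ^+ 2 = v).
Context (indW : mutually_independent Q (fun ij : 'I_p * 'I_q => W ij.1 ij.2)).
Context (E : 'M[R]_(p, q)) (L : finType) (s : L -> R) (f : L -> 'cV[R]_q).
Context (dE : diagonalised E s f).
Context (A tau la w0 : R) (A0 : 0 < A) (tau0 : 0 < tau) (la0 : 0 <= la) (w00 : 0 <= w0).
Context (lae : expR (- la) <= 1 / 2).
Context (htau : 2 * tau * (1 + A + w0) <= c0 / 2).
Context (hcount : la * Num.sqrt (k%:R * q%:R) / tau +
   la * (1 + w0) * q%:R / (tau * A ^+ 2) + 8 * q%:R * expR (- la) <= c2 * p%:R / 2).

Let sp : R := Num.sqrt p%:R.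
Let sq : R := Num.sqrt q%:R.
(** The norm of [E] may be of order [sqrt (p q)], but its squared singular values sum to at most
    [p q], so at most [q / A^2] of them reach [A sqrt p]. Closeness of the entries does not control
    [E *m x] along these directions, whose coordinates [b] are therefore encoded too. *)
Let big : {set L} := [set l | A * sp <= s l]%SET.
Let g : R := sq / (tau * A).
Let b (x : 'cV[R]_q) (l : L) : R := if l \in big then s l * dot (f l) x / sp else 0.

Let sp0 : 0 < sp. Proof. by rewrite sqrtr_gt0 ltr0n. Qed.
Let sq0 : 0 < sq. Proof. by rewrite sqrtr_gt0 ltr0n. Qed.
Let spE : sp ^+ 2 = p%:R. Proof. by rewrite sqr_sqrtr. Qed.
Let sqE : sq ^+ 2 = q%:R. Proof. by rewrite sqr_sqrtr. Qed.
Let g0 : 0 < g. Proof. by rewrite divr_gt0 ?mulr_gt0. Qed.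

Let card_big : #|big|%:R * A ^+ 2 <= q%:R.
Proof.
have := diag_sum dE; have pp : 0 < p%:R :> R by rewrite ltr0n.
rewrite mulrC => h; rewrite -(ler_pM2r pp); apply: le_trans h.
rewrite (bigID (mem big)) /= -[leLHS]addr0 lerD//; last first.
  by apply: sumr_ge0 => l _; exact: sqr_ge0.
rewrite -mulrA -sum1_card natr_sum mulr_suml; apply: ler_sum => l.
rewrite inE => h; rewrite mul1r -spE -exprMn ler_sqr ?nnegrE//.
  by rewrite mulr_ge0// ltW.
exact: diag_ge0 dE l.
Qed.

Let sum_b_sqr x : p%:R * \sum_l b x l ^+ 2 <= nsq (E *m x).
Proof.
rewrite (diag_nsq dE) mulr_sumr; apply: ler_sum => l _; rewrite /b.
case: ifP => _; last by rewrite expr0n /= mulr0 sqr_ge0.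
by rewrite expr_div_n spE mulrC divfK// pnatr_eq0 -lt0n.
Qed.

Let bB x y l : b (x - y) l = b x l - b y l.
Proof. by rewrite /b; case: ifP => _; [rewrite dotBr; ring|rewrite subrr]. Qed.

Let nsq_mul_le x : nsq (E *m x) <= p%:R * (A ^+ 2 * nsq x + \sum_l b x l ^+ 2).
Proof.
rewrite (diag_nsq dE) mulrDr (bigID (mem big)) /= addrC lerD//.
  have := bessel (diag_orth dE) (fun l => l \notin big) x => h.
  apply: (@le_trans _ _ (p%:R * (A ^+ 2 * \sum_(l | l \notin big) dot (f l) x ^+ 2))).
    rewrite !mulr_sumr; apply: ler_sum => l; rewrite inE -ltNge => sl.
    rewrite exprMn mulrA ler_wpM2r ?sqr_ge0// -spE -exprMn mulrC.
    by rewrite ler_sqr ?nnegrE ?(diag_ge0 dE)// ?ltW// mulr_gt0.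
  by rewrite ler_wpM2l// ler_wpM2l// exprn_ge0// ltW.
rewrite mulr_sumr [leRHS](bigID (mem big)) /= -[leLHS]addr0 lerD//.
  apply: ler_sum => l lb; rewrite /b lb expr_div_n spE [leRHS]mulrC divfK//.
  by rewrite pnatr_eq0 -lt0n.
by apply: sumr_ge0 => l _; rewrite mulr_ge0// sqr_ge0.
Qed.

Let M1 := (Num.truncn (sq / tau)).+1.
Let M2 := (Num.truncn ((1 + w0) * g)).+1.
Let enc1 (x : 'cV[R]_q) : {ffun 'I_q -> code M1} := [ffun i => rnd M1 (x i 0 * (sq / tau))].
Let enc2 (x : 'cV[R]_q) : {ffun L -> code M2} := [ffun l => rnd M2 (b x l * g)].

(** The last condition is what a small [(E + W) *m x] leaves when [W] has norm at most [w0 sqrt p]: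
    it bounds [E *m x], hence the coordinates to encode. *)
Let adm (x : 'cV[R]_q) :=
  [/\ nrm x = 1, (#|spread tau x| <= k)%N & \sum_l b x l ^+ 2 <= (1 + w0) ^+ 2].

Let b_le x l : adm x -> `|b x l| <= 1 + w0.
Proof.
move=> [_ _ h]; rewrite -ler_sqr ?nnegrE ?addr_ge0// real_normK ?num_real//.
apply: le_trans h; rewrite (bigD1 l)//= lerDl.
by apply: sumr_ge0 => j _; exact: sqr_ge0.
Qed.

Let bg_le x l : adm x -> `|b x l * g| <= M2%:R.
Proof.
move=> hx; rewrite normrM (gtr0_norm g0).
apply: (@le_trans _ _ ((1 + w0) * g)); first by rewrite ler_wpM2r ?b_le// ltW.
by rewrite ltW// truncnS_gt.
Qed.

Let x_le x i : adm x -> `|x i 0 * (sq / tau)| <= M1%:R.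
Proof.
move=> [x1 _ _]; have st : 0 < sq / tau by rewrite divr_gt0.
rewrite normrM (gtr0_norm st) (@le_trans _ _ (sq / tau))//.
  by rewrite -[leRHS]mul1r ler_wpM2r ?(ltW st)// -x1 entry_le_nrm.
by rewrite ltW// truncnS_gt.
Qed.

(** An entry outside of [spread tau x] is less than 1 in the unit of the grid and rounds to 0, so
    that at most [k] entries count; Cauchy-Schwarz gives the square root. *)
Let enc1_sum x : adm x ->
  \sum_i `|cval (enc1 x i)| <= Num.sqrt (k%:R * q%:R) / tau :> R.
Proof.
move=> hx; have [x1 xk _] := hx.
have h i : `|cval (enc1 x i)| <= (if i \in spread tau x then `|x i 0| * (sq / tau) else 0) :> R.
  rewrite ffunE; have [h1 _] := rndP (x_le i hx).
  rewrite normrM (@gtr0_norm _ (sq / tau)) ?divr_gt0// in h1.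
  case: ifPn => // ; rewrite inE -ltNge x1 mulr1 => xi.
  rewrite cval_eq0 ?normr0// (le_lt_trans h1)//.
  by rewrite mulrA ltr_pdivrMr// mul1r.
apply: (le_trans (ler_sum _ (fun i _ => h i))).
rewrite -big_mkcond -mulr_suml.
apply: (@le_trans _ _ (Num.sqrt k%:R * (sq / tau))).
  rewrite ler_wpM2r//; first by rewrite ltW// divr_gt0.
  by rewrite (le_trans (sum_norm_subset _ xk))// x1 mulr1.
by rewrite sqrtrM ?ler0n// mulrA.
Qed.

Let enc2_sum x : adm x ->
  \sum_l `|cval (enc2 x l)| <= (1 + w0) * q%:R / (tau * A ^+ 2) :> R.
Proof.
move=> hx; have [_ _ bx] := hx.
have h l : `|cval (enc2 x l)| <= (if l \in big then `|b x l| * g else 0) :> R.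
  rewrite ffunE; have [h1 _] := rndP (bg_le l hx).
  case: ifPn => [_|lb]; first by rewrite (le_trans h1)// normrM (gtr0_norm g0).
  by rewrite (le_trans h1)// /b (negPf lb) mul0r normr0.
apply: (le_trans (ler_sum _ (fun i _ => h i))).
rewrite -big_mkcond -mulr_suml.
pose B := \sum_(l in big) `|b x l|.
have B2 : B ^+ 2 <= #|big|%:R * (1 + w0) ^+ 2.
  pose e := enum big.
  pose y1 : 'cV[R]_#|big| := const_mx 1.
  pose y2 : 'cV[R]_#|big| := \col_i `|b x (enum_val i)|.
  have -> : B = dot y1 y2.
    rewrite /B big_enum_val; apply: eq_bigr => i _; by rewrite !mxE mul1r.
  have n1 : nsq y1 = #|big|%:R.
    rewrite nsqE; under eq_bigr do rewrite mxE expr1n.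
    by rewrite sumr_const card_ord.
  have n2 : nsq y2 <= (1 + w0) ^+ 2.
    apply: le_trans bx.
    have -> : nsq y2 = \sum_(l in big) b x l ^+ 2.
      rewrite big_enum_val nsqE; apply: eq_bigr => i _.
      by rewrite mxE real_normK ?num_real.
    rewrite [leRHS](bigID (mem big)) /= lerDl.
    by apply: sumr_ge0 => j _; exact: sqr_ge0.
  apply: (@le_trans _ _ (nsq y1 * nsq y2)); last by rewrite n1 ler_wpM2l.
  rewrite -!sqr_nrm -exprMn -real_normK ?num_real//.
  by rewrite ler_sqr ?nnegrE ?mulr_ge0 ?nrm_ge0// normr_dot_le.
have B0 : 0 <= B by apply: sumr_ge0.
have sA : 0 <= sq / A by rewrite ltW// divr_gt0.
have BA : B <= sq / A * (1 + w0).
  rewrite -ler_sqr ?nnegrE//; last by apply: mulr_ge0 => //; exact: addr_ge0.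
  apply: (le_trans B2); rewrite exprMn ler_wpM2r ?sqr_ge0// expr_div_n sqE.
  by rewrite ler_pdivlMr ?exprn_gt0.
apply: (@le_trans _ _ (sq / A * (1 + w0) * g)); first by rewrite ler_wpM2r// ltW.
rewrite /g -sqE le_eqVlt; apply/orP; left; apply/eqP.
by field; rewrite !gt_eqF.
Qed.

Let same_code x y : adm x -> adm y -> enc1 x = enc1 y -> enc2 x = enc2 y ->
  nrm (x - y) <= 2 * tau /\ nrm (E *m (x - y)) <= 2 * tau * (1 + A) * sp.
Proof.
move=> hx hy /ffunP e1 /ffunP e2.
have st : 0 < sq / tau by rewrite divr_gt0.
have n1 : nrm (x - y) <= 2 * tau.
  apply: nrm_le_of_nsq; first by rewrite mulr_ge0// ltW.
  apply: (@le_trans _ _ (\sum_(i < q) (2 * tau / sq) ^+ 2)).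
    rewrite nsqE; apply: ler_sum => i _; rewrite !mxE.
    rewrite -real_normK ?num_real// ler_sqr ?nnegrE ?divr_ge0 ?mulr_ge0 ?(ltW tau0) ?(ltW sq0)//.
    have := e1 i; rewrite !ffunE => /(rnd_close (x_le i hx) (x_le i hy)).
    rewrite -mulrBl normrM (gtr0_norm st) -ler_pdivlMr//.
    by move=> h; rewrite (le_trans h)// invf_div mulrA.
  rewrite sumr_const card_ord -[_ *+ q]mulr_natl -sqE le_eqVlt; apply/orP; left; apply/eqP.
  by field; rewrite gt_eqF.
split => //.
have nb : \sum_l b (x - y) l ^+ 2 <= (2 * tau) ^+ 2.
  apply: (@le_trans _ _ (\sum_(l in big) (2 / g) ^+ 2)).
    rewrite [leRHS]big_mkcond; apply: ler_sum => l _; rewrite bB.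
    case: ifPn => [_|lb]; last by rewrite /b (negPf lb) subrr expr0n.
    rewrite -real_normK ?num_real// ler_sqr ?nnegrE//; last by rewrite ltW// divr_gt0.
    have := e2 l; rewrite !ffunE => /(rnd_close (bg_le l hx) (bg_le l hy)).
    by rewrite -mulrBl normrM (gtr0_norm g0) -ler_pdivlMr.
  rewrite sumr_const -[_ *+ #|big|]mulr_natl.
  have -> : #|big|%:R * (2 / g) ^+ 2 = (#|big|%:R * A ^+ 2) * ((2 * tau) ^+ 2 / q%:R).
    by rewrite /g -sqE; field; rewrite !gt_eqF.
  apply: (@le_trans _ _ (q%:R * ((2 * tau) ^+ 2 / q%:R))).
    by rewrite ler_wpM2r ?card_big// divr_ge0 ?sqr_ge0.
  by rewrite mulrC divfK// pnatr_eq0 -lt0n.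
apply: nrm_le_of_nsq; first by rewrite !mulr_ge0 ?addr_ge0// ltW.
apply: (le_trans (nsq_mul_le _)); rewrite [leRHS]exprMn spE [leRHS]mulrC ler_wpM2l//.
have n2 : nsq (x - y) <= (2 * tau) ^+ 2.
  by rewrite -sqr_nrm ler_sqr ?nnegrE ?nrm_ge0// mulr_ge0// ltW.
apply: (@le_trans _ _ (A ^+ 2 * (2 * tau) ^+ 2 + (2 * tau) ^+ 2)).
  by rewrite lerD// ler_wpM2l// sqr_ge0.
have : 0 <= (2 * tau) ^+ 2 * (2 * A) by rewrite mulr_ge0 ?sqr_ge0// mulr_ge0// ltW.
have -> : (2 * tau * (1 + A)) ^+ 2 = (2 * tau) ^+ 2 * (2 * A) +
  (A ^+ 2 * (2 * tau) ^+ 2 + (2 * tau) ^+ 2) by ring.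
by lra.
Qed.

(* A vector with few entries above the threshold is determined, up to a small
   error for [E + rmx W w], by the roundings [enc1] of its entries and [enc2] of
   its coordinates along the large singular values of [E]. There are too few
   codes to spoil a union bound over one representative [rep] of each. *)
Lemma net_lower_bound : whp Q (expR (- (c2 * p%:R / 2)))
  (fun w => opbound (rmx W w) (w0 * sp) -> forall x, (#|spread tau x| <= k)%N ->
     c0 / 2 * sp * nrm x <= nrm ((E + rmx W w) *m x)).
Proof.
pose B1 := Num.sqrt (k%:R * q%:R) / tau.
pose B2 := (1 + w0) * q%:R / (tau * A ^+ 2).
pose C1 := [set c : {ffun 'I_q -> code M1} | \sum_i `|cval (c i)| <= B1]%SET.
pose C2 := [set c : {ffun L -> code M2} | \sum_i `|cval (c i)| <= B2]%SET.
(* The representative of a code is an actual admissible vector, fixed independently of the noise, so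
   that [small_ball] applies to it. Codes of no admissible vector get an arbitrary value. *)
have /boolp.choice[rep repP] : forall c, exists y,
    (exists x, adm x /\ c = (enc1 x, enc2 x)) -> adm y /\ c = (enc1 y, enc2 y).
  move=> c.
  have [[x hx]|h] := pselect (exists x, adm x /\ c = (enc1 x, enc2 x)).
    by exists x.
  by exists 0.
have := @whp_fin _ _ _ Q _ (finset.setX C1 C2) (expR (- (c2 * p%:R)))
  (fun c w => nrm (rep c) = 1 -> c2 / th ^+ 2 * p%:R <= nsq ((E + rmx W w) *m rep c))
  (expR_ge0 _).
move=> /(_ _)[]; last move=> B [mB QB hB].
  move=> c _; have [r1|r1] := eqVneq (nrm (rep c)) 1; last first.
    exists set0; rewrite measure0; split => //; rewrite ?lee_fin ?expR_ge0//.
    by move=> w _ /eqP; rewrite (negPf r1).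
  have r2 : nsq (rep c) = 1 by rewrite -sqr_nrm r1 expr1n.
  by apply: (whpS _ (small_ball K0 v0 hth hW vW indW E r2)) => w.
exists B; split => //.
  apply: (le_trans QB); rewrite lee_fin cardsX natrM.
  have h1 := card_codes 'I_q M1 B1 la0 lae.
  have h2 := card_codes L M2 B2 la0 lae.
  apply: (@le_trans _ _ (expR (la * B1 + 4 * q%:R * expR (- la)) *
     expR (la * B2 + 4 * q%:R * expR (- la)) * expR (- (c2 * p%:R)))).
    rewrite ler_wpM2r ?expR_ge0// ler_pM//.
      by rewrite card_ord in h1.
    apply: (le_trans h2); rewrite ler_expR lerD2l ler_wpM2r ?expR_ge0//.
    by rewrite ler_wpM2l// ler_nat (diag_card dE).
  rewrite -!expRD ler_expR; have := hcount.
  rewrite /B1 /B2; set t1 := Num.sqrt _; set e := expR (- la) => h.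
  have -> : la * (t1 / tau) = la * t1 / tau by ring.
  have -> : la * ((1 + w0) * q%:R / (tau * A ^+ 2)) =
    la * (1 + w0) * q%:R / (tau * A ^+ 2) by ring.
  by lra.
move=> w /hB h opW x xk.
have [->|x0] := eqVneq x 0; first by rewrite nrm0 mulr0 nrm_ge0.
have nx : 0 < nrm x by rewrite nrm_gt0.
rewrite leNgt; apply/negP => xlt.
pose y := (nrm x)^-1 *: x.
have y1 : nrm y = 1 by rewrite nrmZ gtr0_norm ?invr_gt0// mulVf// gt_eqF.
have ylt : nrm ((E + rmx W w) *m y) < c0 / 2 * sp.
  by rewrite -scalemxAr nrmZ gtr0_norm ?invr_gt0// mulrC ltr_pdivrMr.
have yk : (#|spread tau y| <= k)%N.
  rewrite (leq_trans _ xk)// subset_leq_card//; apply/fintype.subsetP => i.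
  rewrite !inE y1 mxE normrM (gtr0_norm (_ : 0 < (nrm x)^-1)) ?invr_gt0//.
  by rewrite mulr1 -mulrA ler_pdivlMl// mulrC.
have Ey : nrm (E *m y) <= (1 + w0) * sp.
  have := nrm_sub_ge (E *m y) (rmx W w *m y); rewrite -mulmxDl => h1.
  have := opW y; rewrite y1 mulr1 => h2.
  have : c0 / 2 * sp <= 1 * sp.
    by rewrite ler_wpM2r ?(ltW sp0)//; have := c01; lra.
  by lra.
have ay : adm y.
  split => //; have pp : 0 < p%:R :> R by rewrite ltr0n.
  rewrite -(ler_pM2l pp); apply: (le_trans (sum_b_sqr y)).
  by rewrite mulrC -spE -exprMn -sqr_nrm ler_sqr ?nnegrE ?nrm_ge0// mulr_ge0 ?addr_ge0// ltW.
have [] := repP (enc1 y, enc2 y); first by exists y.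
set r := rep _ => ar [e1 e2]; have r1 : nrm r = 1 by case: ar.
have [n1 n2] := same_code ay ar e1 e2.
have := h (enc1 y, enc2 y).
rewrite finset.in_setX !inE enc1_sum// enc2_sum// -/r => /(_ isT r1) hr.
have hr' : c0 * sp <= nrm ((E + rmx W w) *m r).
  rewrite -ler_sqr ?nnegrE ?nrm_ge0 ?mulr_ge0 ?(ltW c00) ?(ltW sp0)// sqr_nrm.
  by rewrite exprMn spE (le_trans _ hr)// ler_wpM2r.
have hyr : nrm ((E + rmx W w) *m (r - y)) <= c0 / 2 * sp.
  rewrite mulmxDl (le_trans (nrmD _ _))//.
  have -> : r - y = - (y - r) by rewrite opprB.
  rewrite !mulmxN !nrmN.
  have := opW (y - r) => h1.
  have h2 : w0 * sp * nrm (y - r) <= w0 * sp * (2 * tau).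
    by rewrite ler_wpM2l// mulr_ge0// ltW.
  have h3 : 2 * tau * (1 + A + w0) * sp <= c0 / 2 * sp by rewrite ler_wpM2r// ltW.
  have e3 : 2 * tau * (1 + A + w0) * sp = 2 * tau * (1 + A) * sp + w0 * sp * (2 * tau) by ring.
  by lra.
have := nrmD ((E + rmx W w) *m y) ((E + rmx W w) *m (r - y)).
by rewrite -mulmxDr [y + _]addrC subrK; lra.
Qed.

End Net.

(* [tau] is chosen in terms of [A], then [A] large in terms of [la], and
   [kap] last. *)
Lemma compressible_lower (C0 w0 : R) : 1 <= C0 -> 0 <= w0 ->
  exists tau c kap : R, [/\ 0 < tau, 0 < c, 0 < kap &
  forall (d : measure_display) (Om : measurableType d) (Q : probability Om R)
    (p q k : nat) (W : 'I_p -> 'I_q -> Om -> R) (E : 'M[R]_(p, q))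
    (L : finType) (s : L -> R) (f : L -> 'cV[R]_q),
  (0 < p)%N -> (0 < q)%N ->
  (forall i j, centered_subgauss Q K (W i j)) ->
  (forall i j, \int[Q]_w W i j w ^+ 2 = v) ->
  mutually_independent Q (fun ij : 'I_p * 'I_q => W ij.1 ij.2) ->
  diagonalised E s f -> q%:R <= C0 * p%:R -> k%:R * q%:R <= kap * p%:R ^+ 2 ->
  whp Q (expR (- (c2 / 2 * p%:R)))
  (fun w => opbound (rmx W w) (w0 * Num.sqrt p%:R) ->
     forall x, (#|spread tau x| <= k)%N ->
     c * Num.sqrt p%:R * nrm x <= nrm ((E + rmx W w) *m x))].
Proof.
move=> C01 w00; have hc2 : c2 <= 1 / 8.
  by rewrite /c2 /sb_rate; have := expR_ge0 (- (v * th ^+ 2 / 4)); lra.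
have C00 : 0 < C0 by exact: lt_le_trans C01.
(* In the count of codes, [la] makes the third term at most [c2 p / 8], [A] the second at most
   [c2 p / 8], and [kap] the first at most [c2 p / 4]; [tau] gives equality in the rounding
   condition. *)
pose la := 64 * C0 / c2; have la0 : 0 < la by apply: divr_gt0; [exact: mulr_gt0|exact: c20].
have c0c : 0 < c0 * c2 by exact: (mulr_gt0 c00 c20).
have lae : expR (- la) <= c2 / (64 * C0).
  rewrite (le_trans (expRN_le_frac (ltW la0)))// -invf_div lef_pV2 ?posrE ?addr_gt0//.
  by rewrite lerDr.
pose A := 1 + 32 * la * (1 + w0) * (2 + w0) * C0 / (c0 * c2).
have A1 : 1 <= A.
  rewrite lerDl; apply: divr_ge0; last exact: ltW.
  apply: mulr_ge0; last exact: ltW.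
  by apply: mulr_ge0; [apply: mulr_ge0; [apply: mulr_ge0 => //; exact: ltW|]|];
    exact: addr_ge0.
have A0 : 0 < A by exact: lt_le_trans A1.
pose tau := c0 / (4 * (1 + A + w0)).
have D0 : 0 < 1 + A + w0 by lra.
have tau0 : 0 < tau by rewrite divr_gt0 ?mulr_gt0.
pose kap := (c2 * tau / (4 * la)) ^+ 2.
have kap0 : 0 < c2 * tau / (4 * la).
  by apply: divr_gt0; [exact: (mulr_gt0 c20 tau0)|exact: mulr_gt0].
exists tau, (c0 / 2), kap; split => //; first by rewrite divr_gt0.
  by rewrite exprn_gt0.
move=> d Om Q p q k W E L s f p0 q0 hW vW indW dE qp kq.
have -> : c2 / 2 * p%:R = c2 * p%:R / 2 by field.
have pp : 0 < p%:R :> R by rewrite ltr0n.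
apply: (net_lower_bound p0 q0 hW vW indW dE A0 tau0 (ltW la0) w00).
- rewrite (le_trans lae)// ler_pdivrMr ?mulr_gt0//; nra.
- rewrite /tau le_eqVlt; apply/orP; left; apply/eqP; field.
  by rewrite !gt_eqF// addr_gt0// addr_gt0.
have h1 : la * Num.sqrt (k%:R * q%:R) / tau <= c2 * p%:R / 4.
  rewrite ler_pdivrMr//.
  have : Num.sqrt (k%:R * q%:R) <= c2 * tau / (4 * la) * p%:R.
    have k2 : 0 <= c2 * tau / (4 * la) * p%:R by exact: mulr_ge0 (ltW kap0) (ltW pp).
    by rewrite -[leRHS](ger0_norm k2) -sqrtr_sqr ler_wsqrtr// exprMn.
  move=> h; have := ler_wpM2l (ltW la0) h.
  have -> : la * (c2 * tau / (4 * la) * p%:R) = c2 * p%:R / 4 * tau.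
    by field; rewrite gt_eqF.
  by [].
have h2 : la * (1 + w0) * q%:R / (tau * A ^+ 2) <= c2 * p%:R / 8.
  have tA : 0 < tau * A ^+ 2 by exact: (mulr_gt0 tau0 (exprn_gt0 _ A0)).
  rewrite ler_pdivrMr//.
  have e1 : tau * A * (4 * (2 + w0)) >= c0.
    have tD : tau * (4 * (1 + A + w0)) = c0 by rewrite /tau; field; rewrite gt_eqF.
    rewrite -[leLHS]tD -mulrA ler_pM2l//.
    have : 0 <= (A - 1) * (1 + w0) by rewrite mulr_ge0 ?subr_ge0 ?addr_ge0.
    by lra.
  have e2 : 32 * la * (1 + w0) * (2 + w0) * C0 <= A * (c0 * c2).
    have -> : A * (c0 * c2) = c0 * c2 + 32 * la * (1 + w0) * (2 + w0) * C0.
      rewrite /A mulrDl mul1r; congr (_ + _); apply: divfK; exact: lt0r_neq0.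
    by rewrite lerDr ltW.
  apply: (@le_trans _ _ (la * (1 + w0) * (C0 * p%:R))).
    by rewrite ler_wpM2l// mulr_ge0 ?(ltW la0)// addr_ge0.
  have e3 : A * (c0 * c2) <= A * (tau * A * (4 * (2 + w0)) * c2).
    by rewrite ler_pM2l// ler_pM2r.
  have w2 : 0 < 2 + w0 by lra.
  have : 32 * la * (1 + w0) * C0 * (2 + w0) <= (4 * A ^+ 2 * tau * c2) * (2 + w0).
    apply: le_trans (_ : A * (c0 * c2) <= _); first by lra.
    by rewrite (le_trans e3)// le_eqVlt; apply/orP; left; apply/eqP; ring.
  rewrite ler_pM2r// => e4; have := ler_wpM2r (ltW pp) e4; lra.
have h3 : 8 * q%:R * expR (- la) <= c2 * p%:R / 8.
  apply: (@le_trans _ _ (8 * (C0 * p%:R) * (c2 / (64 * C0)))).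
    by rewrite ler_pM ?mulr_ge0 ?expR_ge0// ler_wpM2l.
  by rewrite le_eqVlt; apply/orP; left; apply/eqP; field; rewrite gt_eqF.
have -> : c2 * p%:R / 2 = c2 * p%:R / 4 + c2 * p%:R / 8 + c2 * p%:R / 8 by field.
by apply: lerD => //; exact: lerD.
Qed.

End Compressible.

(** * The smallest singular value *)

Section Concentration.
Context {d : measure_display} {Om : measurableType d} {R : realType}.
Context (Q : probability Om R).
Local Notation intg f := (Q.-integrable [set: Om] (EFin \o f)).

Lemma integrable_sumf (I : Type) (s : seq I) (f : I -> Om -> R) :
  (forall i, intg (f i)) -> intg (fun w => \sum_(i <- s) f i w).
Proof.
move=> hf; elim: s => [|i s IH].
  rewrite (_ : (fun w => _) = cst 0); first exact: integrable_cst_fun.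
  by apply/funext => w; rewrite big_nil.
rewrite (_ : (fun w => _) = (fun w => f i w + \sum_(j <- s) f j w)).
  exact: integrable_addf.
by apply/funext => w; rewrite big_cons.
Qed.

Lemma Rint_sum (I : Type) (s : seq I) (f : I -> Om -> R) :
  (forall i, intg (f i)) ->
  \int[Q]_w (\sum_(i <- s) f i w) = \sum_(i <- s) \int[Q]_w f i w.
Proof.
move=> hf; elim: s => [|i s IH].
  by under eq_Rintegral do rewrite big_nil; rewrite Rint_cst big_nil.
under eq_Rintegral do rewrite big_cons.
by rewrite RintD ?big_cons ?IH//; exact: integrable_sumf.
Qed.

(* The indicator of a short interval is at most four times the Fejer kernel of
   order [k], whose Fourier coefficients are at the frequencies [m th]. *)
Lemma fejer_bound (S : Om -> R) (k : nat) (th dl rho : R) :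
  measurable_fun setT S -> (0 < k)%N -> 0 <= th -> k%:R * th * dl <= 1 -> 0 <= rho ->
  (forall m, (0 < m < k)%N -> `|\int[Q]_w cos (m%:R * th * S w)| <= rho) ->
  (Q [set w | (`|S w| <= dl)%R] <= (4 / k%:R + 4 * rho)%:E)%E.
Proof.
move=> mS k0 th0 kd rho0 hrho; have kk : 0 < k%:R :> R by rewrite ltr0n.
have mA : measurable [set w | `|S w| <= dl].
  rewrite -[X in measurable X]setTI; apply: measurable_fun_ler => //.
  exact: measurableT_comp.
pose c (i j : 'I_k) w := cos ((i%:R - j%:R) * th * S w).
have mc i j : measurable_fun setT (fun w => (i%:R - j%:R) * th * S w).
  by apply: measurable_funM => //; exact: measurable_cst.
have ic i j : intg (c i j) by exact: integrable_cosf.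
(* [4 / k^2] times the squared modulus of the sum of [exp (i j th S)] over [j < k]. It is
   nonnegative by [sumE] and at least 1 where all angles have modulus at most 1. Its mean is at most
   [4 / k] from the diagonal terms plus [4 rho] from the others. *)
pose F w := 4 / k%:R ^+ 2 * \sum_(i < k) \sum_(j < k) c i j w.
have sumE w : \sum_(i < k) \sum_(j < k) c i j w =
    (\sum_(i < k) cos (i%:R * th * S w)) ^+ 2 + (\sum_(i < k) sin (i%:R * th * S w)) ^+ 2.
  rewrite !expr2 !mulr_suml -big_split; apply: eq_bigr => i _ /=.
  rewrite !mulr_sumr -big_split; apply: eq_bigr => j _ /=.
  by rewrite /c -cosB; congr cos; ring.
have iF : intg F.
  apply: integrable_scale; apply: integrable_sumf => i; exact: integrable_sumf.
have mF : measurable_fun setT F by apply/measurable_EFinP; exact: measurable_int iF.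
apply: (@le_trans _ _ (\int[Q]_w (F w)%:E)%E).
  apply: prob_le_integral => //.
  - by move=> w; rewrite mulr_ge0 ?divr_ge0 ?exprn_ge0// sumE addr_ge0// sqr_ge0.
  - move=> w /= Sw; rewrite /F sumE.
    have cs (i : 'I_k) : 1 / 2 <= cos (i%:R * th * S w).
      apply: le_trans (cos_ge_quad _).
      have : `|i%:R * th * S w| <= 1.
        rewrite !normrM (ger0_norm th0) normr_nat; apply: le_trans kd.
        by rewrite ler_pM ?mulr_ge0// ler_wpM2r// ler_nat ltnW.
      rewrite -(@ler_sqr _ `|_|) ?nnegrE// expr1n real_normK ?num_real//.
      by lra.
    have h : k%:R * (1 / 2) <= \sum_(i < k) cos (i%:R * th * S w).
      rewrite -[k in k%:R]card_ord -sum1_card natr_sum mulr_suml.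
      by apply: ler_sum => i _; rewrite mul1r.
    have h2 : (k%:R * (1 / 2)) ^+ 2 <= (\sum_(i < k) cos (i%:R * th * S w)) ^+ 2.
      by rewrite ler_sqr ?nnegrE// ?(le_trans _ h) ?mulr_ge0//.
    rewrite mulrAC ler_pdivlMr ?exprn_gt0// mul1r.
    have := sqr_ge0 (\sum_(i < k) sin (i%:R * th * S w)).
    by rewrite exprMn in h2; lra.
rewrite EFin_Rint// lee_fin RintZ; last first.
  by apply: integrable_sumf => i; exact: integrable_sumf.
rewrite Rint_sum; last by move=> i; exact: integrable_sumf.
under eq_bigr do rewrite Rint_sum//.
have h i : \sum_(j < k) \int[Q]_w c i j w <= 1 + k%:R * rho.
  rewrite (bigD1 i)//=; apply: lerD.
    rewrite /c; under eq_Rintegral do rewrite subrr !mul0r cos0.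
    by rewrite Rint_cst.
  apply: (@le_trans _ _ (\sum_(j < k | j != i) rho)).
    apply: ler_sum => j ji; apply: (le_trans (ler_norm _)).
    wlog ij : i j ji / (i < j)%N => [hw|].
      have [ij|ji'|e] := ltngtP i j; first exact: hw.
        have := hw j i; rewrite eq_sym ji => /(_ isT ji').
        rewrite /c; under eq_Rintegral do rewrite -cosN -!mulNr opprB.
        by [].
      by move/eqP: ji; case; apply/val_inj.
    have := hrho (j - i)%N; rewrite subn_gt0 ij /= (leq_ltn_trans (leq_subr _ _))//.
    move=> /(_ isT); rewrite natrB ?(ltnW ij)// /c.
    by under eq_Rintegral do rewrite -cosN -!mulNr opprB.
  rewrite sumr_const -[_ *+ #|_|]mulr_natl ler_wpM2r// ler_nat.
  by rewrite (leq_trans (max_card _))// card_ord.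
apply: (@le_trans _ _ (4 / k%:R ^+ 2 * \sum_(i < k) (1 + k%:R * rho))).
  by rewrite ler_wpM2l ?divr_ge0 ?exprn_ge0//; apply: ler_sum => i _.
rewrite sumr_const card_ord -[_ *+ k]mulr_natl le_eqVlt; apply/orP; left; apply/eqP.
by field; rewrite gt_eqF.
Qed.

(** The conditions on [G] are imposed at the top frequency [k th], so that the expansion is valid at
    every [m th] with [m < k]; as [m >= 1], the bound at frequency [th] holds for all of them. *)
Lemma lincomb_small_ball (K v : R) (J : finType) (X : J -> Om -> R) (g : J -> R)
    (G : pred J) (a th dl V : R) (k : nat) :
  0 < K -> 0 < v ->
  (forall j, centered_subgauss Q K (X j)) ->
  (forall j, \int[Q]_w X j w ^+ 2 = v) ->
  mutually_independent Q X -> (0 < k)%N -> 0 <= th -> k%:R * th * dl <= 1 ->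
  (forall j, G j -> (k%:R * th * g j) ^+ 2 * v <= 1 / 8 /\
                    (k%:R * th * g j) ^+ 2 * K ^+ 4 <= v / 2) ->
  V <= \sum_(j | G j) g j ^+ 2 ->
  (Q [set w | (`|a + lincomb X g w| <= dl)%R] <=
    (4 / k%:R + 4 * expR (- (v / 4 * th ^+ 2 * V)))%:E)%E.
Proof.
move=> K0 v0 hX vX indX k0 th0 kd hG hV.
have mL := measurable_lincomb hX.
apply: (@fejer_bound _ k th); rewrite ?expR_ge0//.
  by apply: measurable_funD; first exact: measurable_cst.
move=> m /andP[m0 mk].
have -> : (fun w => cos (m%:R * th * (a + lincomb X g w))) =
    (fun w => cos (m%:R * th * a + lincomb X (fun j => m%:R * th * g j) w)).
  apply/funext => w; congr cos; rewrite mulrDr; congr (_ + _).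
  rewrite /lincomb mulr_sumr; apply: eq_bigr => j _; ring.
apply: (le_trans (norm_Rint_cos_le _ _)); rewrite modsq_shift//.
have sq j : (m%:R * th * g j) ^+ 2 <= (k%:R * th * g j) ^+ 2.
  rewrite !exprMn ler_wpM2r ?sqr_ge0// ler_wpM2r ?sqr_ge0//.
  by rewrite ler_sqr ?nnegrE// ler_nat ltnW.
have h : modsq Q (lincomb X (fun j => m%:R * th * g j)) <=
    expR (- (v / 4 * th ^+ 2 * V)) ^+ 2.
  apply: (@le_trans _ _ (expR (- (v / 2) * \sum_(j | G j) (m%:R * th * g j) ^+ 2))).
    apply: (modsq_lincomb_subgauss K0 hX indX v0 vX) => j /hG[h1 h2]; split.
      by rewrite (le_trans _ h1)// ler_wpM2r// ltW.
    by rewrite (le_trans _ h2)// ler_wpM2r// exprn_ge0// ltW.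
  rewrite -expRM_natl ler_expR.
  have h1 : th ^+ 2 * V <= \sum_(j | G j) (m%:R * th * g j) ^+ 2.
    apply: (@le_trans _ _ (th ^+ 2 * \sum_(j | G j) g j ^+ 2)).
      by rewrite ler_wpM2l ?sqr_ge0.
    rewrite mulr_sumr; apply: ler_sum => j _; rewrite !exprMn -mulrA.
    have tg : 0 <= th ^+ 2 * g j ^+ 2 by apply: mulr_ge0; exact: sqr_ge0.
    by rewrite ler_peMl//; apply: exprn_ege1; rewrite ler1n.
  have := ler_wpM2l (ltW v0) h1; lra.
by move: h => /ler_wsqrtr; rewrite sqrtr_sqr ger0_norm// expR_ge0.
Qed.

Lemma measure_bigsetU_uniq (C : choiceType) (s : seq C) (A : C -> set Om) : uniq s ->
  (forall c, measurable (A c)) -> (forall c c' w, A c w -> A c' w -> c = c') ->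
  Q (\big[setU/set0]_(c <- s) A c) = (\sum_(c <- s) Q (A c))%E.
Proof.
move=> us mA dA; elim: s us => [_|c s IH /= /andP[cs us]].
  by rewrite !big_nil measure0.
have mS : measurable (\big[setU/set0]_(c <- s) A c) by exact: bigsetU_measurable.
have d0 : A c `&` \big[setU/set0]_(c <- s) A c = set0.
  apply/seteqP; split => // w [Ac]; rewrite -bigcup_seq => -[c' /= c's Ac'].
  by move: cs; rewrite (dA _ _ _ Ac Ac') c's.
by rewrite !big_cons measureU//; congr (_ + _)%E; exact: IH.
Qed.

(** Let [A c] be the event that [c] is the first index with [N c]. These events are disjoint and
    depend on [J1] only, so the selected index fails with probability at most the sum of the
    [Q (A c) * rho], hence at most [rho]. This replaces conditioning on the variables in [J1]. *)
Lemma whp_select (I : finType) (X : I -> Om -> R) (J1 J2 : set I) (C : finType)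
    (N F : C -> set Om) (rho : R) :
  (forall i, measurable_fun setT (X i)) -> mutually_independent Q X ->
  (forall i, J1 i -> ~ J2 i) -> 0 <= rho ->
  (forall c, <<s gens X J1 >> (N c)) -> (forall c, <<s gens X J2 >> (F c)) ->
  (forall c, (Q (F c) <= rho%:E)%E) ->
  whp Q rho (fun w => (exists c, N c w) -> exists c, N c w /\ ~ F c w).
Proof.
move=> mX indX J12 rho0 sN sF QF.
pose G := g_sigma_algebraType (gens X J1).
pose A (c : C) : set Om := N c `\` \big[setU/set0]_(c' | (enum_rank c' < enum_rank c)%N) N c'.
have sA c : <<s gens X J1 >> (A c).
  apply: (@measurableD _ G); first exact: sN.
  by apply: (@bigsetU_measurable _ G) => c' _; exact: sN.
have mA c : measurable (A c) by exact: sigma_gens_measurable (sA c).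
have mF c : measurable (F c) by exact: sigma_gens_measurable (sF c).
have bigP (P : pred C) (U : C -> set Om) w :
    (\big[setU/set0]_(c | P c) U c) w <-> exists2 c, P c & U c w.
  split.
    elim/big_rec: _ => [[]|c S Pc IH [Uc|/IH//]]; by exists c.
  by move=> [c Pc Uc]; rewrite (bigD1 c)//=; left.
have disjA c c' w : A c w -> A c' w -> c = c'.
  move=> [Nc Uc] [Nc' Uc']; apply: enum_rank_inj; apply/val_inj/eqP => /=.
  have [h|h|//] := ltngtP (enum_rank c) (enum_rank c').
    by exfalso; apply: Uc'; apply/bigP; exists c.
  by exfalso; apply: Uc; apply/bigP; exists c'.
exists (\big[setU/set0]_c (A c `&` F c)); split.
- by apply: bigsetU_measurable => c _; exact: measurableI.
- rewrite measure_bigsetU_uniq ?index_enum_uniq//; last 2 first.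
    by move=> c; exact: measurableI.
    by move=> c c' w [Ac _] [Ac' _]; exact: disjA Ac Ac'.
  apply: (@le_trans _ _ (\sum_c Q (A c) * rho%:E)%E).
    apply: lee_sum => c _.
    by rewrite (indep_sigma mX indX J12 (sA c) (sF c)) lee_wpmul2l.
  rewrite -ge0_sume_distrl//.
  rewrite -[leRHS]mul1e lee_wpmul2r ?lee_fin// -measure_bigsetU_uniq ?index_enum_uniq//.
  by apply: probability_le1; apply: bigsetU_measurable => c _.
- move=> w hw [c Nc].
  have [c0 Nc0 min] := @arg_minnP _ c (fun c => `[< N c w >]) (fun c => enum_rank c) (asboolT Nc).
  have Ac0 : A c0 w.
    split; first exact/asboolP.
    move=> /bigP[c' c'c Nc']; have := min c' (asboolT Nc').
    by rewrite leqNgt c'c.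
  exists c0; split; first exact/asboolP.
  by move=> Fc0; apply: hw; apply/bigP; exists c0.
Qed.

(** A union bound would be useless, as [rho] does not decrease with [n]. Markov's inequality for the
    number of failures tolerates [k] of them, with [k] proportional to [n] in the application. *)
Lemma whp_count n (P : 'I_n -> Om -> Prop) (rho : R) (k : nat) : (0 < k)%N ->
  (forall j, whp Q rho (P j)) ->
  whp Q (n%:R * rho / k%:R)
    (fun w => exists2 T : {set 'I_n}, (#|T| <= k)%N & forall j, j \notin T -> P j w).
Proof.
move=> k0 hP; have [B hB] := boolp.choice hP.
have mB j : measurable (B j) by have [] := hB j.
pose f w := k%:R^-1 * \sum_j \1_(B j) w : R.
have mf : measurable_fun setT f.
  apply: measurable_funM; first exact: measurable_cst.
  by apply: measurable_sum => j; exact: measurable_indic.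
have kk : 0 < k%:R :> R by rewrite ltr0n.
have f0 w : 0 <= f w.
  by rewrite mulr_ge0 ?invr_ge0// sumr_ge0// => j _; rewrite indicE.
exists [set w | 1 < f w]; split.
- by rewrite -[X in measurable X]setTI; apply: measurable_fun_ltr.
- apply: (@le_trans _ _ (\int[Q]_w (f w)%:E)%E).
    apply: prob_le_integral => //; last by move=> w /= /ltW.
    by rewrite -[X in measurable X]setTI; apply: measurable_fun_ltr.
  under eq_integral do rewrite EFinM.
  rewrite ge0_integralZl//; last 2 first.
  + by apply/measurable_EFinP; apply: measurable_sum => j; exact: measurable_indic.
  + by move=> w _; rewrite lee_fin sumr_ge0// => j _; rewrite indicE.
  under eq_integral do rewrite -sumEFin.
  rewrite ge0_integral_sum//; last first.
    by move=> j; apply/measurable_EFinP; exact: measurable_indic.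
  under eq_bigr do rewrite integral_indic// setIT.
  rewrite [leRHS](_ : _ = ((k%:R^-1)%:E * \sum_(j < n) rho%:E)%E); last first.
    by rewrite sumEFin -EFinM sumr_const card_ord -(mulr_natl rho) mulrC.
  rewrite lee_pmul2l ?lte_fin ?invr_gt0//.
  by apply: lee_sum => j _; have [] := hB j.
- move=> w /= /negP; rewrite -leNgt => fw.
  exists [set j | w \in B j]%SET.
    rewrite -(ler_nat R) -sum1_card natr_sum big_mkcond /=.
    rewrite -[leRHS]mulr1 -ler_pdivrMl//.
    rewrite (le_trans _ fw)// /f ler_pM2l ?invr_gt0//; apply: ler_sum => j _.
    by rewrite indicE inE; case: ifP.
  move=> j; rewrite inE => /negP wB; have [_ _] := hB j; apply => Bw.
  by apply: wB; rewrite inE.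
Qed.

End Concentration.

(** * The distance between a column and the span of the others *)

Section SmallestSingularValue.
Context {d : measure_display} {Om : measurableType d} {R : realType}.
Context (Q : probability Om R) (K v th : R).
Context (K0 : 0 < K) (v0 : 0 < v) (hth : small_freq K v th).

Lemma jmeas_norm_le (I : finType) (X : I -> Om -> R) (J : set I) (f : Om -> R) (a : R) :
  jmeas X J f -> <<s gens X J >> [set w | `|f w| <= a].
Proof.
move=> jf; have := jf measurableT [set y : R | `|y| <= a].
rewrite setTI; apply.
by rewrite -[X in measurable X]setTI; apply: measurable_fun_ler.
Qed.

Section Column.
Context (p q : nat) (W : 'I_p -> 'I_q -> Om -> R) (E : 'M[R]_(p, q)) (j : 'I_q).
Context (hW : forall i j, centered_subgauss Q K (W i j)).
Context (vW : forall i j, \int[Q]_w W i j w ^+ 2 = v).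
Context (indW : mutually_independent Q (fun ij : 'I_p * 'I_q => W ij.1 ij.2)).

Let X (ij : 'I_p * 'I_q) := W ij.1 ij.2.

(** Entry [j'] of [(E + rmx W w)^T *m g], kept as a random variable that visibly involves column
    [j'] of the noise only. *)
Definition column_dot (j' : 'I_q) (g : 'cV[R]_p) (w : Om) : R :=
  \sum_i (E i j' + W i j' w) * g i 0.

Lemma column_dotE j' g w :
  column_dot j' g w = \sum_i E i j' * g i 0 + lincomb (W ^~ j') (fun i => g i 0) w.
Proof.
rewrite -big_split; apply: eq_bigr => i _ /=; ring.
Qed.

Lemma jmeas_column_dot j' g (J : set ('I_p * 'I_q)) :
  (forall i, J (i, j')) -> jmeas X J (column_dot j' g).
Proof.
move=> hJ; apply: measurable_sum => i; apply: measurable_funM; last exact: measurable_cst.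
apply: measurable_funD; first exact: measurable_cst.
exact: (jmeasX (X := X) (i := (i, j'))).
Qed.

(* The first candidate that is nearly orthogonal to the other columns is a
   function of these columns, hence independent of column [j]. *)
Lemma column_escape (C : finType) (g : C -> 'cV[R]_p) (cand : pred C)
    (eta d1 rho : R) : 0 <= rho ->
  (forall c, cand c -> (Q [set w | (`|column_dot j (g c) w| <= d1)%R] <= rho%:E)%E) ->
  whp Q rho (fun w =>
    (exists c, cand c /\ forall j', j' != j -> `|column_dot j' (g c) w| <= eta) ->
    exists c, [/\ cand c, forall j', j' != j -> `|column_dot j' (g c) w| <= eta &
                  d1 < `|column_dot j (g c) w|]).
Proof.
move=> rho0 hc.
pose J1 : set ('I_p * 'I_q) := [set ij | ij.2 <> j].
pose J2 : set ('I_p * 'I_q) := [set ij | ij.2 = j].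
pose N c := if cand c then \bigcap_(j' in [set j' | j' <> j])
  [set w | `|column_dot j' (g c) w| <= eta] else set0.
pose F c := if cand c then [set w | `|column_dot j (g c) w| <= d1] else set0.
have mX ij : measurable_fun setT (X ij) by have [] := hW ij.1 ij.2.
have := @whp_select _ _ _ Q _ X J1 J2 C N F rho mX indW.
move=> /(_ _ rho0)[].
- by [].
- move=> c; rewrite /N; case: ifP => _; last exact: (@measurable0 _ (g_sigma_algebraType (gens X J1))).
  apply: (@fin_bigcap_measurable _ (g_sigma_algebraType (gens X J1))) => // j' jj'.
  by apply: jmeas_norm_le; exact: jmeas_column_dot.
- move=> c; rewrite /F; case: ifP => _; last exact: (@measurable0 _ (g_sigma_algebraType (gens X J2))).
  by apply: jmeas_norm_le; exact: jmeas_column_dot.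
- move=> c; rewrite /F; case: ifP => [/hc//|_].
  by rewrite measure0 lee_fin.
move=> B [mB QB hB]; exists B; split => // w wB [c [cc hcc]].
have [|c' []] := hB w wB.
  by exists c; rewrite /N cc => j' /= /eqP; exact: hcc.
rewrite /N /F; case: ifP => // cc' h1 h2; exists c'; split => //.
  by move=> j' /eqP jj'; exact: h1.
by rewrite ltNge; exact/negP.
Qed.

(** Of the at least [beta p] entries of size at least [tau / (2 sqrt p)], at most [beta p / 2]
    exceed [sqrt (2 / (beta p))], because [nrm g <= 1]. The others are small enough for the
    expansion at frequency [kn theta], and their squares sum to at least [beta tau^2 / 8]. *)
Lemma candidate_small_ball (g : 'cV[R]_p) (beta tau rho theta d1 : R) (kn : nat) :
  (0 < p)%N -> 0 < beta -> 0 < tau -> 0 < theta -> (0 < kn)%N ->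
  nrm g <= 1 ->
  beta * p%:R <= #|[set i | tau / 2 <= `|g i 0| * Num.sqrt p%:R]%SET|%:R ->
  kn%:R * theta * d1 <= 1 ->
  (kn%:R * theta) ^+ 2 * (2 / beta) * v / p%:R <= 1 / 8 ->
  (kn%:R * theta) ^+ 2 * (2 / beta) * K ^+ 4 / p%:R <= v / 2 ->
  4 / kn%:R + 4 * expR (- (v / 4 * theta ^+ 2 * (beta * tau ^+ 2 / 8))) <= rho ->
  (Q [set w | (`|column_dot j g w| <= d1)%R] <= rho%:E)%E.
Proof.
move=> p0 b0 tau0 th0 kn0 g1 hg kd c1 c2 hrho.
have pp : 0 < p%:R :> R by rewrite ltr0n.
pose sp := Num.sqrt p%:R : R; have spE : sp ^+ 2 = p%:R by rewrite sqr_sqrtr.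
have sp0 : 0 < sp by rewrite sqrtr_gt0.
pose A := [set i | tau / 2 <= `|g i 0| * sp]%SET.
pose P := fun i => (tau / 2 <= `|g i 0| * sp) && (g i 0 ^+ 2 * p%:R <= 2 / beta).
have indj : mutually_independent Q (W ^~ j).
  by apply: (@mutually_independent_inj _ _ _ Q _ _ X (fun i => (i, j))) => // i i' [].
have nsg : nsq g <= 1 by rewrite -sqr_nrm expr_le1// nrm_ge0.
pose L := [set i | ~~ (g i 0 ^+ 2 * p%:R <= 2 / beta)]%SET.
have few : #|L|%:R <= beta * p%:R / 2.
  have : (2 / beta) * #|L|%:R <= p%:R * nsq g.
    rewrite -sum1_card natr_sum nsqE !mulr_sumr [leLHS]big_mkcond /=; apply: ler_sum => i _.
    case: ifPn => [|_]; last by rewrite mulr_ge0// sqr_ge0.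
    by rewrite inE -ltNge => /ltW h; rewrite mulr1 [leRHS]mulrC.
  move=> h; have {}h := le_trans h (ler_wpM2l (ltW pp) nsg).
  rewrite -(@ler_pM2l _ (2 / beta)) ?divr_gt0// (le_trans h)//.
  by rewrite le_eqVlt; apply/orP; left; apply/eqP; field; rewrite gt_eqF.
have many : beta * p%:R / 2 <= #|[set i | P i]%SET|%:R.
  have : (#|A| <= #|[set i | P i]%SET| + #|L|)%N.
    rewrite -cardsUI (leq_trans _ (leq_addr _ _))// subset_leq_card//.
    by apply/fintype.subsetP => i; rewrite !inE /P => ->; case: (_ <= 2 / beta).
  rewrite -(ler_nat R) natrD => h; have := le_trans hg h; lra.
have hV : beta * tau ^+ 2 / 8 <= \sum_(i | P i) g i 0 ^+ 2.
  apply: (@le_trans _ _ (\sum_(i | P i) tau ^+ 2 / (4 * p%:R))).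
    rewrite sumr_const -(mulr_natl (tau ^+ 2 / _)).
    apply: (@le_trans _ _ (beta * p%:R / 2 * (tau ^+ 2 / (4 * p%:R)))).
      by rewrite le_eqVlt; apply/orP; left; apply/eqP; field; rewrite gt_eqF.
    rewrite ler_wpM2r ?divr_ge0 ?sqr_ge0 ?mulr_ge0//.
    by rewrite cardsE in many.
  apply: ler_sum => i /andP[h _].
  rewrite ler_pdivrMr ?mulr_gt0// -spE.
  have : (tau / 2) ^+ 2 <= (`|g i 0| * sp) ^+ 2.
    by rewrite ler_sqr ?nnegrE ?mulr_ge0 ?divr_ge0 ?(ltW tau0) ?(ltW sp0).
  by rewrite [X in _ <= X]exprMn real_normK ?num_real// expr_div_n; lra.
have hG i : P i -> (kn%:R * theta * g i 0) ^+ 2 * v <= 1 / 8 /\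
    (kn%:R * theta * g i 0) ^+ 2 * K ^+ 4 <= v / 2.
  move=> /andP[_ gi].
  have gp : g i 0 ^+ 2 <= 2 / beta / p%:R by rewrite ler_pdivlMr.
  have kt : 0 <= (kn%:R * theta) ^+ 2 by exact: sqr_ge0.
  split.
    apply: le_trans c1; rewrite exprMn.
    have := ler_wpM2r (ltW v0) (ler_wpM2l kt gp); move=> h; apply: (le_trans h).
    by rewrite le_eqVlt; apply/orP; left; apply/eqP; ring.
  apply: le_trans c2; rewrite exprMn.
  have K4 : 0 <= K ^+ 4 by rewrite exprn_ge0// ltW.
  have := ler_wpM2r K4 (ler_wpM2l kt gp); move=> h; apply: (le_trans h).
  by rewrite le_eqVlt; apply/orP; left; apply/eqP; ring.
have := @lincomb_small_ball _ _ _ Q K v _ (W ^~ j) (fun i => g i 0) P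
  (\sum_i E i j * g i 0) theta d1 (beta * tau ^+ 2 / 8) kn K0 v0
  (fun i => hW i j) (fun i => vW i j) indj kn0 (ltW th0) kd hG hV.
under eq_set do rewrite -column_dotE.
by move=> h; rewrite (le_trans h)// lee_fin.
Qed.

End Column.

End SmallestSingularValue.

Section NearNormal.
Context {R : realType}.

Lemma mul_colE p q (A : 'M[R]_(p, q)) (j : 'I_q) (g : 'cV[R]_p) :
  (A^T *m g) j 0 = dot (col j A) g.
Proof. by rewrite mxE; apply: eq_bigr => i _; rewrite !mxE. Qed.

Lemma exists_normal p q (A : 'M[R]_(p, q)) (j : 'I_q) : (q <= p)%N ->
  exists2 u : 'cV[R]_p, nrm u = 1 & forall j', j' != j -> (A^T *m u) j' 0 = 0.
Proof.
move=> qp.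
have [|c [[i _ ci] hc]] := @exists_kernel R _ _ (predC1 j) (@predT 'I_p) (fun j' i => A i j').
  have q0 : (0 < q)%N by exact: leq_ltn_trans (leq0n j) (ltn_ord j).
  by rewrite cardC1 card_ord cardT size_enum_ord prednK.
pose u : 'cV[R]_p := \col_k c k.
have u0 : nrm u != 0.
  rewrite nrm_eq0; apply/eqP => /colP/(_ i); rewrite !mxE => /eqP.
  by rewrite (negPf ci).
exists ((nrm u)^-1 *: u).
  by rewrite nrmZ normfV (ger0_norm (nrm_ge0 _)) mulVf.
move=> j' jj'; rewrite -scalemxAr mxE [X in _ * X](_ : _ = 0) ?mulr0//.
rewrite mxE -[RHS](hc j' jj'); apply: eq_bigr => k _; by rewrite !mxE.
Qed.

Definition grid_vec p M (h : R) (c : {ffun 'I_p -> code M}) : 'cV[R]_p := h *: cvec c.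

(** The threshold is [tau / 2] rather than [tau] because rounding to the grid of mesh [h] loses up
    to [h sqrt p <= tau / 2]. *)
Definition grid_cand p M (h tau : R) k (c : {ffun 'I_p -> code M}) : bool :=
  let A := [set i | tau / 2 <= `|grid_vec h c i 0| * Num.sqrt p%:R]%SET in
  (nrm (grid_vec h c) <= 1) && (k < #|A|)%N.

(** Let [u] be a unit normal to all columns but [j]. Then [dot (A *m x) u] is [x j] times the only
    nonzero entry of [A^T *m u]. So a small [A *m x] and a large [x j] make [A^T *m u] small, which
    forces [u] to have many large entries by the hypothesis on [A^T]. The candidate is [u] rounded
    to the grid. *)
Lemma near_normal p q k M (A : 'M[R]_(p, q)) (x : 'cV[R]_q) (j : 'I_q)
    (tau t c eta h D : R) :
  (0 < p)%N -> (q <= p)%N -> 0 < tau -> 0 < h -> nrm x = 1 -> nrm (A *m x) <= t ->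
  tau <= `|x j 0| * Num.sqrt q%:R -> t < c * tau ->
  (forall u : 'cV[R]_p, (#|spread tau u| <= k)%N ->
     c * Num.sqrt q%:R * nrm u <= nrm (A^T *m u)) ->
  (forall j', nrm (col j' A) <= D) -> D * (h * Num.sqrt p%:R) <= eta ->
  h * Num.sqrt p%:R <= tau / 2 -> h^-1 <= M%:R ->
  exists cc : {ffun 'I_p -> code M}, grid_cand h tau k cc /\
    forall j', j' != j -> `|(A^T *m grid_vec h cc) j' 0| <= eta.
Proof.
move=> p0 qp tau0 h0 x1 Axt xj tc compT colD Deta htau hM.
have [u u1 un] := exists_normal A j qp.
have q0 : (0 < q)%N by exact: leq_ltn_trans (leq0n j) (ltn_ord j).
have sq0 : 0 < Num.sqrt q%:R :> R by rewrite sqrtr_gt0 ltr0n.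
have c0 : 0 < c.
  have : 0 < c * tau by apply: le_lt_trans tc; apply: le_trans Axt; exact: nrm_ge0.
  by rewrite pmulr_lgt0.
have Atu : nrm (A^T *m u) = `|(A^T *m u) j 0|.
  rewrite /nrm nsqE (bigD1 j)//= big1 ?addr0 ?sqrtr_sqr// => j' /un ->.
  by rewrite expr0n.
have dotE : dot (A *m x) u = x j 0 * (A^T *m u) j 0.
  rewrite dot_mulmx /dot (bigD1 j)//= big1 ?addr0// => j' /un ->.
  by rewrite mulr0.
have small : `|x j 0| * nrm (A^T *m u) <= t.
  rewrite Atu -normrM -dotE (le_trans (normr_dot_le _ _))// u1 mulr1//.
have xj0 : 0 < `|x j 0|.
  have : 0 < `|x j 0| * Num.sqrt q%:R by exact: lt_le_trans xj.
  by rewrite pmulr_lgt0.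
have uspread : (k < #|spread tau u|)%N.
  rewrite ltnNge; apply/negP => /compT; rewrite u1 mulr1 => hc.
  have h1 := le_trans (ler_wpM2l (ltW xj0) hc) small.
  have h2 : tau * c <= `|x j 0| * (c * Num.sqrt q%:R).
    by rewrite mulrCA mulrC ler_pM2l.
  by have := le_lt_trans (le_trans h2 h1) tc; rewrite mulrC ltxx.
pose y := h^-1 *: u.
have y1 : nrm y = h^-1 by rewrite nrmZ u1 mulr1 gtr0_norm// invr_gt0.
have yM : nrm y <= M%:R by rewrite y1.
have [z1 z2 _] := rvecMP yM.
set cc := rvecM M y in z1 z2.
have gu : u - grid_vec h cc = h *: (y - cvec cc).
  by rewrite scalerBr scalerA divff ?scale1r// gt_eqF.
have ngu : nrm (u - grid_vec h cc) <= h * Num.sqrt p%:R.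
  by rewrite gu nrmZ gtr0_norm// ler_pM2l.
have ent i : `|u i 0 - grid_vec h cc i 0| <= h.
  rewrite [grid_vec _ _ _ _]mxE [cvec _ _ _]mxE ffunE.
  have [_ h2] := rndP (le_trans (entry_le_nrm y i) yM).
  have -> : u i 0 = h * y i 0 by rewrite mxE mulrA divff ?mul1r// gt_eqF.
  by rewrite -mulrBr normrM gtr0_norm// ger_pMr.
exists cc; split.
  apply/andP; split.
    by rewrite nrmZ gtr0_norm// -ler_pdivlMl// mulr1 -y1.
  rewrite (leq_trans uspread)// subset_leq_card//; apply/fintype.subsetP => i.
  rewrite !inE u1 mulr1 => ui.
  have := ent i => hi; have sp0 : 0 <= Num.sqrt p%:R :> R by exact: sqrtr_ge0.
  have hb : `|u i 0| <= `|grid_vec h cc i 0| + h.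
    rewrite -lerBlDl; apply: le_trans hi; exact: lerB_dist.
  have := ler_wpM2r sp0 hb; rewrite mulrDl; lra.
move=> j' jj'.
have -> : (A^T *m grid_vec h cc) j' 0 = - (A^T *m (u - grid_vec h cc)) j' 0.
  have e (a b : 'cV[R]_q) : (a - b) j' 0 = a j' 0 - b j' 0 by rewrite !mxE.
  by rewrite mulmxBr e un// sub0r opprK.
rewrite normrN mul_colE (le_trans (normr_dot_le _ _))// (le_trans _ Deta)//.
by rewrite ler_pM ?nrm_ge0.
Qed.

(** Stated for every nearly normal [g], since the candidate delivered by [column_escape] need not be
    the rounded normal of [near_normal]. *)
Lemma near_normal_dot p q (A : 'M[R]_(p, q)) (x : 'cV[R]_q) (g : 'cV[R]_p) (j : 'I_q)
    (t eta : R) : 0 <= eta ->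
  nrm x = 1 -> nrm g <= 1 -> nrm (A *m x) <= t ->
  (forall j', j' != j -> `|(A^T *m g) j' 0| <= eta) ->
  `|x j 0| * `|(A^T *m g) j 0| <= t + Num.sqrt q%:R * eta.
Proof.
move=> eta0 x1 g1 At hn.
have e1 : x j 0 * (A^T *m g) j 0 = dot (A *m x) g -
    \sum_(j' | j' != j) x j' 0 * (A^T *m g) j' 0.
  by rewrite dot_mulmx /dot [X in _ = X - _](bigD1 j)//= addrK.
rewrite -normrM e1 (le_trans (ler_normB _ _))// lerD//.
  rewrite (le_trans (normr_dot_le _ _))// -[leRHS]mulr1 ler_pM ?nrm_ge0//.
apply: (@le_trans _ _ (\sum_j' `|x j' 0| * eta)).
  rewrite (le_trans (ler_norm_sum _ _ _))// [leRHS](bigD1 j)//= ler_wpDl ?mulr_ge0//.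
  by apply: ler_sum => j' jj'; rewrite normrM ler_wpM2l ?hn.
by rewrite -mulr_suml ler_wpM2r// (le_trans (sum_norm_le _))// x1 mulr1.
Qed.

Lemma nrm_col_le p q (E W : 'M[R]_(p, q)) (w : R) j :
  (forall i j, `|E i j| <= 1) -> opbound W (w * Num.sqrt p%:R) ->
  nrm (col j (E + W)) <= (1 + w) * Num.sqrt p%:R.
Proof.
move=> E1 hW.
have -> : col j (E + W) = col j E + W *m delta_mx j 0 by rewrite -colE linearD.
rewrite (le_trans (nrmD _ _))// mulrDl mul1r lerD//.
  rewrite ler_wsqrtr// nsqE.
  apply: (@le_trans _ _ (\sum_(i < p) 1)); last by rewrite sumr_const card_ord.
  by apply: ler_sum => i _; rewrite mxE -real_normK ?num_real// expr_le1.
rewrite (le_trans (hW _))// -[leRHS]mulr1.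
have -> : nrm (delta_mx j 0 : 'cV[R]_q) = 1; last by [].
rewrite /nrm nsqE (bigD1 j)//= big1 ?addr0; first by rewrite mxE !eqxx expr1n sqrtr1.
by move=> k kj; rewrite mxE (negPf kj) expr0n.
Qed.

End NearNormal.

Section SmallestSvSquare.
Context {R : realType} (K v th : R).
Context (K0 : 0 < K) (v0 : 0 < v) (hth : small_freq K v th).

Lemma half_lt (y : R) : 0 < y -> y / 2 < y.
Proof. by move=> y0; rewrite gtr_pMr// invf_lt1// ltr1n. Qed.

Lemma expRN_le_inv (y : R) : 0 < y -> expR (- y) <= y^-1.
Proof.
move=> y0; rewrite (le_trans (expRN_le_frac (ltW y0)))//.
by rewrite lef_pV2 ?posrE ?addr_gt0// lerDr.
Qed.

Lemma rmx_tr {d : measure_display} {Om : measurableType d} p q (W : 'I_p -> 'I_q -> Om -> R) w :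
  rmx (fun i j => W j i) w = (rmx W w)^T.
Proof. by apply/matrixP => i j; rewrite !mxE. Qed.

Lemma mutually_independent_tr {d : measure_display} {Om : measurableType d}
    (Q : probability Om R) p q (W : 'I_p -> 'I_q -> Om -> R) :
  mutually_independent Q (fun ij : 'I_p * 'I_q => W ij.1 ij.2) ->
  mutually_independent Q (fun ij : 'I_q * 'I_p => W ij.2 ij.1).
Proof.
apply: (@mutually_independent_inj _ _ _ Q _ _ (fun ij => W ij.1 ij.2)
  (fun ij : 'I_q * 'I_p => (ij.2, ij.1))).
by move=> [a b] [a' b'] [-> ->].
Qed.

(* The constants of [candidate_small_ball]. *)
Lemma exists_test (beta tau c rho : R) : 0 < beta -> 0 < tau -> 0 < c -> 0 < rho ->
  exists (theta d1 N : R) (kn : nat),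
  [/\ 0 < theta, 0 < d1, d1 <= c, (0 < kn)%N & kn%:R * theta * d1 <= 1 /\
   4 / kn%:R + 4 * expR (- (v / 4 * theta ^+ 2 * (beta * tau ^+ 2 / 8))) <= rho /\
   forall p : nat, (0 < p)%N -> N <= p%:R ->
    (kn%:R * theta) ^+ 2 * (2 / beta) * v / p%:R <= 1 / 8 /\
    (kn%:R * theta) ^+ 2 * (2 / beta) * K ^+ 4 / p%:R <= v / 2].
Proof.
move=> b0 tau0 c0 rho0.
pose V := beta * tau ^+ 2 / 8; have V0 : 0 < V by rewrite divr_gt0// mulr_gt0// exprn_gt0.
(* Both terms of the bound become at most [rho / 2]: [theta] gives the exponent [8 / rho], and [kn]
   exceeds [8 / rho]. *)
pose th2 := 32 / (rho * v * V).
have th20 : 0 < th2 by rewrite divr_gt0// !mulr_gt0.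
pose theta := Num.sqrt th2; have theta0 : 0 < theta by rewrite sqrtr_gt0.
have thE : theta ^+ 2 = th2 by rewrite sqr_sqrtr// ltW.
pose kn := (Num.truncn (8 / rho)).+1.
have kn0 : 0 < kn%:R :> R by rewrite ltr0n.
have knr : 8 / rho <= kn%:R by rewrite ltW// truncnS_gt.
pose d1 := Num.min c (kn%:R * theta)^-1.
pose A := (kn%:R * theta) ^+ 2 * (2 / beta).
have A0 : 0 <= A by rewrite mulr_ge0 ?sqr_ge0// divr_ge0// ltW.
exists theta, d1, (8 * (A * v) + 2 * (A * K ^+ 4) / v), kn; split => //.
- by rewrite lt_min c0 invr_gt0 mulr_gt0.
- by rewrite ge_min lexx.
split.
  apply: (@le_trans _ _ (kn%:R * theta * (kn%:R * theta)^-1)).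
    by rewrite ler_pM2l ?mulr_gt0// ge_min lexx orbT.
  by rewrite divff// gt_eqF// mulr_gt0.
split.
  have h1 : 4 / kn%:R <= rho / 2.
    rewrite ler_pdivrMr// -ler_pdivrMl ?divr_gt0//.
    by apply: le_trans knr; rewrite le_eqVlt; apply/orP; left; apply/eqP; field; rewrite gt_eqF.
  have h2 : v / 4 * theta ^+ 2 * V = 8 / rho.
    by rewrite thE /th2; field; rewrite !gt_eqF.
  have h3 : expR (- (8 / rho)) <= rho / 8.
    by rewrite (le_trans (expRN_le_inv _)) ?divr_gt0// invf_div.
  by rewrite -/V h2; lra.
move=> p p0 Np; have pp : 0 < p%:R :> R by rewrite ltr0n.
have Av : 0 <= 8 * (A * v) by apply: mulr_ge0 => //; exact: mulr_ge0 A0 (ltW v0).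
have AK : 0 <= 2 * (A * K ^+ 4) / v.
  apply: divr_ge0; last exact: ltW.
  by apply: mulr_ge0 => //; apply: mulr_ge0 A0 (exprn_ge0 _ (ltW K0)).
rewrite !ler_pdivrMr// -/A; split; first by lra.
have : 2 * (A * K ^+ 4) / v <= p%:R by lra.
by rewrite ler_pdivrMr//; lra.
Qed.

(* If [(E + rmx W w) *m x] is tiny then [x] is spread by [compressible_lower], and
   for each of its many large entries [j] there is a grid vector nearly normal
   to the columns other than [j], hence to column [j] as well. By
   [column_escape] few columns [j] allow this. *)
Lemma smallest_sv_square (C0 eps : R) : 1 <= C0 -> 0 < eps ->
  exists dl N : R, 0 < dl /\
  forall (d : measure_display) (Om : measurableType d) (Q : probability Om R)
    (p q : nat) (W : 'I_p -> 'I_q -> Om -> R) (E : 'M[R]_(p, q))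
    (L : finType) (s : L -> R) (f : L -> 'cV[R]_q)
    (L' : finType) (s' : L' -> R) (f' : L' -> 'cV[R]_p),
  (0 < q)%N -> N <= q%:R -> (q <= p)%N -> p%:R <= C0 * q%:R ->
  (forall i j, centered_subgauss Q K (W i j)) ->
  (forall i j, \int[Q]_w W i j w ^+ 2 = v) ->
  mutually_independent Q (fun ij : 'I_p * 'I_q => W ij.1 ij.2) ->
  (forall i j, `|E i j| <= 1) ->
  diagonalised E s f -> diagonalised E^T s' f' ->
  whp Q eps (fun w => forall x,
     dl / Num.sqrt q%:R * nrm x <= nrm ((E + rmx W w) *m x)).
Proof.
move=> C01 eps0; have C00 : 0 < C0 by exact: lt_le_trans C01.
(* The factor [sqrt (1 + C0)] converts the norm bound in [sqrt (p + q)] into one in [sqrt p] and one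
   in [sqrt q], as [compressible_lower] is used for the matrix and for its transpose. *)
pose w0 := 20 * K * Num.sqrt (1 + C0).
have K20 : 0 <= 20 * K by rewrite mulr_ge0// ltW.
have w00 : 0 <= w0 by rewrite mulr_ge0 ?sqrtr_ge0.
have [tau [c [kap [tau0 c0 kap0 hcomp]]]] := compressible_lower K0 v0 hth C01 w00.
set c2 := sb_rate v th in hcomp; have c20 : 0 < c2 by exact: sb_rate_gt0 hth.
(* The number [k] of large entries will be about [k1 q]: dividing by [C0] yields both
   [k q <= kap p^2] and [k p <= kap q^2]. With [rho = eps k1 / 8], more than [k] columns fail with
   probability at most [eps / 4]. *)
pose k1 := kap / C0; have k10 : 0 < k1 by rewrite divr_gt0.
pose beta := k1 / C0; have beta0 : 0 < beta by rewrite divr_gt0.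
pose rho := eps * k1 / 8; have rho0 : 0 < rho := divr_gt0 (mulr_gt0 eps0 k10) (ltr0Sn R 7).
have [theta [d1 [N1 [kn [th0 d10 d1c kn0 [kd [hrho hN1]]]]]]] :=
  exists_test beta0 tau0 c0 rho0.
exists (d1 * tau / 2), (Num.max N1 (Num.max (2 / k1) (Num.max (4 / eps) (Num.max (8 / (c2 * eps)) tau)))).
split; first by apply: divr_gt0 => //; exact: mulr_gt0.
move=> d Om Q p q W E L s f L' s' f' q0 Nq qp pC0 hW vW indW E1 dE dE'.
have p0 : (0 < p)%N by exact: leq_trans q0 qp.
have qq : 0 < q%:R :> R by rewrite ltr0n.
have pp : 0 < p%:R :> R by rewrite ltr0n.
have qpR : q%:R <= p%:R :> R by rewrite ler_nat.
move: Nq; rewrite !ge_max => /and5P[e1 e2 e3 e4 e0].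
pose k := Num.truncn (k1 * q%:R).
have /andP[kl kr] : k%:R <= k1 * q%:R < k.+1%:R.
  by apply: truncn_itv; apply: mulr_ge0; exact: ltW.
have k1q : 2 <= k1 * q%:R by rewrite mulrC -ler_pdivrMr.
have kh : k1 * q%:R / 2 <= k%:R by rewrite -addn1 natrD in kr; lra.
have kk : 0 < k%:R :> R by lra.
have k0 : (0 < k)%N by rewrite -(ltr0n R).
have kC : k%:R * C0 <= kap * q%:R.
  by have := ler_wpM2r (ltW C00) kl; rewrite /k1 mulrAC divfK// gt_eqF.
have opS w : opbound (rmx W w) (20 * K * Num.sqrt (p%:R + q%:R)) ->
    opbound (rmx W w) (w0 * Num.sqrt p%:R) /\
    opbound (rmx W w)^T (w0 * Num.sqrt q%:R).
  move=> h.
  have le_op a : a <= 1 + C0 -> forall n : nat, p%:R + q%:R <= (1 + C0) * n%:R ->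
      20 * K * Num.sqrt (p%:R + q%:R) <= w0 * Num.sqrt n%:R.
    move=> _ n hn; rewrite /w0 -[leRHS](mulrA (20 * K)); apply: ler_wpM2l => //.
    by rewrite -sqrtrM ?addr_ge0 ?(ltW C00)// ler_wsqrtr.
  split.
    move=> x; rewrite (le_trans (h x))// ler_wpM2r ?nrm_ge0// (le_op 0)//.
      by rewrite addr_ge0// ltW.
    rewrite mulrDl mul1r lerD2l (le_trans qpR)// -[leLHS]mul1r ler_wpM2r//.
  have h' := opbound_tr (mulr_ge0 K20 (sqrtr_ge0 _)) h.
  move=> x; rewrite (le_trans (h' x))// ler_wpM2r ?nrm_ge0// (le_op 0)//.
    by rewrite addr_ge0// ltW.
  by rewrite mulrDl mul1r addrC lerD2l.
(* With [eta = t / sqrt q] both errors in [near_normal_dot] equal [t], and [2 t sqrt q = d1 tau].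
   For an entry of size at least [tau / sqrt q], this excludes a product with column [j] above
   [d1]. *)
pose t := d1 * tau / 2 / Num.sqrt q%:R.
pose sq := Num.sqrt q%:R : R; have sq0 : 0 < sq by rewrite sqrtr_gt0.
pose sp := Num.sqrt p%:R : R; have sp0 : 0 < sp by rewrite sqrtr_gt0.
have t0 : 0 < t by apply: divr_gt0 => //; apply: divr_gt0 => //; exact: mulr_gt0.
pose eta := t / sq; have eta0 : 0 < eta by exact: divr_gt0 t0 sq0.
pose D := (1 + w0) * sp; have D0 : 0 < D by apply: mulr_gt0 => //; exact: ltr_wpDr.
pose h := Num.min (tau / 2 / sp) (eta / (D * sp)).
have h0 : 0 < h.
  rewrite lt_min; apply/andP; split; apply: divr_gt0 => //; first exact: divr_gt0.
  exact: mulr_gt0.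
have htau : h * sp <= tau / 2 by rewrite -(ler_pdivlMr _ _ sp0) ge_min lexx.
have heta : D * (h * sp) <= eta.
  have -> : D * (h * sp) = h * (D * sp) by rewrite mulrCA.
  by rewrite -(ler_pdivlMr _ _ (mulr_gt0 D0 sp0)) ge_min lexx orbT.
pose M := (Num.truncn h^-1).+1.
have hM : h^-1 <= M%:R by rewrite ltW// truncnS_gt.
have hA := opbound_whp p0 q0 K0 hW indW.
have hB := hcomp d Om Q p q k W E L s f p0 q0 hW vW indW dE _ _.
have hC := hcomp d Om Q q p k (fun i j => W j i) E^T L' s' f' q0 p0 (fun i j => hW j i)
  (fun i j => vW j i) (mutually_independent_tr indW) dE' pC0 _.
have {}hB : whp Q (expR (- (c2 / 2 * p%:R))) (fun w =>
    opbound (rmx W w) (w0 * Num.sqrt p%:R) ->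
    forall x, (#|spread tau x| <= k)%N ->
    c * Num.sqrt p%:R * nrm x <= nrm ((E + rmx W w) *m x)).
  apply: hB.
    by rewrite (le_trans qpR)// -[leLHS]mul1r ler_wpM2r.
  have h1 : k%:R * q%:R <= kap * q%:R * q%:R.
    rewrite ler_wpM2r// (le_trans _ kC)// -[leLHS]mulr1 ler_wpM2l//.
  rewrite (le_trans h1)// -mulrA ler_wpM2l ?(ltW kap0)// -expr2.
  by rewrite ler_sqr ?nnegrE.
have {}hC : whp Q (expR (- (c2 / 2 * q%:R))) (fun w =>
    opbound (rmx W w)^T (w0 * Num.sqrt q%:R) ->
    forall u, (#|spread tau u| <= k)%N ->
    c * Num.sqrt q%:R * nrm u <= nrm ((E + rmx W w)^T *m u)).
  apply: (whpS _ (hC _)).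
    by move=> w hw; rewrite -rmx_tr linearD /= -rmx_tr; exact: hw.
  apply: (@le_trans _ _ (k%:R * (C0 * q%:R))); first by rewrite ler_wpM2l.
  by rewrite mulrA expr2 mulrA ler_wpM2r.
pose Pj (j : 'I_q) w :=
  (exists cc : {ffun 'I_p -> code M}, grid_cand h tau k cc /\
      forall j', j' != j -> `|column_dot W E j' (grid_vec h cc) w| <= eta) ->
    exists cc : {ffun 'I_p -> code M}, [/\ grid_cand h tau k cc,
      forall j', j' != j -> `|column_dot W E j' (grid_vec h cc) w| <= eta &
      d1 < `|column_dot W E j (grid_vec h cc) w|].
have hPj j : whp Q rho (Pj j).
  apply: (@column_escape _ _ _ Q K p q W E j hW indW
    {ffun 'I_p -> code M} (@grid_vec R p M h) (@grid_cand R p M h tau k) eta d1 rho (ltW rho0) _).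
  move=> cc /andP[g1 gk].
  have [n1 n2] := hN1 p p0 (le_trans e1 qpR).
  apply: (candidate_small_ball K0 v0 E j hW vW indW p0 beta0 tau0 th0 kn0 g1 _ kd n1 n2 hrho).
  apply: (@le_trans _ _ k.+1%:R); last by rewrite ler_nat.
  rewrite ltW// (le_lt_trans _ kr)//.
  have -> : beta * p%:R = k1 * (p%:R / C0) by rewrite /beta mulrAC mulrA.
  by apply: (ler_wpM2l (ltW k10)); rewrite ler_pdivrMr// mulrC.
have hD := whp_count k0 hPj.
apply: (@whp_le _ _ _ Q (expR (- 2 * (p%:R + q%:R)) + expR (- (c2 / 2 * p%:R)) +
  (expR (- (c2 / 2 * q%:R)) + q%:R * rho / k%:R))).
  have c2q : 0 < c2 / 2 * q%:R := mulr_gt0 (divr_gt0 c20 (ltr0Sn R 1)) qq.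
  have b2 : expR (- (c2 / 2 * q%:R)) <= eps / 4.
    apply: (le_trans (expRN_le_inv c2q)).
    rewrite -[leRHS]invrK lef_pV2 ?posrE ?invr_gt0 ?divr_gt0// invf_div.
    rewrite ler_pdivrMr// in e4; last exact: mulr_gt0.
    by rewrite ler_pdivrMr//; lra.
  have b1 : expR (- (c2 / 2 * p%:R)) <= eps / 4.
    apply: le_trans b2; rewrite ler_expR lerN2 ler_wpM2l//.
    by apply: divr_ge0 => //; exact: ltW.
  have b0 : expR (- 2 * (p%:R + q%:R)) <= eps / 4.
    rewrite mulNr (le_trans (expRN_le_inv _))//.
      by apply: mulr_gt0 => //; exact: addr_gt0.
    rewrite -[leRHS]invrK lef_pV2 ?posrE ?invr_gt0 ?divr_gt0 ?addr_gt0 ?mulr_gt0// ?addr_gt0//.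
    by rewrite invf_div (le_trans e3)//; lra.
  have b3 : q%:R * rho / k%:R <= eps / 4.
    have -> : q%:R * rho = eps / 4 * (k1 * q%:R / 2) by rewrite /rho; field.
    by rewrite ler_pdivrMr// ler_pM2l// divr_gt0.
  have -> : eps = eps / 4 + eps / 4 + (eps / 4 + eps / 4) by field.
  exact: lerD (lerD b0 b1) (lerD b2 b3).
apply: whpS (whpI (whpI hA hB) (whpI hC hD)) => w [[hOA cX] [cY [T cT hT]]] x.
have [ho1 ho2] := opS w hOA; move: (cX ho1) (cY ho2) => {}cX {}cY.
rewrite -/t.
have [->|x0] := eqVneq x 0; first by rewrite mulmx0 !nrm0 mulr0.
have nx : 0 < nrm x by rewrite nrm_gt0.
rewrite leNgt; apply/negP => small.
pose y := (nrm x)^-1 *: x.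
have ny : nrm y = 1 by rewrite /y nrmZ ger0_norm ?invr_ge0 ?nrm_ge0// mulVf// gt_eqF.
have small1 : nrm ((E + rmx W w) *m y) <= t.
  rewrite /y -scalemxAr nrmZ ger0_norm ?invr_ge0 ?nrm_ge0// ler_pdivrMl//.
  by rewrite mulrC ltW.
have tsq : t * sq = d1 * tau / 2 by rewrite /t -/sq divfK// gt_eqF.
have sq1 : 1 <= sq by rewrite -sqrtr1 ler_wsqrtr// ler1n.
have sqq : sq * sq = q%:R by rewrite -expr2 sqr_sqrtr// ltW.
have tc : t < c * tau.
  rewrite -(ltr_pM2r sq0) tsq; apply: (@lt_le_trans _ _ (c * tau)).
    apply: (@lt_le_trans _ _ (d1 * tau)); last by rewrite ler_pM2r.
    exact/half_lt/mulr_gt0.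
  by rewrite -[leLHS]mulr1 ler_pM2l// mulr_gt0.
have tsp : t < c * sp.
  have sqsp : sq <= sp by exact: ler_wsqrtr.
  apply: (@lt_le_trans _ _ (c * sq)); last by rewrite ler_pM2l.
  have -> : (t < c * sq) = (d1 * tau / 2 < c * q%:R) by rewrite -(ltr_pM2r sq0) tsq -sqq mulrA.
  apply: (@lt_le_trans _ _ (d1 * tau)); first exact/half_lt/mulr_gt0.
  by apply: ler_pM => //; exact: ltW.
have big : (k < #|spread tau y|)%N.
  rewrite ltnNge; apply/negP => /cX; rewrite ny mulr1 => h1.
  by have := le_lt_trans (le_trans h1 small1) tsp; rewrite ltxx.
(* More than [k] large entries against at most [k] exceptional columns. *)
have [j jS jT] : exists2 j, j \in spread tau y & j \notin T.
  apply/subsetPn; apply: contraTN big => /subset_leq_card h1.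
  by rewrite -leqNgt (leq_trans h1).
have {jS}jS : tau <= `|y j 0| * sq by move: jS; rewrite inE ny mulr1.
have dotE j' g : column_dot W E j' g w = ((E + rmx W w)^T *m g) j' 0.
  by rewrite mxE; apply: eq_bigr => i _; rewrite !mxE.
have [cc [candc nc]] := near_normal p0 qp tau0 h0 ny small1 jS tc cY
  (fun j' => nrm_col_le j' E1 ho1) heta htau hM.
have /(hT j jT)[dd [candd nd]] : exists cc : {ffun 'I_p -> code M},
    grid_cand h tau k cc /\
    forall j', j' != j -> `|column_dot W E j' (grid_vec h cc) w| <= eta.
  by exists cc; split => // j' jj'; rewrite dotE; exact: nc.
rewrite dotE ltNge => /negP; apply.
have /andP[nd1 _] := candd.
have nd' j' : j' != j -> `|((E + rmx W w)^T *m grid_vec h dd) j' 0| <= eta.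
  by move=> /nd; rewrite dotE.
have := near_normal_dot (ltW eta0) ny nd1 small1 nd'.
rewrite -/sq /eta [sq * _]mulrC divfK ?gt_eqF// => H.
have H2 : tau * `|((E + rmx W w)^T *m grid_vec h dd) j 0| <= tau * d1.
  apply: (@le_trans _ _ ((t + t) * sq)).
    apply: le_trans (ler_wpM2r (ltW sq0) H).
    by rewrite mulrAC ler_wpM2r.
  by rewrite mulrDl tsq -splitr mulrC.
by rewrite ler_pM2l in H2.
Qed.

End SmallestSvSquare.

Section SmallestSvGe.
Context {R : realType} (K v th : R).
Context (K0 : 0 < K) (v0 : 0 < v) (hth : small_freq K v th).

Lemma frobenius_sq_le p q (E : 'M[R]_(p, q)) : (forall i j, `|E i j| <= 1) ->
  frobenius_sq E <= p%:R * q%:R.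
Proof.
move=> E1; apply: (@le_trans _ _ (\sum_(i < p) \sum_(j < q) 1)).
  apply: ler_sum => i _; apply: ler_sum => j _.
  by rewrite -real_normK ?num_real// exprn_ile1.
by rewrite !sumr_const !card_ord -mulrnA natrM mulrC.
Qed.

Lemma svd_diagonalised p q (E : 'M[R]_(p, q)) (S : svd E) :
  (forall i j, `|E i j| <= 1) -> diagonalised E (tnth (sv S)) (rvec S).
Proof.
move=> E1; split.
- exact: sv_ge0.
- by rewrite card_ord geq_minr.
- exact: dot_rvec.
- exact: nsq_svd_mul.
- by rewrite sum_sqr_sv frobenius_sq_le.
Qed.

Lemma svd_diagonalised_tr p q (E : 'M[R]_(p, q)) (S : svd E) :
  (forall i j, `|E i j| <= 1) -> diagonalised E^T (tnth (sv S)) (lvec S).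
Proof.
move=> E1; split.
- exact: sv_ge0.
- by rewrite card_ord geq_minl.
- exact: dot_lvec.
- exact: nsq_svd_mul_tr.
- by rewrite sum_sqr_sv mulrC frobenius_sq_le.
Qed.

(** If [q^2 <= kap p^2], the choice [k = q] makes every vector compressible and [compressible_lower]
    is enough. Otherwise [p <= C1 q] with [C1 = 1 + 1 / kap], since [kap C1^2 > 1], and
    [smallest_sv_square] applies. *)
Lemma smallest_sv_tall (eps : R) : 0 < eps ->
  exists dl N : R, 0 < dl /\
  forall (d : measure_display) (Om : measurableType d) (Q : probability Om R)
    (p q : nat) (W : 'I_p -> 'I_q -> Om -> R) (E : 'M[R]_(p, q))
    (L : finType) (s : L -> R) (f : L -> 'cV[R]_q)
    (L' : finType) (s' : L' -> R) (f' : L' -> 'cV[R]_p),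
  (0 < q)%N -> N <= q%:R -> (q <= p)%N ->
  (forall i j, centered_subgauss Q K (W i j)) ->
  (forall i j, \int[Q]_w W i j w ^+ 2 = v) ->
  mutually_independent Q (fun ij : 'I_p * 'I_q => W ij.1 ij.2) ->
  (forall i j, `|E i j| <= 1) ->
  diagonalised E s f -> diagonalised E^T s' f' ->
  whp Q eps (fun w => forall x,
     dl * Num.sqrt p%:R / q%:R * nrm x <= nrm ((E + rmx W w) *m x)).
Proof.
move=> eps0; pose w0 := 20 * K * Num.sqrt 2.
have K20 : 0 <= 20 * K by rewrite mulr_ge0// ltW.
have w00 : 0 <= w0 by rewrite mulr_ge0 ?sqrtr_ge0.
have [tau [c [kap [tau0 c0 kap0 hcomp]]]] := compressible_lower K0 v0 hth (lexx 1) w00.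
set c2 := sb_rate v th in hcomp; have c20 : 0 < c2 by exact: sb_rate_gt0 hth.
pose C1 := 1 + kap^-1.
have ik : 0 < kap^-1 by rewrite invr_gt0.
have C11 : 1 <= C1 by rewrite lerDl ltW.
have [dl [N [dl0 hsq]]] := smallest_sv_square K0 v0 hth C11 eps0.
have sC : 0 < Num.sqrt C1 by rewrite sqrtr_gt0 (lt_le_trans _ C11).
exists (Num.min c (dl / Num.sqrt C1)), (`|N| + 2 / eps + 4 / (c2 * eps)); split.
  by rewrite lt_min c0 divr_gt0.
move=> d Om Q p q W E L s f L' s' f' q0 Nq qp hW vW indW E1 dE dE'.
have p0 : (0 < p)%N by exact: leq_trans q0 qp.
have qq : 0 < q%:R :> R by rewrite ltr0n.
have pp : 0 < p%:R :> R by rewrite ltr0n.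
have q1 : 1 <= q%:R :> R by rewrite ler1n.
have qpR : q%:R <= p%:R :> R by rewrite ler_nat.
have [e1 e2 e3] : [/\ N <= q%:R, 2 / eps <= q%:R & 4 / (c2 * eps) <= q%:R].
  have h2 : 0 <= 2 / eps := divr_ge0 (ler0n R 2) (ltW eps0).
  have h3 : 0 <= 4 / (c2 * eps) := divr_ge0 (ler0n R 4) (ltW (mulr_gt0 c20 eps0)).
  have n1 := normr_ge0 N; have n2 := ler_norm N.
  by split; apply: (le_trans _ Nq); lra.
have sp0 : 0 <= Num.sqrt p%:R :> R by exact: sqrtr_ge0.
have [qk|qk] := leP (q%:R * q%:R) (kap * p%:R ^+ 2).
  have hA := opbound_whp p0 q0 K0 hW indW.
  have hB := hcomp d Om Q p q q W E L s f p0 q0 hW vW indW dE _ qk.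
  rewrite mul1r in hB; move/(_ qpR) in hB.
  apply: (@whp_le _ _ _ Q (expR (- 2 * (p%:R + q%:R)) + expR (- (c2 / 2 * p%:R)))).
    have b1 : expR (- (c2 / 2 * p%:R)) <= eps / 2.
      have c2p : 0 < c2 / 2 * p%:R := mulr_gt0 (divr_gt0 c20 (ltr0Sn R 1)) pp.
      apply: (le_trans (expRN_le_inv c2p)).
      have e2' : 0 < eps / 2 by exact: divr_gt0.
      rewrite -[leRHS]invrK lef_pV2 ?posrE ?invr_gt0// invf_div.
      move: (le_trans e3 qpR); rewrite (ler_pdivrMr _ _ (mulr_gt0 c20 eps0)) => h.
      by rewrite ler_pdivrMr//; lra.
    have b0 : expR (- 2 * (p%:R + q%:R)) <= eps / 2.
      have pq : 0 < 2 * (p%:R + q%:R) :> R by rewrite mulr_gt0// addr_gt0.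
      rewrite mulNr (le_trans (expRN_le_inv pq))//.
      rewrite -[leRHS]invrK lef_pV2 ?posrE ?invr_gt0 ?divr_gt0//.
      by rewrite invf_div (le_trans e2)//; lra.
    lra.
  apply: whpS (whpI hA hB) => w [hA1 hB1] x.
  apply: (@le_trans _ _ (c * Num.sqrt p%:R * nrm x)).
    apply: ler_wpM2r; first exact: nrm_ge0.
    rewrite ler_pdivrMr// -[leLHS]mulr1; apply: ler_pM => //.
      by apply: mulr_ge0 => //; rewrite le_min ltW// ltW// divr_gt0.
    by apply: ler_wpM2r => //; rewrite ge_min lexx.
  apply: hB1.
    move=> y; apply: (le_trans (hA1 y)); apply: ler_wpM2r; first exact: nrm_ge0.
    rewrite /w0 -[leRHS]mulrA; apply: ler_wpM2l => //.
    by rewrite -sqrtrM// ler_wsqrtr//; lra.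
  by rewrite -[leqRHS]card_ord max_card.
have pC : p%:R <= C1 * q%:R.
  rewrite leNgt; apply/negP => h.
  have : (C1 * q%:R) ^+ 2 < p%:R ^+ 2.
    by rewrite ltr_sqr ?nnegrE// mulr_ge0// (le_trans _ C11).
  move=> h2; have := ltr_pM2l kap0 ((C1 * q%:R) ^+ 2) (p%:R ^+ 2); rewrite h2 => h3.
  have : kap * (C1 * q%:R) ^+ 2 < q%:R * q%:R by rewrite (lt_trans _ qk)//.
  have -> : kap * (C1 * q%:R) ^+ 2 = (kap + 2 + kap^-1) * (q%:R * q%:R).
    by rewrite /C1; field; rewrite gt_eqF.
  rewrite -[ltRHS]mul1r ltr_pM2r ?mulr_gt0//; lra.
apply: whpS (hsq d Om Q p q W E L s f L' s' f' q0 e1 qp pC hW vW indW E1 dE dE') => w h x.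
apply: (le_trans _ (h x)); apply: ler_wpM2r; first exact: nrm_ge0.
have sq0 : 0 < Num.sqrt q%:R :> R by rewrite sqrtr_gt0.
have qE : q%:R = Num.sqrt q%:R * Num.sqrt q%:R :> R by rewrite -expr2 sqr_sqrtr.
apply: (@le_trans _ _ (dl / Num.sqrt C1 * (Num.sqrt C1 * Num.sqrt q%:R) / q%:R)).
  apply: ler_wpM2r; first by rewrite invr_ge0 ltW.
  apply: ler_pM => //.
  - by rewrite le_min ltW// ltW// divr_gt0.
  - by rewrite ge_min lexx orbT.
  - by rewrite -sqrtrM ?ler_wsqrtr// (le_trans _ C11).
by rewrite {2}qE le_eqVlt; apply/orP; left; apply/eqP; field; rewrite !gt_eqF.
Qed.

Lemma nrm_lvec p q (Z : 'M[R]_(p, q)) (S : svd Z) l : nrm (lvec S l) = 1.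
Proof. by rewrite /nrm /nsq dot_lvec eqxx sqrtr1. Qed.

Lemma nrm_rvec p q (Z : 'M[R]_(p, q)) (S : svd Z) l : nrm (rvec S l) = 1.
Proof. by rewrite /nrm /nsq dot_rvec eqxx sqrtr1. Qed.

Lemma nrm_mul_rvec p q (Z : 'M[R]_(p, q)) (S : svd Z) l :
  nrm (Z *m rvec S l) = tnth (sv S) l.
Proof.
rewrite /nrm (nsq_svd_mul S) (bigD1 l)//= big1 => [|k kl]; rewrite dot_rvec.
  by rewrite eqxx mulr1 addr0 sqrtr_sqr ger0_norm// sv_ge0.
by rewrite (negPf kl) mulr0 expr0n.
Qed.

Lemma nrm_mul_tr_lvec p q (Z : 'M[R]_(p, q)) (S : svd Z) l :
  nrm (Z^T *m lvec S l) = tnth (sv S) l.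
Proof.
rewrite /nrm (nsq_svd_mul_tr S) (bigD1 l)//= big1 => [|k kl]; rewrite dot_lvec.
  by rewrite eqxx mulr1 addr0 sqrtr_sqr ger0_norm// sv_ge0.
by rewrite (negPf kl) mulr0 expr0n.
Qed.

(** Wide matrices are transposed: a singular value is the norm of the image of a right singular
    vector, or of a left one under the transpose. *)
Lemma smallest_sv_ge (eps : R) : 0 < eps ->
  exists dl N : R, 0 < dl /\
  forall (d : measure_display) (Om : measurableType d) (Q : probability Om R)
    (p q : nat) (W : 'I_p -> 'I_q -> Om -> R) (E : 'M[R]_(p, q)) (S : svd E),
  (0 < p)%N -> (0 < q)%N -> N <= p%:R -> N <= q%:R ->
  (forall i j, centered_subgauss Q K (W i j)) ->
  (forall i j, \int[Q]_w W i j w ^+ 2 = v) ->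
  mutually_independent Q (fun ij : 'I_p * 'I_q => W ij.1 ij.2) ->
  (forall i j, `|E i j| <= 1) ->
  whp Q eps (fun w => forall (S' : svd (E + rmx W w)) l,
     dl * Num.sqrt (maxn p q)%:R / (minn p q)%:R <= tnth (sv S') l).
Proof.
move=> eps0; have [dl [N [dl0 h]]] := smallest_sv_tall eps0; exists dl, N; split => //.
move=> d Om Q p q W E S p0 q0 Np Nq hW vW indW E1.
have E1' i j : `|E^T i j| <= 1 by rewrite mxE.
have [qp|qp] := boolP (q <= p)%N.
  have H := h d Om Q p q W E _ _ _ _ _ _ q0 Nq qp hW vW indW E1
    (svd_diagonalised S E1) (svd_diagonalised_tr S E1).
  apply: whpS H => w H S' l; have := H (rvec S' l).
  rewrite nrm_mul_rvec nrm_rvec mulr1.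
  have -> : (minn p q)%:R = q%:R :> R by rewrite (minn_idPr qp).
  by rewrite (maxn_idPl qp).
have pq : (p < q)%N by rewrite ltnNge.
have dET : diagonalised E^T^T (tnth (sv S)) (rvec S).
  by rewrite trmxK; exact: svd_diagonalised.
have H := h d Om Q q p (fun i j => W j i) E^T _ _ _ _ _ _ p0 Np (ltnW pq)
    (fun i j => hW j i) (fun i j => vW j i) (mutually_independent_tr indW) E1'
    (svd_diagonalised_tr S E1) dET.
apply: whpS H => w H S' l; have := H (lvec S' l).
have -> : E^T + rmx (fun i j => W j i) w = (E + rmx W w)^T by rewrite rmx_tr linearD.
rewrite nrm_mul_tr_lvec nrm_lvec mulr1.
have -> : (minn p q)%:R = p%:R :> R by rewrite (minn_idPl (ltnW pq)).
by rewrite (maxn_idPr (ltnW pq)).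
Qed.

End SmallestSvGe.

(** * The estimation error for independent noise *)

Section EstimationBound.
Context {R : realType}.

(** The last summand pays for the regime where the noise dominates ([bad_regime_arith]); the others
    come from [good_regime_arith]. *)
Definition est_const (c k dl : R) : R :=
  (1 + c) * (c + 8 * (1 + c) * k) + c + 8 * c * (1 + c) * k +
  ((1 + c) ^+ 2 / dl + 1) * (4 * k) ^+ 4.

(** Here [a], [b], [m] stand for [sqrt p], [sqrt q], [1 / sqrt (min p q)], and [X], [N], [A], [Z],
    [e], [h] for the norms of the projected noise, the noise, the coefficients, the response, the
    averaged mean row and its noise; [d] is the product of the last noise with the coefficients. All
    rests on [w / (a b) <= 2 k m]. *)
Lemma good_regime_arith (a b g c k m X N A Z e h d s w : R) :
  s = a * b / g -> w = k * (a + b) -> 0 < a -> 0 < b -> 1 <= g -> 0 <= c -> 0 <= k -> a^-1 <= m -> b^-1 <= m ->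
  0 <= X <= c * g -> 0 <= N <= c * a -> 0 <= A <= g / b -> 0 <= Z <= (1 + c) * a ->
  0 <= e <= b -> 0 <= h <= c * b -> d <= c * (g / b) ->
  (e + h) * ((X + 2 * w * N / s + 2 * w * A + 2 * w * Z / s) / s) + d +
    h * (4 * w * Z / s ^+ 2) <=
  ((1 + c) * (c + 8 * (1 + c) * k) + c + 8 * c * (1 + c) * k) * g ^+ 4 * m.
Proof.
move=> sE wE a0 b0 g1 c0 k0 am bm /andP[X0 X1] /andP[N0 N1] /andP[A0 A1] /andP[Z0 Z1]
  /andP[e0 e1] /andP[h0 h1] d1.
have g0 : 0 < g by lra.
have m0 : 0 < m by rewrite (lt_le_trans _ am)// invr_gt0.
pose ia := a^-1; pose ib := b^-1.
have ia0 : 0 < ia by rewrite invr_gt0.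
have ib0 : 0 < ib by rewrite invr_gt0.
have w0 : 0 <= w by rewrite wE mulr_ge0//; lra.
have si : s^-1 = g * ia * ib by rewrite sE /ia /ib; field; rewrite !gt_eqF.
have si0 : 0 <= g * ia * ib by rewrite !mulr_ge0// ltW.
pose y := w * ia * ib.
have y0 : 0 <= y by rewrite /y !mulr_ge0// ltW.
have ym : y <= 2 * k * m.
  have -> : y = k * (ia + ib) by rewrite /y wE /ia /ib; field; rewrite !gt_eqF.
  have := ler_wpM2l k0 (lerD am bm); rewrite -/ia -/ib; lra.
have lam1 : (X + 2 * w * N / s + 2 * w * A + 2 * w * Z / s) / s <=
    (c * g + 4 * (1 + c) * w * (g * ib)) * (g * ia * ib).
  rewrite si; apply: ler_wpM2r => //.
  have t1 : 2 * w * N * (g * ia * ib) <= 2 * w * (c * (g * ib)).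
    have -> : 2 * w * (c * (g * ib)) = 2 * w * (c * a) * (g * ia * ib).
      by rewrite /ia /ib; field; rewrite !gt_eqF.
    by apply: ler_wpM2r => //; apply: ler_wpM2l => //; lra.
  have t2 : 2 * w * A <= 2 * w * (g * ib) by apply: ler_wpM2l => //; lra.
  have t3 : 2 * w * Z * (g * ia * ib) <= 2 * w * ((1 + c) * (g * ib)).
    have -> : 2 * w * ((1 + c) * (g * ib)) = 2 * w * ((1 + c) * a) * (g * ia * ib).
      by rewrite /ia /ib; field; rewrite !gt_eqF.
    by apply: ler_wpM2r => //; apply: ler_wpM2l => //; lra.
  lra.
have lam0 : 0 <= (c * g + 4 * (1 + c) * w * (g * ib)) * (g * ia * ib).
  rewrite mulr_ge0// addr_ge0 ?mulr_ge0//; lra.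
have gg : g ^+ 2 <= g ^+ 4 by apply: ler_weXn2l.
have g14 : g <= g ^+ 4 by rewrite -[leLHS]expr1; apply: ler_weXn2l.
have G0 : 0 < g ^+ 4 by rewrite exprn_gt0.
have T1 : (e + h) * ((X + 2 * w * N / s + 2 * w * A + 2 * w * Z / s) / s) <=
    (1 + c) * (c + 8 * (1 + c) * k) * g ^+ 4 * m.
  apply: (@le_trans _ _ ((1 + c) * b * ((c * g + 4 * (1 + c) * w * (g * ib)) * (g * ia * ib)))).
    apply: (@le_trans _ _ ((e + h) * ((c * g + 4 * (1 + c) * w * (g * ib)) * (g * ia * ib)))).
      by apply: ler_wpM2l => //; lra.
    by apply: ler_wpM2r => //; lra.
  have -> : (1 + c) * b * ((c * g + 4 * (1 + c) * w * (g * ib)) * (g * ia * ib)) =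
      (1 + c) * (g ^+ 2 * (c * ia + 4 * (1 + c) * y)).
    by rewrite /y /ia /ib; field; rewrite !gt_eqF.
  have -> : (1 + c) * (c + 8 * (1 + c) * k) * g ^+ 4 * m =
      (1 + c) * (g ^+ 4 * (c * m + 4 * (1 + c) * (2 * k * m))) by ring.
  apply: ler_wpM2l; first lra.
  apply: ler_pM => //.
  - by rewrite exprn_ge0// ltW.
  - by rewrite addr_ge0// !mulr_ge0 ?(ltW ia0)//; lra.
  - by apply: lerD; [exact: ler_wpM2l | apply: ler_wpM2l => //; lra].
have T2 : d <= c * g ^+ 4 * m.
  apply: (le_trans d1); rewrite -mulrA; apply: ler_wpM2l => //.
  by apply: ler_pM => //; rewrite ?ltW// invr_gt0.
have T3 : h * (4 * w * Z / s ^+ 2) <= 8 * c * (1 + c) * k * g ^+ 4 * m.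
  have -> : h * (4 * w * Z / s ^+ 2) = h * (4 * w * Z * (g * ia * ib) ^+ 2).
    by rewrite -exprVn si.
  have sq0 : 0 <= (g * ia * ib) ^+ 2 by exact: sqr_ge0.
  apply: (@le_trans _ _ (c * b * (4 * w * ((1 + c) * a) * (g * ia * ib) ^+ 2))).
    apply: ler_pM => //; first by apply: mulr_ge0 => //; apply: mulr_ge0 => //; lra.
    by apply: ler_wpM2r => //; apply: ler_wpM2l => //; lra.
  have -> : c * b * (4 * w * ((1 + c) * a) * (g * ia * ib) ^+ 2) =
      4 * c * (1 + c) * (g ^+ 2 * y).
    by rewrite /y /ia /ib; field; rewrite !gt_eqF.
  have -> : 8 * c * (1 + c) * k * g ^+ 4 * m = 4 * c * (1 + c) * (g ^+ 4 * (2 * k * m)).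
    by ring.
  apply: ler_wpM2l; first by rewrite !mulr_ge0//; lra.
  by apply: ler_pM => //; exact: sqr_ge0.
lra.
Qed.

(** A noise bound above half of the signal forces [mu <= 4 k g], so that [g^4 / mu] dominates
    [mu^3], the order of the estimate when the smallest singular value is only known to be at least
    [dl nu / mu^2]. *)
Lemma bad_regime_arith (mu nu g c k dl : R) :
  1 <= mu -> mu <= nu -> 0 < g -> 0 <= c -> 0 <= k -> 0 < dl ->
  mu * nu / g < 2 * (k * (mu + nu)) ->
  (1 + c) ^+ 2 * (mu * nu) / (dl * nu / mu ^+ 2) + 1 <=
  ((1 + c) ^+ 2 / dl + 1) * (4 * k) ^+ 4 * g ^+ 4 * mu^-1.
Proof.
move=> mu1 munu g0 c0 k0 dl0 h.
have mu0 : 0 < mu by lra.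
have nu0 : 0 < nu by lra.
have mug : mu <= 4 * k * g.
  rewrite ltr_pdivrMr// in h.
  have : mu * nu <= 4 * k * g * nu.
    have : k * g * (mu + nu) <= k * g * (2 * nu).
      by apply: ler_wpM2l; [rewrite mulr_ge0// ltW | lra].
    lra.
  by rewrite ler_pM2r.
have -> : (1 + c) ^+ 2 * (mu * nu) / (dl * nu / mu ^+ 2) = (1 + c) ^+ 2 / dl * mu ^+ 3.
  by field; rewrite !gt_eqF.
have c1 : 0 <= (1 + c) ^+ 2 / dl by rewrite divr_ge0 ?sqr_ge0// ltW.
have m31 : 1 <= mu ^+ 3 by rewrite exprn_ege1.
apply: (@le_trans _ _ (((1 + c) ^+ 2 / dl + 1) * mu ^+ 3)); first by rewrite mulrDl mul1r lerD2l.
have -> : ((1 + c) ^+ 2 / dl + 1) * (4 * k) ^+ 4 * g ^+ 4 * mu^-1 =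
    ((1 + c) ^+ 2 / dl + 1) * ((4 * k * g) ^+ 4 / mu) by rewrite [in RHS]exprMn !mulrA.
apply: ler_wpM2l; first lra.
rewrite ler_pdivlMr// -exprSr.
by apply: lerXn2r; rewrite ?nnegrE ?mulr_ge0// ltW.
Qed.

Section Bound.
Context (p q r : nat) (E W : 'M[R]_(p, q)) (S : svd E) (T : svd (E + W)).
Context (g c k dl : R).
Local Notation L := 'I_(minn p q).
Local Notation Pr := (fun l : L => (l < r)%N).
Local Notation a := (Num.sqrt p%:R).
Local Notation b := (Num.sqrt q%:R).

(** The disjunction serves two situations: without noise its first side holds, and with positive
    variance its second side holds with high probability in either regime. When the noise dominates,
    estimate and target are bounded separately. *)
Lemma estimation_bound (al : 'cV[R]_q) (nz z : 'cV[R]_p) (e eta : 'cV[R]_q) :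
  (0 < p)%N -> (0 < q)%N -> (r <= minn p q)%N ->
  1 <= g -> 0 <= c -> 0 <= k -> 0 < dl ->
  (forall l : L, (l < r)%N -> a * b / g <= tnth (sv S) l) ->
  (forall l : L, (r <= l)%N -> tnth (sv S) l = 0) ->
  opbound W (k * (a + b)) ->
  2 * (k * (a + b)) <= a * b / g \/
    (forall l, dl * Num.sqrt (maxn p q)%:R / (minn p q)%:R <= tnth (sv T) l) ->
  proj (rvec S) Pr al = al -> (forall y, dot e y = dot e (proj (rvec S) Pr y)) ->
  z = E *m al + nz ->
  nrm (E *m al) <= a -> nrm nz <= c * a -> nrm (proj (lvec S) Pr nz) <= c * g ->
  nrm e <= b -> nrm eta <= c * b -> `|dot eta al| <= c * (g / b) ->
  `|dot e al| <= 1 ->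
  `|dot (e + eta) (pcr T r z) - dot e al| <=
    est_const c k dl * g ^+ 4 / Num.sqrt (minn p q)%:R.
Proof.
move=> p0 q0 rm g1 c0 k0 dl0 svr sv0 opW hs pal pe zE nE nn npn ne neta deta de1.
have a1 : 1 <= a :> R by rewrite -[leLHS]sqrtr1 ler_wsqrtr// ler1n.
have b1 : 1 <= b :> R by rewrite -[leLHS]sqrtr1 ler_wsqrtr// ler1n.
have a0 : 0 < a :> R by lra.
have b0 : 0 < b :> R by lra.
have g0 : 0 < g by lra.
have s0 : 0 < a * b / g by rewrite divr_gt0 ?mulr_gt0.
have w0 : 0 <= k * (a + b) by rewrite mulr_ge0// addr_ge0// ltW.
have nz1 : nrm z <= (1 + c) * a.
  by rewrite zE (le_trans (nrmD _ _))// mulrDl mul1r lerD.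
set mu := Num.sqrt (minn p q)%:R; pose nu : R := Num.sqrt (maxn p q)%:R.
have munu : [/\ mu * nu = a * b, mu + nu = a + b, mu <= nu, 1 <= mu &
    a^-1 <= mu^-1 /\ b^-1 <= mu^-1].
  rewrite /mu /nu; case: leqP => pq.
    have le_ab : a <= b :> R by rewrite ler_wsqrtr// ler_nat.
    by split => //; split => //; rewrite lef_pV2.
  have le_ba : b <= a :> R by rewrite ler_wsqrtr// ler_nat ltnW.
  by split => //; [rewrite mulrC|rewrite addrC|split => //; rewrite lef_pV2].
case: munu => mE aE mn mu1 [am bm].
have mu0 : 0 < mu by lra.
have nu0 : 0 < nu by lra.
have C1 : 0 <= (1 + c) * (c + 8 * (1 + c) * k) + c + 8 * c * (1 + c) * k.
  rewrite !addr_ge0 ?mulr_ge0// ?addr_ge0 ?mulr_ge0// ?addr_ge0//.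
have C2 : 0 <= ((1 + c) ^+ 2 / dl + 1) * (4 * k) ^+ 4.
  by rewrite mulr_ge0 ?exprn_ge0 ?mulr_ge0// addr_ge0// divr_ge0 ?sqr_ge0// ltW.
have gm0 : 0 <= g ^+ 4 / mu by rewrite divr_ge0 ?exprn_ge0// ltW.
rewrite /est_const.
have [good|bad] := leP (2 * (k * (a + b))) (a * b / g).
  have H := good_regime_bound T rm s0 w0 svr sv0 opW good eta pal pe zE erefl.
  apply: (le_trans H).
  apply: (@le_trans _ _ (((1 + c) * (c + 8 * (1 + c) * k) + c + 8 * c * (1 + c) * k) *
    g ^+ 4 / mu)); last first.
    by rewrite -[leLHS]mulrA -[leRHS]mulrA; apply: ler_wpM2r => //; rewrite lerDl.
  apply: (good_regime_arith erefl erefl) => //; rewrite ?nrm_ge0//=.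
  have := nrm_mul_proj_ge s0 svr al; rewrite pal => h.
  rewrite ler_pdivlMr//; have := le_trans h nE.
  by rewrite mulrAC (ler_pdivrMr _ _ g0) -mulrA ler_pM2l// mulrC.
case: hs => [|smin]; first by rewrite leNgt bad.
have muE : mu ^+ 2 = (minn p q)%:R by rewrite sqr_sqrtr.
have sig0 : 0 < dl * nu / mu ^+ 2 by rewrite divr_gt0 ?mulr_gt0 ?exprn_gt0.
have np : nrm (pcr T r z) <= nrm z / (dl * nu / mu ^+ 2).
  by apply: nrm_pcr => // l _; rewrite muE; exact: smin.
apply: (@le_trans _ _ ((1 + c) ^+ 2 * (mu * nu) / (dl * nu / mu ^+ 2) + 1)).
  apply: (le_trans (ler_normB _ _)); apply: lerD => //.
  apply: (le_trans (normr_dot_le _ _)).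
  have -> : (1 + c) ^+ 2 * (mu * nu) / (dl * nu / mu ^+ 2) =
      ((1 + c) * b) * (((1 + c) * a) / (dl * nu / mu ^+ 2)).
    by rewrite mE; field; rewrite !gt_eqF.
  apply: ler_pM; rewrite ?nrm_ge0//.
    by rewrite (le_trans (nrmD _ _))// mulrDl mul1r lerD.
  by apply: (le_trans np); apply: ler_wpM2r => //; rewrite invr_ge0 ltW.
apply: (@le_trans _ _ (((1 + c) ^+ 2 / dl + 1) * (4 * k) ^+ 4 * g ^+ 4 / mu)).
  by apply: bad_regime_arith => //; rewrite mE aE.
by rewrite -[leLHS]mulrA -[leRHS]mulrA; apply: ler_wpM2r => //; rewrite lerDr.
Qed.

End Bound.
End EstimationBound.

Section NoiseEvents.
Context {d : measure_display} {Om : measurableType d} {R : realType}.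
Context (Q : probability Om R).

(** One second-moment bound serves every noise event of [finite_sample_of_events]. For the
    projection on [r] orthonormal vectors it costs [r] instead of the number of measurements. *)
Lemma markov_lincombs (K : R) (I L : finType) (X : I -> Om -> R) (P : pred L)
    (c : L -> I -> R) (B eps : R) : 0 < K ->
  (forall i, centered_subgauss Q K (X i)) -> mutually_independent Q X ->
  0 < B -> 0 < eps -> \sum_(l | P l) \sum_i c l i ^+ 2 <= B ->
  whp Q eps (fun w => \sum_(l | P l) lincomb X (c l) w ^+ 2 <=
                      4 * expR 2 * K ^+ 2 / eps * B).
Proof.
move=> K0 hX indX B0 eps0 cB.
set k := 4 * expR 2 * K ^+ 2; have k0 : 0 < k by rewrite !mulr_gt0 ?expR_gt0 ?exprn_gt0.
have D0 : 0 < k / eps * B by apply: mulr_gt0 => //; exact: divr_gt0.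
have mX i : measurable_fun setT (X i) by case: (hX i).
have mf l : measurable_fun setT (fun w => lincomb X (c l) w ^+ 2).
  by apply: measurable_funX; exact: measurable_lincomb.
have mS : measurable_fun setT (fun w => \sum_(l | P l) lincomb X (c l) w ^+ 2).
  under eq_fun do rewrite -big_filter.
  exact: measurable_sum.
have mB : measurable [set w | k / eps * B < \sum_(l | P l) lincomb X (c l) w ^+ 2].
  rewrite [X in measurable X](_ : _ = setT `&`
    (fun w => \sum_(l | P l) lincomb X (c l) w ^+ 2) @^-1` `]k / eps * B, +oo[%classic).
    exact: mS.
  by apply/seteqP; split => w /=; rewrite in_itv /= andbT; [split|case].
exists [set w | k / eps * B < \sum_(l | P l) lincomb X (c l) w ^+ 2]; split.
- exact: mB.
- pose f w := (k / eps * B)^-1 * \sum_(l | P l) lincomb X (c l) w ^+ 2.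
  apply: (@le_trans _ _ (\int[Q]_w (f w)%:E)%E).
    apply: prob_le_integral.
    + exact: mB.
    + exact: measurable_funM.
    + move=> w; rewrite mulr_ge0 ?invr_ge0 ?(ltW D0)// sumr_ge0// => l _; exact: sqr_ge0.
    + by move=> w /= h; rewrite /f ler_pdivlMl// mulr1 ltW.
  have -> : (\int[Q]_w (f w)%:E)%E = ((k / eps * B)^-1%:E *
      \int[Q]_w (\sum_(l <- [seq l <- index_enum L | P l]) (lincomb X (c l) w ^+ 2)%:E)%R)%E.
    rewrite -ge0_integralZl_EFin//=.
    - by apply: eq_integral => w _; rewrite /f EFinM sumEFin big_filter.
    - by move=> w _; apply: sume_ge0 => l _; rewrite lee_fin sqr_ge0.
    - by apply: emeasurable_sum => l; exact/measurable_EFinP.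
    - by rewrite invr_ge0 ltW.
  rewrite ge0_integral_sum//=; last 2 first.
    - by move=> l; exact/measurable_EFinP.
    - by move=> l w _; rewrite lee_fin sqr_ge0.
  rewrite big_filter.
  apply: (@le_trans _ _ ((k / eps * B)^-1%:E * (k * B)%:E)%E).
    apply: lee_wpmul2l; first by rewrite lee_fin invr_ge0 ltW.
    apply: (@le_trans _ _ (\sum_(l | P l) (k * \sum_i c l i ^+ 2)%:E)%E).
      by apply: lee_sum => l _; exact: sqr_lincomb.
    by rewrite sumEFin lee_fin -mulr_sumr ler_wpM2l// ltW.
  rewrite -EFinM lee_fin le_eqVlt; apply/orP; left; apply/eqP.
  by field; rewrite !gt_eqF.
- by move=> w /negP; rewrite -leNgt.
Qed.

End NoiseEvents.

Section RowAverage.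
Context {R : realType}.

Definition row_average P q (F : 'M[R]_(P, q)) : 'cV[R]_q :=
  \col_j (P%:R^-1 * \sum_t F t j).

Lemma dot_row_average P q (F : 'M[R]_(P, q)) x :
  dot (row_average F) x = P%:R^-1 * \sum_t (F *m x) t 0.
Proof.
rewrite mulr_sumr /dot; under eq_bigr do rewrite mxE mulr_sumr mulr_suml.
rewrite exchange_big; apply: eq_bigr => t _; rewrite mxE mulr_sumr.
by apply: eq_bigr => j _; rewrite mulrA.
Qed.

Lemma row_averageD P q (F G : 'M[R]_(P, q)) :
  row_average (F + G) = row_average F + row_average G.
Proof.
apply/matrixP => i j; rewrite !mxE -mulrDr -big_split.
by congr (_ * _); apply: eq_bigr => t _; rewrite mxE.
Qed.

Lemma normr_average_le P (f : 'I_P -> R) : (0 < P)%N -> (forall t, `|f t| <= 1) ->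
  `|P%:R^-1 * \sum_t f t| <= 1.
Proof.
move=> P0 f1; rewrite normrM gtr0_norm ?invr_gt0 ?ltr0n//.
rewrite ler_pdivrMl ?ltr0n// mulr1 (le_trans (ler_norm_sum _ _ _))//.
rewrite (le_trans (ler_sum _ (fun t _ => f1 t)))//.
by rewrite sumr_const card_ord.
Qed.

Lemma nrm_bounded n (x : 'cV[R]_n) : (forall i, `|x i 0| <= 1) -> nrm x <= Num.sqrt n%:R.
Proof.
move=> x1; apply: nrm_le_of_nsq; first exact: sqrtr_ge0.
rewrite sqr_sqrtr// nsqE (@le_trans _ _ (\sum_(i < n) 1))//.
  by apply: ler_sum => i _; rewrite -real_normK ?num_real// exprn_ile1.
by rewrite sumr_const card_ord.
Qed.

Lemma nrm_row_average P q (F : 'M[R]_(P, q)) : (0 < P)%N ->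
  (forall i j, `|F i j| <= 1) -> nrm (row_average F) <= Num.sqrt q%:R.
Proof.
move=> P0 F1; apply: nrm_bounded => j; rewrite mxE; exact: normr_average_le.
Qed.

End RowAverage.

Section FiniteSample.
Context {R : realType} (K : R) (K0 : 0 < K).

Lemma finite_sample_of_events (c k dl eps : R) : 0 < eps -> 0 <= k -> 0 < dl ->
  c = Num.sqrt (4 * expR 2 * K ^+ 2 / (eps / 8)) ->
  forall (d : measure_display) (Om : measurableType d) (Q : probability Om R)
    (p P q r : nat) (W : 'I_p -> 'I_q -> Om -> R) (nz : 'I_p -> Om -> R)
    (et : 'I_P -> 'I_q -> Om -> R) (E : 'M[R]_(p, q)) (F : 'M[R]_(P, q))
    (S : svd E) (g : R) (be : 'cV[R]_q),
  (0 < p)%N -> (0 < q)%N -> (0 < P)%N -> (0 < r <= minn p q)%N ->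
  1 <= g -> Num.sqrt r%:R <= g ->
  (forall i, centered_subgauss Q K (nz i)) -> mutually_independent Q nz ->
  (forall i j, centered_subgauss Q K (et i j)) ->
  mutually_independent Q (fun ij : 'I_P * 'I_q => et ij.1 ij.2) ->
  (forall i j, `|F i j| <= 1) ->
  (forall l : 'I_(minn p q), (l < r)%N ->
     Num.sqrt p%:R * Num.sqrt q%:R / g <= tnth (sv S) l) ->
  (forall l : 'I_(minn p q), (r <= l)%N -> tnth (sv S) l = 0) ->
  (F <= E)%MS ->
  (forall t, `|(E *m be) t 0| <= 1) -> (forall t, `|(F *m be) t 0| <= 1) ->
  whp Q (eps / 2) (fun w =>
    opbound (rmx W w) (k * (Num.sqrt p%:R + Num.sqrt q%:R)) /\
    forall T : svd (E + rmx W w),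
     2 * (k * (Num.sqrt p%:R + Num.sqrt q%:R)) <= Num.sqrt p%:R * Num.sqrt q%:R / g \/
     forall l, dl * Num.sqrt (maxn p q)%:R / (minn p q)%:R <= tnth (sv T) l) ->
  whp Q eps (fun w => forall T : svd (E + rmx W w),
    `|dot (row_average (F + rmx et w)) (pcr T r (E *m be + \col_t nz t w)) -
      P%:R^-1 * \sum_t (F *m be) t 0| <=
    est_const c k dl * g ^+ 4 / Num.sqrt (minn p q)%:R).
Proof.
move=> eps0 k0 dl0 cE d Om Q p P q r W nz et E F S g be p0 q0 P0 /andP[r0 rm] g1 rg
  hnz inz het iet F1 svr sv0 FE Ebe Fbe hW.
have e80 : 0 < eps / 8 by rewrite divr_gt0.
set C := 4 * expR 2 * K ^+ 2 / (eps / 8) in cE.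
have C0 : 0 <= C by rewrite !mulr_ge0 ?expR_ge0 ?exprn_ge0 ?invr_ge0 ?(ltW e80) ?(ltW K0).
have c0 : 0 <= c by rewrite cE sqrtr_ge0.
have cC : c ^+ 2 = C by rewrite cE sqr_sqrtr.
have g0 : 0 < g by exact: lt_le_trans g1.
have pp : 0 < p%:R :> R by rewrite ltr0n.
have qq : 0 < q%:R :> R by rewrite ltr0n.
have PP : 0 < P%:R :> R by rewrite ltr0n.
have P1 : P%:R^-1 <= 1 :> R by rewrite invf_le1// ler1n.
pose Pr := fun l : 'I_(minn p q) => (l < r)%N.
(* Projecting on the row space of [E] changes neither [E *m be] nor [F *m be], and makes the norm at
   most [g / sqrt q]: the fitted means are bounded by 1, and [E] is bounded below on that space. *)
pose al := proj (rvec S) Pr be.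
have s0 : 0 < Num.sqrt p%:R * Num.sqrt q%:R / g :> R.
  by rewrite divr_gt0// mulr_gt0// sqrtr_gt0.
have pal : proj (rvec S) Pr al = al by exact: proj_proj (dot_rvec S) _ _.
have Eproj y : E *m (proj (rvec S) Pr y) = E *m y.
  apply/eqP; rewrite -subr_eq0 -mulmxBr; apply/eqP.
  apply: (mul_kernel sv0) => l lr; rewrite dotBr dot_f_proj; last exact: dot_rvec.
  by rewrite /Pr lr subrr.
have Fproj y : F *m (proj (rvec S) Pr y) = F *m y.
  by have /submxP[D ->] := FE; rewrite -!mulmxA Eproj.
(* Four families of coefficients: the entries of the target noise, its coordinates along the left
   singular vectors, the entries of the averaged prediction noise, and its product with [al]. *)
pose c1 (l : 'I_p) (i : 'I_p) : R := (i == l)%:R.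
pose c2 (l : 'I_(minn p q)) (i : 'I_p) : R := lvec S l i 0.
pose c3 (l : 'I_q) (ij : 'I_P * 'I_q) : R := P%:R^-1 * (ij.2 == l)%:R.
pose c4 (l : 'I_1) (ij : 'I_P * 'I_q) : R := P%:R^-1 * al ij.2 0.
have h1 : whp Q (eps / 8) (fun w => \sum_l lincomb nz (c1 l) w ^+ 2 <= C * p%:R).
  apply: (markov_lincombs K0 hnz inz pp e80).
  rewrite (eq_bigr (fun=> 1)) ?sumr_const ?card_ord// => l _.
  rewrite (bigD1 l)//= /c1 eqxx expr1n big1 ?addr0// => i /negPf ->.
  by rewrite expr0n.
have h2 : whp Q (eps / 8) (fun w => \sum_(l | Pr l) lincomb nz (c2 l) w ^+ 2 <= C * r%:R).
  apply: (markov_lincombs K0 hnz inz _ e80); first by rewrite ltr0n.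
  rewrite (eq_bigr (fun=> 1)) ?sumr_const ?card_ltn_ord// => l _.
  transitivity (nsq (lvec S l)); first by rewrite nsqE.
  by rewrite /nsq dot_lvec eqxx.
have sumP (f : 'I_q -> R) : \sum_(ij : 'I_P * 'I_q) (P%:R^-1 * f ij.2) ^+ 2 =
    P%:R^-1 * \sum_j f j ^+ 2.
  rewrite -(pair_bigA _ (fun i j => (P%:R^-1 * f j) ^+ 2)) /=.
  rewrite sumr_const card_ord -(mulr_natl (\sum_(j < q) _)) !mulr_sumr.
  apply: eq_bigr => j _.
  by field; rewrite gt_eqF.
have h3 : whp Q (eps / 8) (fun w =>
    \sum_l lincomb (fun ij : 'I_P * 'I_q => et ij.1 ij.2) (c3 l) w ^+ 2 <= C * q%:R).
  apply: (markov_lincombs K0 (fun ij => het ij.1 ij.2) iet qq e80).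
  apply: (@le_trans _ _ (\sum_(l < q) 1)); last by rewrite sumr_const card_ord.
  apply: ler_sum => l _; rewrite /c3 (sumP (fun j => (j == l)%:R)).
  rewrite (bigD1 l)//= eqxx expr1n big1 ?addr0 ?mulr1// => i /negPf ->.
  by rewrite expr0n.
have nal : nrm al <= g / Num.sqrt q%:R.
  have sp0 : 0 < Num.sqrt p%:R :> R by rewrite sqrtr_gt0.
  have sq0 : 0 < Num.sqrt q%:R :> R by rewrite sqrtr_gt0.
  have := nrm_mul_proj_ge s0 svr al; rewrite pal Eproj => h.
  rewrite ler_pdivlMr//; have := le_trans h (nrm_bounded Ebe).
  by rewrite mulrAC (ler_pdivrMr _ _ g0) -mulrA ler_pM2l// mulrC.
have h4 : whp Q (eps / 8) (fun w =>
    \sum_l lincomb (fun ij : 'I_P * 'I_q => et ij.1 ij.2) (c4 l) w ^+ 2 <=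
    C * (g ^+ 2 / q%:R)).
  apply: (markov_lincombs K0 (fun ij => het ij.1 ij.2) iet _ e80).
    by rewrite divr_gt0// exprn_gt0.
  rewrite big_ord1 /c4 (sumP (fun j => al j 0)) -nsqE.
  apply: (@le_trans _ _ (nsq al)); first by rewrite ler_piMl// nsq_ge0.
  rewrite -sqr_nrm -[X in _ / X]sqr_sqrtr ?(ltW qq)// -expr_div_n.
  by rewrite ler_sqr ?nnegrE ?nrm_ge0// divr_ge0 ?sqrtr_ge0// ltW.
have le2 (a b : R) : a ^+ 2 <= C * b ^+ 2 -> 0 <= b -> `|a| <= c * b.
  move=> h b0; rewrite -[leRHS]ger0_norm ?mulr_ge0// -sqrtr_sqr -[leRHS]sqrtr_sqr.
  by rewrite ler_wsqrtr// exprMn cC.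
have := whpI hW (whpI (whpI h1 h2) (whpI h3 h4)).
have -> : eps / 2 + (eps / 8 + eps / 8 + (eps / 8 + eps / 8)) = eps by field.
apply: whpS => w [[opW hT] [[e1 e2] [e3 e4]]] T.
have lin1 l : lincomb nz (c1 l) w = nz l w.
  rewrite /lincomb (bigD1 l)//= /c1 eqxx mul1r big1 ?addr0// => i /negPf ->.
  by rewrite mul0r.
have lin2 l : lincomb nz (c2 l) w = dot (lvec S l) (\col_t nz t w).
  by apply: eq_bigr => i _; rewrite mxE.
have lin3 l : lincomb (fun ij : 'I_P * 'I_q => et ij.1 ij.2) (c3 l) w =
    row_average (rmx et w) l 0.
  rewrite /lincomb -(pair_bigA _ (fun i j => c3 l (i, j) * et i j w)) /= mxE mulr_sumr.
  apply: eq_bigr => t _; rewrite mxE (bigD1 l)//= /c3 /= eqxx mulr1 big1 ?addr0//.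
  by move=> j /negPf ->; rewrite mulr0 mul0r.
have lin4 : lincomb (fun ij : 'I_P * 'I_q => et ij.1 ij.2) (c4 0) w =
    dot (row_average (rmx et w)) al.
  rewrite dot_row_average mulr_sumr.
  rewrite /lincomb -(pair_bigA _ (fun i j => c4 0 (i, j) * et i j w)) /=.
  apply: eq_bigr => t _; rewrite mxE mulr_sumr; apply: eq_bigr => j _.
  by rewrite mxE /c4 /= -!mulrA; congr (_ * _); rewrite mulrC.
rewrite row_averageD -dot_row_average.
have -> : dot (row_average F) be = dot (row_average F) al.
  by rewrite !dot_row_average Fproj.
apply: (estimation_bound p0 q0 rm g1 c0 k0 dl0 svr sv0 opW (hT T) pal) => //.
- by move=> y; rewrite !dot_row_average Fproj.
- by rewrite Eproj.
- by rewrite Eproj nrm_bounded.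
- rewrite -[leLHS]ger0_norm ?nrm_ge0//; apply: le2; last exact: sqrtr_ge0.
  rewrite sqr_nrm nsqE sqr_sqrtr// (le_trans _ e1)// le_eqVlt.
  by apply/orP; left; apply/eqP; apply: eq_bigr => l _; rewrite lin1 mxE.
- apply: (@le_trans _ _ (c * Num.sqrt r%:R)); last exact: ler_wpM2l.
  rewrite -[leLHS]ger0_norm ?nrm_ge0//; apply: le2; last exact: sqrtr_ge0.
  rewrite sqr_nrm nsq_proj; last exact: dot_lvec.
  by rewrite sqr_sqrtr//; under eq_bigr do rewrite -lin2.
- exact: nrm_row_average.
- rewrite -[leLHS]ger0_norm ?nrm_ge0//; apply: le2; last exact: sqrtr_ge0.
  by rewrite sqr_nrm nsqE sqr_sqrtr//; under eq_bigr do rewrite -lin3.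
- apply: le2; last by rewrite divr_ge0 ?sqrtr_ge0// ltW.
  by move: e4; rewrite big_ord1 lin4 expr_div_n [in X in _ -> X]sqr_sqrtr// ltW.
- rewrite dot_row_average; apply: normr_average_le => // t.
  by rewrite Fproj.
Qed.

End FiniteSample.

Section FiniteSampleBound.
Context {R : realType} (K v : R) (K0 : 0 < K).

Lemma exists_small_freq : 0 < v -> exists th, small_freq K v th.
Proof.
move=> v0; pose m := Num.min (1 / 8 / v) (v / 2 / K ^+ 4).
have K40 : 0 < K ^+ 4 by rewrite exprn_gt0.
have m0 : 0 < m by rewrite lt_min !divr_gt0.
exists (Num.sqrt m); split; first by rewrite sqrtr_gt0.
  by rewrite sqr_sqrtr ?(ltW m0)// -ler_pdivlMr// ge_min lexx.
by rewrite sqr_sqrtr ?(ltW m0)// -ler_pdivlMr// ge_min lexx orbT.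
Qed.

Lemma whp_null {d : measure_display} {Om : measurableType d} (Q : probability Om R)
    (X : Om -> R) : centered_subgauss Q K X -> \int[Q]_w X w ^+ 2 = 0 ->
  whp Q 0 (fun w => X w = 0).
Proof.
move=> hX X2; have mX : measurable_fun setT X by case: hX.
have mX2 : measurable_fun setT (fun w => X w ^+ 2) by exact: measurable_funX.
have := EFin_Rint (integrable_subgauss_sqr K0 hX); rewrite X2 => X20.
have /ae_eq_integral_abs : measurable_fun setT (fun w => (X w ^+ 2)%:E).
  exact/measurable_EFinP.
move=> /(_ Q measurableT)[+ _]; case.
  apply: etrans X20; apply: eq_integral => w _.
  by rewrite /= ger0_norm// sqr_ge0.
move=> N [mN N0 hN]; exists N; split => //; first by rewrite N0.
move=> w nNw; apply: contrapT => /eqP Xw; apply: nNw; apply: hN => /= /(_ Logic.I).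
by move=> [] /eqP; rewrite sqrf_eq0 (negPf Xw).
Qed.

(** With [v = 0] there is no anti-concentration, but [W] vanishes almost surely and [k = 0] puts
    everything in the good regime. Otherwise [opbound_whp] and [smallest_sv_ge] supply the
    events. *)
Lemma finite_sample (eps : R) : 0 <= v -> 0 < eps ->
  exists C N : R,
  forall (d : measure_display) (Om : measurableType d) (Q : probability Om R)
    (p P q r : nat) (W : 'I_p -> 'I_q -> Om -> R) (nz : 'I_p -> Om -> R)
    (et : 'I_P -> 'I_q -> Om -> R) (E : 'M[R]_(p, q)) (F : 'M[R]_(P, q))
    (S : svd E) (g : R) (be : 'cV[R]_q),
  (0 < p)%N -> (0 < q)%N -> (0 < P)%N -> (0 < r <= minn p q)%N ->
  N <= p%:R -> N <= q%:R ->
  1 <= g -> Num.sqrt r%:R <= g ->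
  (forall i j, centered_subgauss Q K (W i j)) ->
  (forall i j, \int[Q]_w W i j w ^+ 2 = v) ->
  mutually_independent Q (fun ij : 'I_p * 'I_q => W ij.1 ij.2) ->
  (forall i, centered_subgauss Q K (nz i)) -> mutually_independent Q nz ->
  (forall i j, centered_subgauss Q K (et i j)) ->
  mutually_independent Q (fun ij : 'I_P * 'I_q => et ij.1 ij.2) ->
  (forall i j, `|E i j| <= 1) -> (forall i j, `|F i j| <= 1) ->
  (forall l : 'I_(minn p q), (l < r)%N ->
     Num.sqrt p%:R * Num.sqrt q%:R / g <= tnth (sv S) l) ->
  (forall l : 'I_(minn p q), (r <= l)%N -> tnth (sv S) l = 0) ->
  (F <= E)%MS ->
  (forall t, `|(E *m be) t 0| <= 1) -> (forall t, `|(F *m be) t 0| <= 1) ->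
  whp Q eps (fun w => forall T : svd (E + rmx W w),
    `|dot (row_average (F + rmx et w)) (pcr T r (E *m be + \col_t nz t w)) -
      P%:R^-1 * \sum_t (F *m be) t 0| <=
    C * g ^+ 4 / Num.sqrt (minn p q)%:R).
Proof.
move=> v0 eps0; pose c := Num.sqrt (4 * expR 2 * K ^+ 2 / (eps / 8)).
have [vpos|vneg] := ltP 0 v; last first.
  have vE : v = 0 by apply/eqP; rewrite eq_le vneg.
  exists (est_const c 0 1), 0 => d Om Q p P q r W nz et E F S g be p0 q0 P0 r0 _ _ g1 rg
    hW vW iW hnz inz het iet E1 F1 svr sv0 FE Ebe Fbe.
  apply: (finite_sample_of_events K0 eps0 (lexx 0) ltr01 erefl p0 q0 P0 r0 g1 rg
    hnz inz het iet F1 svr sv0 FE Ebe Fbe).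
  have h1 : forall ij, ij \in [set: 'I_p * 'I_q]%SET -> whp Q 0 (fun w => W ij.1 ij.2 w = 0).
    by move=> ij _; apply: whp_null => //; rewrite vW.
  have := whp_fin (lexx 0) h1; rewrite mulr0 => h2.
  apply: (@whp_le _ _ _ Q 0); first by rewrite divr_ge0// ltW.
  apply: whpS h2 => w h2; split; last first.
    move=> T; left; rewrite mul0r mulr0 divr_ge0 ?mulr_ge0 ?sqrtr_ge0//.
    exact: le_trans g1.
  have -> : rmx W w = 0.
    by apply/matrixP => i j; rewrite !mxE; exact: (h2 (i, j) (finset.in_setT _)).
  by move=> x; rewrite mul0mx nrm0 !mul0r.
have [th hth] := exists_small_freq vpos.
have e40 : 0 < eps / 4 by rewrite divr_gt0.
have [dl [N [dl0 hs]]] := smallest_sv_ge K0 vpos hth e40.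
exists (est_const c (20 * K) dl), (`|N| + 4 / eps).
move=> d Om Q p P q r W nz et E F S g be p0 q0 P0 r0 Np Nq g1 rg
    hW vW iW hnz inz het iet E1 F1 svr sv0 FE Ebe Fbe.
have K20 : 0 <= 20 * K by rewrite mulr_ge0// ltW.
apply: (finite_sample_of_events K0 eps0 K20 dl0 erefl p0 q0 P0 r0 g1 rg
    hnz inz het iet F1 svr sv0 FE Ebe Fbe).
have e4 : 0 <= 4 / eps by rewrite divr_ge0// ltW.
have n1 := normr_ge0 N; have n2 := ler_norm N.
have Np' : N <= p%:R by lra.
have Nq' : N <= q%:R by lra.
have hB := hs d Om Q p q W E S p0 q0 Np' Nq' hW vW iW E1.
have hA := opbound_whp p0 q0 K0 hW iW.
apply: (@whp_le _ _ _ Q (expR (- 2 * (p%:R + q%:R)) + eps / 4)).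
  have pp : 0 < p%:R :> R by rewrite ltr0n.
  have qq : 0 < q%:R :> R by rewrite ltr0n.
  have pq : 0 < 2 * (p%:R + q%:R) :> R by rewrite mulr_gt0// addr_gt0.
  have : expR (- 2 * (p%:R + q%:R)) <= eps / 4.
    rewrite mulNr (le_trans (expRN_le_inv pq))//.
    rewrite -[leRHS]invrK lef_pV2 ?posrE ?invr_gt0//.
    by rewrite invf_div; lra.
  lra.
apply: whpS (whpI hA hB) => w [hA1 hB1]; split; last by move=> T; right; exact: hB1.
move=> x; apply: (le_trans (hA1 x)); apply: ler_wpM2r; first exact: nrm_ge0.
apply: ler_wpM2l => //.
rewrite -[leRHS]ger0_norm ?addr_ge0 ?sqrtr_ge0// -sqrtr_sqr ler_wsqrtr//.
rewrite sqrrD !sqr_sqrtr// lerD2r lerDl mulrn_wge0// mulr_ge0// sqrtr_ge0.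
Qed.

End FiniteSampleBound.

(** * Conditional laws *)

Section Conditioning.
Context {d : measure_display} {Om : measurableType d} {R : realType}.
Context (P : probability Om R).

Lemma sigma_gen_measurable (G : set (set Om)) A : G `<=` measurable ->
  <<s G >> A -> measurable A.
Proof.
move=> GM GA; apply: (smallest_sub _ GM GA); exact: sigma_algebra_measurable.
Qed.

Lemma sigma_genC (G : set (set Om)) A : <<s G >> A -> <<s G >> (~` A).
Proof. by move=> hA; exact: (@measurableC _ (g_sigma_algebraType G) A hA). Qed.

Lemma sigma_genI (G : set (set Om)) A B :
  <<s G >> A -> <<s G >> B -> <<s G >> (A `&` B).
Proof.
by move=> hA hB; exact: (@measurableI _ (g_sigma_algebraType G) A B hA hB).
Qed.

Section OneKernel.
Context (G : set (set Om)) (K : Om -> probability Om R).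
Context (GM : G `<=` measurable) (hK : is_regular_cond_prob P G K).

Lemma kernel_lt_gen E (al : R) : measurable E -> <<s G >> [set x | (K x E < al%:E)%E].
Proof.
move=> mE; have [mK _] := hK.
have := mK E mE measurableT _ (emeasurable_itv `]-oo, al%:E[).
by rewrite setTI; congr (<<s G >> _); apply/seteqP; split => x /=; rewrite in_itv.
Qed.

Lemma kernel_gt_gen E (al : R) : measurable E -> <<s G >> [set x | (al%:E < K x E)%E].
Proof.
move=> mE; have [mK _] := hK.
have := mK E mE measurableT _ (emeasurable_itv `]al%:E, +oo[).
rewrite setTI; congr (<<s G >> _); apply/seteqP; split => x /=; rewrite in_itv/= andbC.
  by case/andP.
by move=> ->.
Qed.

Lemma measurable_kernel E : measurable E -> measurable_fun setT (fun x => K x E).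
Proof.
move=> mE _ Y mY; apply: (sigma_gen_measurable GM).
by have [mK _] := hK; exact: mK.
Qed.

Lemma integral_kernel_le E D (al : R) : measurable E -> <<s G >> D ->
  (forall x, D x -> (K x E <= al%:E)%E) -> (P (E `&` D) <= al%:E * P D)%E.
Proof.
move=> mE GD h; have mD := sigma_gen_measurable GM GD.
have [_ ->] := hK; rewrite // -integral_cst//.
apply: ge0_le_integral => //.
by apply: (measurable_funS measurableT) => //; exact: measurable_kernel.
Qed.

Lemma integral_kernel_ge E D (al : R) : measurable E -> <<s G >> D -> 0 <= al ->
  (forall x, D x -> (al%:E <= K x E)%E) -> (al%:E * P D <= P (E `&` D))%E.
Proof.
move=> mE GD al0 h; have mD := sigma_gen_measurable GM GD.
have [_ ->] := hK; rewrite // -integral_cst//.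
apply: ge0_le_integral => //.
by apply: (measurable_funS measurableT) => //; exact: measurable_kernel.
Qed.

(** On the part [D n] of [C] where the kernel is below [1 - 1 / (n + 1)], integration gives
    [P (D n) <= (1 - 1 / (n + 1)) P (D n)], so this part is null; these parts exhaust the
    failures. *)
Lemma kernel_self C : <<s G >> C -> {ae P, forall x, C x -> K x C = 1%E}.
Proof.
move=> GC; have mC := sigma_gen_measurable GM GC.
pose al (n : nat) : R := 1 - n.+1%:R^-1.
pose D n := C `&` [set x | (K x C < (al n)%:E)%E].
have GD n : <<s G >> (D n) by apply: sigma_genI => //; exact: kernel_lt_gen.
have D0 n : P (D n) = 0%E.
  have mD := sigma_gen_measurable GM (GD n).
  have : (P (C `&` D n) <= (al n)%:E * P (D n))%E.
    by apply: integral_kernel_le => // x [_ /= /ltW].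
  have -> : C `&` D n = D n by rewrite /D setIA setIid.
  have [s sE] : exists s, P (D n) = s%:E.
    by exists (fine (P (D n))); rewrite fineK// fin_num_measure.
  have s0 : 0 <= s by rewrite -lee_fin -sE.
  rewrite sE -EFinM lee_fin /al mulrBl mul1r lerBrDr gerDl.
  by rewrite pmulr_rle0 ?invr_gt0 ?ltr0n// => s1; congr (_%:E); lra.
apply: (@negligibleS _ _ _ P (\bigcup_n D n)); last first.
  apply: negligible_bigcup => n; exists (D n); split => //; last exact: D0.
  exact: sigma_gen_measurable GM (GD n).
move=> x /= /not_implyP[Cx K1].
have : (K x C < 1)%E.
  by rewrite lt_neqAle; apply/andP; split; [exact/eqP|exact: probability_le1].
have [s sE] : exists s, K x C = s%:E.
  by exists (fine (K x C)); rewrite fineK// fin_num_measure.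
rewrite sE lte_fin -subr_gt0 => s1.
have [n] := ltr_add_invr s1; rewrite add0r => hn.
by exists n => //; split => //=; rewrite sE lte_fin /al ltrBrDr addrC -ltrBrDr.
Qed.

End OneKernel.

(* On the atom [EA] the two sigma-algebras have the same trace, so that it is
   enough to compare the kernels on the events [b < K1 EY, K2 EY < a] and
   [K1 EY < a, b < K2 EY] with [a < b]. *)
Lemma kernel_refine (G1 G2 : set (set Om)) (K1 K2 : Om -> probability Om R) EA EY :
  G1 `<=` measurable -> G2 `<=` measurable -> G1 `<=` G2 -> <<s G2 >> EA ->
  (forall D, <<s G2 >> D -> exists2 D', <<s G1 >> D' & EA `&` D = EA `&` D') ->
  is_regular_cond_prob P G1 K1 -> is_regular_cond_prob P G2 K2 ->
  measurable EY ->
  {ae P, forall x, K1 x (EY `&` EA) = (K1 x EY * K1 x EA)%E} ->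
  {ae P, forall x, EA x -> K2 x EY = K1 x EY}.
Proof.
move=> G1M G2M G12 GEA tr h1 h2 mEY ign.
have mEA := sigma_gen_measurable G2M GEA.
have G12' D : <<s G1 >> D -> <<s G2 >> D.
  by apply: smallest_sub;
    [exact: smallest_sigma_algebra|exact: subset_trans (@sub_gen_smallest _ _ _)].
have mK1 E D : measurable E -> measurable D -> measurable_fun D (fun x => K1 x E).
  by move=> mE mD; apply: (measurable_funS measurableT) => //; exact: measurable_kernel h1 _ _.
have intD D : <<s G1 >> D -> P (EA `&` D) = (\int[P]_(x in D) K1 x EA)%E /\
    P (EY `&` (EA `&` D)) = (\int[P]_(x in D) K1 x (EY `&` EA))%E.
  by have [_ h] := h1; split; rewrite ?setIA h//; exact: measurableI.
have null D a b : a < b -> <<s G1 >> D -> (b%:E * P (EA `&` D) <= P (EY `&` (EA `&` D)))%E ->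
    (P (EY `&` (EA `&` D)) <= a%:E * P (EA `&` D))%E -> P (EA `&` D) = 0%E.
  move=> ab GD l1 l2; have mD := sigma_gen_measurable G1M GD.
  have [s sE] : exists s, P (EA `&` D) = s%:E.
    by exists (fine (P (EA `&` D))); rewrite fineK// fin_num_measure//; exact: measurableI.
  have s0 : 0 <= s by rewrite -lee_fin -sE.
  have := le_trans l1 l2; rewrite sE -!EFinM lee_fin => h.
  have : (b - a) * s <= 0 by lra.
  by rewrite pmulr_rle0 ?subr_gt0// => s1; congr (_%:E); lra.
(* Replace the event of [K2] by a set of the coarse sigma-algebra with the same trace on [EA]. By
   ignorability the probability of [EY], [EA] and [D] together is the integral of [K1 EY * K1 EA]
   over [D], so at least [b] times that of [EA] and [D]; through [K2] it is at most [a] times the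
   same, with [a < b]. *)
have null1 a b : 0 <= a -> a < b ->
    P.-negligible (EA `&` ([set x | (b%:E < K1 x EY)%E] `&` [set x | (K2 x EY < a%:E)%E])).
  move=> a0 ab; have GS1 := kernel_gt_gen h1 b mEY.
  have [S2' GS2' S2E] := tr _ (kernel_lt_gen h2 a mEY).
  set D := [set x | (b%:E < K1 x EY)%E] `&` S2'.
  have GD : <<s G1 >> D by exact: sigma_genI.
  have mD := sigma_gen_measurable G1M GD.
  have -> : EA `&` ([set x | (b%:E < K1 x EY)%E] `&` [set x | (K2 x EY < a%:E)%E]) = EA `&` D.
    by rewrite setICA S2E setICA.
  exists (EA `&` D); split => //; first exact: measurableI.
  have [i1 i2] := intD D GD; apply: (null D a b) => //.
    rewrite i1 i2 -ge0_integralZl_EFin//; [|exact: mK1|by lra].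
    apply: ae_ge0_le_integral => //.
    - by move=> x _; rewrite mule_ge0// lee_fin; lra.
    - by apply: measurable_funeM; exact: mK1.
    - by apply: mK1 => //; exact: measurableI.
    - apply: filterS ign => x -> [/= /ltW bx _].
      exact: lee_wpmul2r.
  apply: (integral_kernel_le G2M h2) => //.
    by apply: sigma_genI => //; exact: G12'.
  by move=> x; rewrite /D setICA -S2E => -[_ [_ /= /ltW]].
have null2 a b : 0 <= a -> a < b ->
    P.-negligible (EA `&` ([set x | (K1 x EY < a%:E)%E] `&` [set x | (b%:E < K2 x EY)%E])).
  move=> a0 ab; have GS1 := kernel_lt_gen h1 a mEY.
  have [S2' GS2' S2E] := tr _ (kernel_gt_gen h2 b mEY).
  set D := [set x | (K1 x EY < a%:E)%E] `&` S2'.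
  have GD : <<s G1 >> D by exact: sigma_genI.
  have mD := sigma_gen_measurable G1M GD.
  have -> : EA `&` ([set x | (K1 x EY < a%:E)%E] `&` [set x | (b%:E < K2 x EY)%E]) = EA `&` D.
    by rewrite setICA S2E setICA.
  exists (EA `&` D); split => //; first exact: measurableI.
  have [i1 i2] := intD D GD; apply: (null D a b) => //.
    apply: (integral_kernel_ge G2M h2) => //; [|by lra|].
      by apply: sigma_genI => //; exact: G12'.
    by move=> x; rewrite /D setICA -S2E => -[_ [_ /= /ltW]].
  rewrite i1 i2 -ge0_integralZl_EFin//; last exact: mK1.
  apply: ae_ge0_le_integral => //.
  - by apply: mK1 => //; exact: measurableI.
  - by move=> x _; rewrite mule_ge0.
  - by apply: measurable_funeM; exact: mK1.
  - apply: filterS ign => x -> [/= /ltW bx _].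
    exact: lee_wpmul2r.
pose B1 (ab : rat * rat) : set Om := if (0 <= ab.1) && (ab.1 < ab.2) then
  EA `&` ([set x | ((ratr ab.2)%:E < K1 x EY)%E] `&` [set x | (K2 x EY < (ratr ab.1)%:E)%E])
  else set0.
pose B2 (ab : rat * rat) : set Om := if (0 <= ab.1) && (ab.1 < ab.2) then
  EA `&` ([set x | (K1 x EY < (ratr ab.1)%:E)%E] `&` [set x | ((ratr ab.2)%:E < K2 x EY)%E])
  else set0.
have nB1 ab : P.-negligible (B1 ab).
  rewrite /B1; case: ifP => [/andP[a0 ab0]|_]; last exact: negligible_set0.
  by apply: null1; rewrite ?ler0q// ltr_rat.
have nB2 ab : P.-negligible (B2 ab).
  rewrite /B2; case: ifP => [/andP[a0 ab0]|_]; last exact: negligible_set0.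
  by apply: null2; rewrite ?ler0q// ltr_rat.
pose dec n : rat * rat := odflt (0, 0) (unpickle n).
have := negligibleU (negligible_bigcup (fun n => nB1 (dec n))) (negligible_bigcup (fun n => nB2 (dec n))).
apply: negligibleS => x /= /not_implyP[EAx neq].
have decP ab : exists n, dec n = ab by exists (pickle ab); rewrite /dec pickleK.
have fin (Q : probability Om R) : exists2 s, Q EY = s%:E & 0 <= s.
  exists (fine (Q EY)); first by rewrite fineK// fin_num_measure.
  exact: fine_ge0.
have [s1 s1E s10] := fin (K1 x); have [s2 s2E s20] := fin (K2 x).
have between (s t : R) : 0 <= s -> s < t -> exists ab : rat * rat,
    [/\ (0 <= ab.1) && (ab.1 < ab.2), s < ratr ab.1 & ratr ab.2 < t].
  move=> s0 st; have [a] := rat_in_itvoo st; rewrite in_itv/= => /andP[sa at'].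
  have [b] := rat_in_itvoo at'; rewrite in_itv/= => /andP[ab bt].
  exists (a, b); split => //=; rewrite -(ler0q R) -(ltr_rat R) ab andbT.
  by rewrite ltW// (le_lt_trans s0).
have [l|l|e] := ltgtP s1 s2.
- have [ab [h sa bt]] := between _ _ s10 l; have [n nE] := decP ab.
  by right; exists n => //; rewrite nE /B2 h; split => //; split => /=;
    rewrite ?s1E ?s2E lte_fin.
- have [ab [h sa bt]] := between _ _ s20 l; have [n nE] := decP ab.
  by left; exists n => //; rewrite nE /B1 h; split => //; split => /=;
    rewrite ?s1E ?s2E lte_fin.
- by case: neq; rewrite s1E s2E e.
Qed.

End Conditioning.

(** * Equality of laws, and transfer of moments between them *)

Section Laws.
Context {d : measure_display} {Om : measurableType d} {R : realType}.

(** [None] stands for the whole line. Rational end points make the boxes below a countable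
    pi-system, so that an identity true almost everywhere for each box is true almost everywhere for
    all of them at once. *)
Definition ray (c : option rat) : set R :=
  if c is Some q then `]ratr q, +oo[%classic else setT.

Lemma measurable_ray c : measurable (ray c).
Proof. by case: c => [q|] /=; [exact: measurable_itv|exact: measurableT]. Qed.

Definition ray_join (a b : option rat) : option rat :=
  match a, b with
  | Some x, Some y => Some (Num.max x y)
  | Some x, None => Some x
  | None, c => c
  end.

Lemma rayI a b : ray a `&` ray b = ray (ray_join a b).
Proof.
case: a b => [x|] [y|] /=; rewrite ?setIT ?setTI//.
apply/seteqP; split => r /=; rewrite !in_itv/= !andbT.
  by move=> [xr yr]; rewrite /Order.max; case: ifP.
rewrite /Order.max; case: (ltP x y) => [/ltW xy|xy] h; split => //;
  by rewrite (le_lt_trans _ h)// ler_rat.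
Qed.

Section Boxes.
Context (I : finType) (X : I -> Om -> R) (mX : forall i, measurable_fun setT (X i)).

Definition box (c : {ffun I -> option rat}) : set Om :=
  \bigcap_(i in [set: I]) (X i @^-1` ray (c i)).

Lemma measurable_box c : measurable (box c).
Proof.
apply: fin_bigcap_measurable => // i _; rewrite -[X in measurable X]setTI.
by apply: mX => //; exact: measurable_ray.
Qed.

Lemma boxes_generate i B : measurable B -> <<s range box >> (X i @^-1` B).
Proof.
suff h : measurable_fun [set: g_sigma_algebraType (range box)]
    (X i : g_sigma_algebraType (range box) -> R).
  by move=> mB; have := h measurableT B mB; rewrite setTI.
move=> mD; apply: (measurability _ (RGenOInfty.measurableE R)) => //.
move=> /= _ [_ [x ->] <-]; rewrite setTI.
have -> : X i @^-1` `]x, +oo[%classic =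
    \bigcup_(q : rat) (if (x <= ratr q) then X i @^-1` ray (Some q) else set0).
  apply/seteqP; split => [w /=|w [q _]].
    rewrite in_itv/= andbT => xw; have [q] := rat_in_itvoo xw.
    rewrite in_itv/= => /andP[xq qw]; exists q => //.
    by rewrite ltW//= in_itv/= andbT.
  case: ifP => // xq /=; rewrite !in_itv/= !andbT; exact: le_lt_trans.
apply: bigcupT_measurable_rat => q; case: ifP => // _.
apply: sub_sigma_algebra; exists [ffun j => if j == i then Some q else None] => //.
apply/seteqP; split => w /=.
  by move/(_ i Logic.I); rewrite /= ffunE eqxx.
by move=> iw j _ /=; rewrite ffunE; case: eqP => [->|].
Qed.

Lemma eq_on_boxes (Q1 Q2 : probability Om R) : (forall c, Q1 (box c) = Q2 (box c)) ->
  forall B : I -> set R, (forall i, measurable (B i)) ->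
  Q1 (\bigcap_(i in [set: I]) (X i @^-1` B i)) = Q2 (\bigcap_(i in [set: I]) (X i @^-1` B i)).
Proof.
move=> Q12 B mB.
have boxT : box [ffun=> None] = setT.
  by apply/seteqP; split => // w _ i _; rewrite /= ffunE.
apply: (@g_sigma_algebra_measure_unique _ _ _ (range box) _ (fun=> setT)).
- by move=> _ [c _ <-]; exact: measurable_box.
- by move=> _; rewrite -boxT; exists [ffun=> None].
- by rewrite bigcup_const.
- move=> _ _ [c1 _ <-] [c2 _ <-]; exists [ffun i => ray_join (c1 i) (c2 i)] => //.
  apply/seteqP; split => w h.
    by split=> i _; have := h i Logic.I; rewrite /= ffunE -rayI => -[].
  by case: h => h1 h2 i _ /=; rewrite ffunE -rayI; split; [exact: h1|exact: h2].
- by move=> _ [c _ <-]; exact: Q12.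
- move=> k; apply: le_lt_trans (ltry 1); exact: probability_le1.
apply: (@fin_bigcap_measurable _ (g_sigma_algebraType (range box))) => // i _.
exact: boxes_generate.
Qed.

End Boxes.

Section SameLaw.
Context (Q1 Q2 : probability Om R) (X1 X2 : Om -> R).
Context (mX1 : measurable_fun setT X1) (mX2 : measurable_fun setT X2).
Context (law : forall B, measurable B -> Q1 (X1 @^-1` B) = Q2 (X2 @^-1` B)).

Lemma same_law_integral (f : R -> \bar R) : measurable_fun setT f ->
  (forall x, (0 <= f x)%E) -> (\int[Q1]_w f (X1 w) = \int[Q2]_w f (X2 w))%E.
Proof.
move=> mf f0.
have := @ge0_integral_pushforward _ _ _ _ _ X1 mX1 Q1 setT f measurableT mf (fun x _ => f0 x).
have := @ge0_integral_pushforward _ _ _ _ _ X2 mX2 Q2 setT f measurableT mf (fun x _ => f0 x).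
rewrite !preimage_setT => <- <-.
by apply: eq_measure_integral => A mA _; exact: law.
Qed.

Lemma same_law_expectation :
  (\int[Q1]_w (X1 w)%:E = \int[Q2]_w (X2 w)%:E)%E.
Proof.
rewrite integralE [RHS]integralE.
have mE : measurable_fun setT (@EFin R) by exact/measurable_EFinP.
have hp := same_law_integral (measurable_funepos mE) (funepos_ge0 _).
have hn := same_law_integral (measurable_funeneg mE) (funeneg_ge0 _).
congr (_ - _)%E.
  by apply: etrans (etrans hp _); apply: eq_integral => w _; rewrite !funeposE.
by apply: etrans (etrans hn _); apply: eq_integral => w _; rewrite !funenegE.
Qed.

Lemma same_law_subgauss K : centered_subgauss Q1 K X1 -> centered_subgauss Q2 K X2.
Proof.
case=> _ e0 e1; split => //.
  rewrite -(same_law_integral (f := fun x => (expR (x ^+ 2 / K ^+ 2))%:E))//.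
  apply/measurable_EFinP; apply: measurable_expf.
  by apply: measurable_funM => //; exact: measurable_funX.
by move: e1; rewrite /Rintegral -same_law_expectation.
Qed.

Lemma same_law_sqr : \int[Q1]_w X1 w ^+ 2 = \int[Q2]_w X2 w ^+ 2.
Proof.
rewrite /Rintegral; congr fine.
apply: (same_law_integral (f := fun x => (x ^+ 2)%:E)).
  by apply/measurable_EFinP; exact: measurable_funX.
by move=> x; rewrite lee_fin sqr_ge0.
Qed.

End SameLaw.
End Laws.

Section AlmostSure.
Context {d : measure_display} {Om : measurableType d} {R : realType}.
Context (Q : probability Om R).

Lemma prob1_ae C : measurable C -> Q C = 1%E -> {ae Q, forall y, C y}.
Proof.
move=> mC QC; exists (~` C); split => //; first exact: measurableC.
by rewrite probability_setC// QC subee.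
Qed.

Lemma ae_prob_eq A B : measurable A -> measurable B ->
  {ae Q, forall y, A y <-> B y} -> Q A = Q B.
Proof.
move=> mA mB [N [mN N0 hN]].
suff h C D : measurable C -> measurable D -> (forall y, ~ N y -> C y -> D y) ->
    (Q C <= Q D)%E.
  apply/eqP; rewrite eq_le; apply/andP; split; apply: h => // y nN;
    have [ab ba] : A y <-> B y by apply: contrapT => nAB; apply: nN; exact: hN.
  - exact: ab.
  - exact: ba.
move=> mC mD CD; apply: (@le_trans _ _ (Q (D `|` N))).
  apply: le_measure; rewrite ?inE//; first exact: measurableU.
  by move=> y Cy; have [Ny|nN] := pselect (N y); [right|left; exact: CD].
by rewrite (le_trans (measureU2 _ mD mN))//= [X in (_ + X)%E]N0 adde0.
Qed.

Lemma ae_countable (I : countType) (S : I -> Om -> Prop) :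
  (forall i, {ae Q, forall y, S i y}) -> {ae Q, forall y, forall i, S i y}.
Proof.
move=> h; have : {ae Q, forall y, forall n, if unpickle n is Some i then S i y else True}.
  by apply/ae_foralln => n; case: unpickle => [i|]; [exact: h|exact: aeW].
by apply: filterS => y hy i; have := hy (pickle i); rewrite pickleK.
Qed.

End AlmostSure.

Section ConstantCoordinates.
Context {d : measure_display} {Om : measurableType d} {R : realType}.
Context (P : probability Om R) (G : set (set Om)) (K : Om -> probability Om R).
Context (GM : G `<=` measurable) (hK : is_regular_cond_prob P G K).

(** By [kernel_self] the kernel at [x] is carried, for each rational level, by the points on the
    same side of this level as [x]; countably many levels determine the value of [u]. *)
Lemma kernel_const (u : Om -> R) :
  measurable_fun [set: g_sigma_algebraType G] (u : g_sigma_algebraType G -> R) ->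
  {ae P, forall x, {ae K x, forall y, u y = u x}}.
Proof.
move=> mu; pose U (q : rat) := [set x | u x <= ratr q].
have GU q : <<s G >> (U q).
  have := mu measurableT _ (measurable_itv `]-oo, (ratr q)]); rewrite setTI.
  by congr (<<s G >> _); apply/seteqP; split => x /=; rewrite in_itv.
have aeU : {ae P, forall x, forall q, (U q x -> K x (U q) = 1%E) /\
    ((~` U q) x -> K x (~` U q) = 1%E)}.
  apply: ae_countable => q; apply: filterS2 (kernel_self GM hK (GU q))
    (kernel_self GM hK (sigma_genC (GU q))) => x h1 h2; split; [exact: h1|exact: h2].
apply: filterS aeU => x h.
have mU q : measurable (U q) := sigma_gen_measurable GM (GU q).
have : {ae K x, forall y, forall q, U q x <-> U q y}.
  apply: ae_countable => q; have [h1 h2] := h q.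
  have [Ux|nUx] := pselect (U q x).
    by apply: filterS (prob1_ae (mU q) (h1 Ux)).
  by apply: filterS (prob1_ae (measurableC (mU q)) (h2 nUx)).
apply: filterS => y hy; apply/eqP; rewrite eq_le; apply/andP; split; rewrite leNgt; apply/negP => l.
  have [q] := rat_in_itvoo l; rewrite in_itv/= => /andP[l1 l2].
  by have := (hy q).1 (ltW l1); rewrite /U /= leNgt l2.
have [q] := rat_in_itvoo l; rewrite in_itv/= => /andP[l1 l2].
by have := (hy q).2 (ltW l1); rewrite /U /= leNgt l2.
Qed.

End ConstantCoordinates.

(** * The network model *)

Section RegularPoint.
Context {R : realType} (M : instance R).
Local Notation unit := 'I_(units M).
Local Notation time := 'I_(Ttr M + Tpr M).
Local Notation treat := (treatment (units M) (levels M)).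
Local Notation GL := (gen_LF (edge M) (ufac M) (wfac M)).
Local Notation GA := (GL `|` [set E | exists a, E = assign M @^-1` [set a]]).

Definition factor_mean (x : Om M) (t : time) (i : unit) (a : treat) : R :=
  \sum_(j in nbhd (edge M) i) \sum_(k < lrank M) ufac M j i k x * wfac M t (a j) k x.

Definition outcome_at (t : time) (i : unit) (a : treat) : outcome_index M :=
  (t, Tagged (fun i => exposure (levels M) (edge M) i) (Defs.restrict (edge M) i a)).

Lemma gen_LF_measurable : GL `<=` measurable.
Proof.
move=> E [[j [i [k [B [_ mB ->]]]]]|[t [b [k [B [mB ->]]]]]];
  by rewrite -[X in measurable X]setTI; exact: measurable_funPT.
Qed.

Lemma gen_LFA_measurable : GA `<=` measurable.
Proof.
move=> E [/gen_LF_measurable//|[a ->]]; exact: assign_measurable.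
Qed.

Lemma measurable_factor_mean t i a :
  measurable_fun [set: g_sigma_algebraType GL]
    ((fun x => factor_mean x t i a) : g_sigma_algebraType GL -> R).
Proof.
have gen_measurable (u : Om M -> R) : (forall B, measurable B -> GL (u @^-1` B)) ->
    measurable_fun [set: g_sigma_algebraType GL] (u : g_sigma_algebraType GL -> R).
  by move=> h _ B mB; rewrite setTI; apply: sub_sigma_algebra; exact: h.
rewrite (_ : (fun x => _) = (fun x => \sum_(j < units M)
    if j \in nbhd (edge M) i then \sum_(k < lrank M) ufac M j i k x * wfac M t (a j) k x
    else 0)); last by apply/funext => x; rewrite /factor_mean big_mkcond.
apply: (@measurable_sum _ (g_sigma_algebraType GL)) => j.
case: (boolP (j \in nbhd (edge M) i)) => ji; last exact: measurable_cst.
apply: (@measurable_sum _ (g_sigma_algebraType GL)) => k; apply: measurable_funM.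
  by apply: gen_measurable => B mB; left; exists j, i, k, B.
by apply: gen_measurable => B mB; right; exists t, (a j), k, B.
Qed.

Lemma outcome_at_surj (o : outcome_index M) : exists a, o = outcome_at o.1 (tag o.2) a.
Proof.
case: o => t [i b] /=.
have ii : i \in nbhd (edge M) i by rewrite inE edge_refl.
(* A default treatment is needed outside of the neighbourhood; as [i] is its own neighbour, its own
   treatment supplies one. *)
pose b0 := b (Sub i ii).
exists [ffun j => if insub j is Some j' then b j' else b0].
congr (_, Tagged _ _); apply/ffunP => j; rewrite !ffunE.
by rewrite valK.
Qed.

(** The sets with this property form a sigma-algebra containing the generators: on the event
    [assign = a], a generator about the assignment is everything or nothing. It is the trace
    hypothesis of [kernel_refine]. *)
Lemma assign_trace a D : <<s GA >> D ->
  exists2 D', <<s GL >> D' & (assign M @^-1` [set a]) `&` D = (assign M @^-1` [set a]) `&` D'.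
Proof.
set EA := assign M @^-1` [set a].
suff : <<s GA >> `<=` [set D | exists2 D', <<s GL >> D' & EA `&` D = EA `&` D'].
  by apply.
apply: smallest_sub.
  have [s0 sC sU] := smallest_sigma_algebra setT GL; split => /=.
  - by exists set0.
  - move=> A [A' GA' AE]; exists (setT `\` A'); first exact: sC.
    rewrite !setTD; apply/seteqP; split => x [ax nA]; split => // Bx; apply: nA.
      by have : (EA `&` A) x by [rewrite AE]; case.
    by have : (EA `&` A') x by [rewrite -AE]; case.
  - move=> A /(_ _)/cid2 h; exists (\bigcup_k (projT1 (h k))).
      by apply: sU => k; case: (h k).
    rewrite !setI_bigcupr; apply: eq_bigcup => // k _.
    by case: (h k).
move=> A [GLA|[b ->]].
  by exists A => //; exact: sub_gen_smallest.
have [<-|ab] := eqVneq a b.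
  exists setT; last by rewrite setIT -/EA setIid.
  by have [s0 sC _] := smallest_sigma_algebra setT GL; have := sC _ s0; rewrite setD0.
exists set0; first by have [] := smallest_sigma_algebra setT GL.
rewrite setI0; apply/seteqP; split => // x [] /= -> ba; by rewrite ba eqxx in ab.
Qed.

End RegularPoint.

Section Regular.
Context {R : realType} (M : instance R) (sigma xi : R).
Local Notation unit := 'I_(units M).
Local Notation time := 'I_(Ttr M + Tpr M).
Local Notation treat := (treatment (units M) (levels M)).
Local Notation GL := (gen_LF (edge M) (ufac M) (wfac M)).
Local Notation GA := (GL `|` [set E | exists a, E = assign M @^-1` [set a]]).

(** Collects what holds at almost every realisation, so that the sequel works at one point [x] under
    two fixed laws. It involves neither the donors nor the estimator. *)
Record regular (x : Om M) : Prop := Regular {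
  reg_factors : {ae condLF M x, forall y, forall (t : time) (i : unit) (a : treat),
    factor_mean y t i a = factor_mean x t i a};
  reg_assign : {ae condLFA M x, forall y, assign M y = assign M x};
  reg_law : forall B : outcome_index M -> set R, (forall o, measurable (B o)) ->
    condLFA M x (\bigcap_(o in [set: outcome_index M]) (outcome o @^-1` B o)) =
    condLF M x (\bigcap_(o in [set: outcome_index M]) (outcome o @^-1` B o));
  reg_noise0 : forall o, ('E_(condLF M x)[outcome_noise o] = 0)%E;
  reg_indep : mutually_independent (condLF M x) (@outcome_noise R M);
  reg_var : forall o, variance (condLF M x) (outcome_noise o) = (sigma ^+ 2)%:E;
  reg_psi2 : forall o, (psi2_norm (condLF M x) (outcome_noise o) <= (xi * sigma)%:E)%E;
  reg_bounded : forall o, ((-1)%:E <= 'E_(condLF M x)[outcome o] <= 1%:E)%E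
}.

Lemma ae_regular : latent_factor_model M -> cond_ignorability M ->
  subgaussian_noise M sigma xi -> bounded_cond_mean M ->
  {ae Pr M, forall x, regular x}.
Proof.
move=> [_ HL] HI HS HB.
have mout o : measurable_fun [set: Om M] (outcome o) by exact: measurable_funPT.
have hF : {ae Pr M, forall x, {ae condLF M x, forall y, forall (tia : time * unit * treat),
    factor_mean y tia.1.1 tia.1.2 tia.2 = factor_mean x tia.1.1 tia.1.2 tia.2}}.
  have : {ae Pr M, forall x, forall tia : time * unit * treat, {ae condLF M x, forall y,
      factor_mean y tia.1.1 tia.1.2 tia.2 = factor_mean x tia.1.1 tia.1.2 tia.2}}.
    apply: ae_countable => tia.
    apply: (kernel_const (@gen_LF_measurable R M) (condLF_rcp M)).
    exact: measurable_factor_mean.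
  by apply: filterS => x; exact: ae_countable.
have GEA a : <<s GA >> (assign M @^-1` [set a]).
  by apply: sub_gen_smallest; right; exists a.
have hA : {ae Pr M, forall x, {ae condLFA M x, forall y, assign M y = assign M x}}.
  have : {ae Pr M, forall x, forall a, (assign M @^-1` [set a]) x ->
      condLFA M x (assign M @^-1` [set a]) = 1%E}.
    apply: ae_countable => a.
    have := kernel_self (@gen_LFA_measurable R M) (condLFA_rcp M) (GEA a).
    by apply: filterS => x h; exact: h.
  apply: filterS => x h; have := h (assign M x) erefl.
  by move=> /(prob1_ae (assign_measurable _)).
have hB : {ae Pr M, forall x, forall c : {ffun outcome_index M -> option rat},
    condLFA M x (box (@outcome R M) c) = condLF M x (box (@outcome R M) c)}.
  have : {ae Pr M, forall x, forall ca : {ffun outcome_index M -> option rat} *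
      {ffun 'I_(Ttr M + Tpr M) -> treat}, (assign M @^-1` [set ca.2]) x ->
    condLFA M x (box (@outcome R M) ca.1) = condLF M x (box (@outcome R M) ca.1)}.
    apply: ae_countable => -[c a] /=.
    apply: (kernel_refine (@gen_LF_measurable R M) (@gen_LFA_measurable R M) _ (GEA a)
      (@assign_trace R M a) (condLF_rcp M) (condLFA_rcp M)).
    - exact: subsetUl.
    - exact: measurable_box.
    - apply: filterS HI => x /(_ (fun o => ray (c o)) a); apply.
      by move=> o; exact: measurable_ray.
  by apply: filterS => x h c; exact: (h (c, assign M x)).
apply: filterS (filterI hF (filterI hA (filterI hB (filterI HL (filterI HS HB)))))
  => x [xF [xA [xB [xL [[xS1 xS2] xM]]]]]; split => //.
- by apply: filterS xF => y h t i a; exact: (h (t, i, a)).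
- by move=> B mB; exact: (eq_on_boxes mout).
- by move=> o; case: (xS2 o).
- by move=> o; case: (xS2 o).
Qed.

Section AtRegular.
Context (x : Om M) (hx : regular x) (hL : latent_factor_model M).
Context (K : R) (K0 : 0 < K) (KS : xi * sigma < K).
Local Notation Q1 := (condLF M x).
Local Notation Q2 := (condLFA M x).

(** [psi2_norm] is an infimum, so an admissible scale is only obtained strictly above it; this is
    the reason for the strict inequality [KS]. *)
Lemma noise_subgauss o : centered_subgauss Q1 K (outcome_noise o).
Proof.
have mn : measurable_fun [set: Om M] (outcome_noise o) by exact: measurable_funPT.
split => //; last first.
  by have := reg_noise0 hx o; rewrite unlock /Rintegral => ->.
have : (psi2_norm Q1 (outcome_noise o) < K%:E)%E.
  by rewrite (le_lt_trans (reg_psi2 hx o))// lte_fin.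
move=> /ereal_inf_lt[_ [k [k0 hk] <-]]; rewrite lte_fin => kK.
apply: le_trans hk; rewrite unlock; apply: ge0_le_integral => //.
- apply/measurable_EFinP; apply: measurable_expf; apply: measurable_funM => //.
  exact: measurable_funX.
- apply/measurable_EFinP; apply: measurable_expf; apply: measurable_funM => //.
  exact: measurable_funX.
- move=> w _; rewrite lee_fin ler_expR ler_wpM2l ?sqr_ge0//.
  by rewrite lef_pV2 ?posrE ?exprn_gt0// ler_sqr ?nnegrE ?ltW.
Qed.

Lemma noise_sqr o : \int[Q1]_y outcome_noise o y ^+ 2 = sigma ^+ 2.
Proof.
have := reg_var hx o; rewrite /variance unlock reg_noise0//= unlock => h.
rewrite /Rintegral -[RHS]/(fine (sigma ^+ 2)%:E) -h; congr fine.
by apply: eq_integral => w _; rewrite expr2 -[in LHS](subr0 (outcome_noise o w)).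
Qed.

Definition omean (o : outcome_index M) : R := fine ('E_Q1[outcome o])%E.

Lemma omean_le1 o : `|omean o| <= 1.
Proof.
have /andP[h1 h2] := reg_bounded hx o.
rewrite /omean; move: h1 h2; case: ('E_Q1[outcome o])%E => [r| |]//=.
by rewrite !lee_fin ler_norml => -> ->.
Qed.

(** Under the law given the factors, these are almost surely constant, so the outcome is a constant
    plus centered noise. *)
Lemma omeanE t i a : omean (outcome_at t i a) = factor_mean x t i a /\
  {ae Q1, forall y, outcome (outcome_at t i a) y =
    omean (outcome_at t i a) + outcome_noise (outcome_at t i a) y}.
Proof.
have ae1 : {ae Q1, forall y, outcome (outcome_at t i a) y =
    factor_mean x t i a + outcome_noise (outcome_at t i a) y}.
  apply: filterS (reg_factors hx) => y h.
  by rewrite /outcome /outcome_noise /= hL.1 -(h t i a).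
suff E : omean (outcome_at t i a) = factor_mean x t i a by split; rewrite ?E.
have sg := noise_subgauss (outcome_at t i a).
have [mn _ n0] := sg.
have int_n := integrable_subgauss K0 sg.
rewrite /omean unlock.
transitivity (\int[Q1]_y (factor_mean x t i a + outcome_noise (outcome_at t i a) y)).
  rewrite /Rintegral; congr fine; apply: ae_eq_integral => //.
  - by apply/measurable_EFinP; exact: measurable_funPT.
  - by apply/measurable_EFinP; exact: measurable_funD.
  - by apply: filterS ae1 => y -> _.
rewrite RintD//; last exact: integrable_cst_fun.
by rewrite Rint_cst n0 addr0.
Qed.

Lemma ae_outcome : {ae Q1, forall y, forall o : outcome_index M,
  outcome o y = omean o + outcome_noise o y}.
Proof.
by apply: ae_countable => o; have [a ->] := outcome_at_surj o; case: (omeanE o.1 (tag o.2) a).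
Qed.

(** Ignorability transfers to [condLFA] the law of the outcomes, not that of the noise. The residual
    from the mean therefore replaces the noise under this law. *)
Definition centered (o : outcome_index M) (y : Om M) : R := outcome o y - omean o.

Lemma measurable_centered o : measurable_fun setT (centered o).
Proof. by apply: measurable_funB => //; exact: measurable_funPT. Qed.

Lemma measurable_noise o : measurable_fun setT (@outcome_noise R M o).
Proof. exact: measurable_funPT. Qed.

Lemma centered_law B : (forall o, measurable (B o)) ->
  Q2 (\bigcap_(o in [set: outcome_index M]) (centered o @^-1` B o)) =
  Q1 (\bigcap_(o in [set: outcome_index M]) (outcome_noise o @^-1` B o)).
Proof.
move=> mB; pose B' o := (fun r => r - omean o) @^-1` B o.
have mB' o : measurable (B' o).
  by rewrite -[B' o]setTI; apply: measurable_funB.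
rewrite [LHS](reg_law hx mB'); apply: ae_prob_eq.
- apply: fin_bigcap_measurable => // o _; rewrite -[X in measurable X]setTI.
  exact: measurable_funPT.
- apply: fin_bigcap_measurable => // o _; rewrite -[X in measurable X]setTI.
  exact: measurable_funPT.
- apply: filterS ae_outcome => y h; split => hy o _; have := hy o Logic.I;
    by rewrite /B' /= h addrC addKr.
Qed.

Lemma centered_law1 o B : measurable B ->
  Q1 (outcome_noise o @^-1` B) = Q2 (centered o @^-1` B).
Proof.
move=> mB; pose C o' : set R := if o' == o then B else setT.
have mC o' : measurable (C o') by rewrite /C; case: ifP.
have CE (X : outcome_index M -> Om M -> R) :
    \bigcap_(o in [set: outcome_index M]) (X o @^-1` C o) = X o @^-1` B.
  apply/seteqP; split => [y /(_ o Logic.I)|y Xy o' _]; rewrite /C /=; first by rewrite eqxx.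
  by case: eqP => [->|].
by rewrite -[LHS](congr1 Q1 (CE _)) -centered_law// (congr1 Q2 (CE _)).
Qed.

Lemma centered_indep : mutually_independent Q2 centered.
Proof.
move=> B mB; rewrite centered_law// (reg_indep hx)//.
by apply: eq_bigr => o _; exact: centered_law1.
Qed.

Lemma centered_subgauss_outcome o : centered_subgauss Q2 K (centered o).
Proof.
apply: (same_law_subgauss (measurable_noise o) (measurable_centered o) (centered_law1 o)).
exact: noise_subgauss.
Qed.

Lemma centered_sqr o : \int[Q2]_y centered o y ^+ 2 = sigma ^+ 2.
Proof.
rewrite -(same_law_sqr (measurable_noise o) (measurable_centered o) (centered_law1 o)).
exact: noise_sqr.
Qed.

End AtRegular.
End Regular.

(** * The donors reproduce the means of the target unit *)

Section Donors.
Context {R : realType} (M : instance R).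
Local Notation unit := 'I_(units M).
Local Notation time := 'I_(Ttr M + Tpr M).
Local Notation treat := (treatment (units M) (levels M)).

Lemma factor_mean_seq (x : Om M) (t : time) (i : unit) (a : treat) (s : seq unit) :
  uniq s -> s =i nbhd (edge M) i ->
  factor_mean x t i a = \sum_(k < size s) \sum_(l < lrank M)
    ufac M (nth i s k) i l x * wfac M t (nth (a i) [seq a j | j <- s] k) l x.
Proof.
move=> us ms; rewrite /factor_mean (eq_bigl (mem s)) => [|j]; last by rewrite /= ms.
rewrite -big_uniq//= (big_nth i) big_mkord; apply: eq_bigr => k _.
by apply: eq_bigr => l _; rewrite (nth_map i).
Qed.

Section Target.
Context (n : unit) (x : Om M).
Local Notation c := #|nbhd (edge M) n|.

(** A mean outcome is linear in the concatenated factors of the unit; for given [x], the linear form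
    depends only on the measurement and on the treatments read along the ordering. *)
Definition loading (t : time) (b : 'I_c -> 'I_(levels M))
    (U : 'rV[R]_(\sum_(k < c) lrank M)) : R :=
  \sum_(k < c) \sum_(l < lrank M) submxrow U k 0 l * wfac M t (b k) l x.

Lemma loading_sum t b (L : finType) (be : L -> R) (U : L -> 'rV[R]_(\sum_(k < c) lrank M)) :
  loading t b (\sum_i be i *: U i) = \sum_i be i * loading t b (U i).
Proof.
rewrite /loading; under [RHS]eq_bigr do rewrite mulr_sumr.
rewrite [RHS]exchange_big; apply: eq_bigr => k _.
under [RHS]eq_bigr do rewrite mulr_sumr.
rewrite [RHS]exchange_big; apply: eq_bigr => l _.
rewrite mxE summxE mulr_suml; apply: eq_bigr => i _.
by rewrite !mxE mulrA.
Qed.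

Lemma loading_utilde t b i s :
  loading t b (utilde n x i s) =
  \sum_(k < c) \sum_(l < lrank M) ufac M (nth i s k) i l x * wfac M t (b k) l x.
Proof.
rewrite /loading; apply: eq_bigr => k _; apply: eq_bigr => l _.
by rewrite /utilde mxrowK mxE.
Qed.

Lemma factor_mean_loading t i (a : treat) s (a0 : 'I_(levels M)) (bs : seq 'I_(levels M)) :
  uniq s -> s =i nbhd (edge M) i -> size s = c -> [seq a j | j <- s] = bs ->
  factor_mean x t i a = loading t (fun k => nth a0 bs k) (utilde n x i s).
Proof.
move=> us ms sc ab; rewrite loading_utilde (factor_mean_seq _ _ _ us ms) -ab sc.
apply: eq_bigr => k _; apply: eq_bigr => l _.
by congr (_ * wfac M t _ l x); apply: set_nth_default; rewrite size_map sc.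
Qed.

Lemma size_nbseq i : size (nbseq M i) = #|nbhd (edge M) i|.
Proof. by rewrite -(card_uniqP (nbseq_uniq i)); apply: eq_card => j; exact: mem_nbseq. Qed.

Context (atilde : treat) (p : unit -> {perm unit}).
Local Notation I := (donors n atilde x).
Context (pI : forall i, i \in I -> matching n atilde x i (p i)).

(** A matching makes each donor receive, along [p i], the treatments of the target, so the same form
    [loading] gives both means and the coefficients that express [utilde] carry over. They do not
    depend on [t], hence serve training and prediction alike. *)
Lemma donors_combination : donors_span n atilde x p ->
  exists be : 'I_#|I| -> R,
    (forall t : 'I_(Ttr M), let t' := lshift (Tpr M) t in
       factor_mean x t' n (assign M x t') =
       \sum_l be l * factor_mean x t' (enum_val l) (assign M x t')) /\
    (forall t : 'I_(Tpr M), let t' := rshift (Ttr M) t in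
       factor_mean x t' n atilde =
       \sum_l be l * factor_mean x t' (enum_val l) (assign M x t')).
Proof.
move=> [_ sp]; pose f i := utilde n x i [seq p i j | j <- nbseq M i].
pose X := map_tuple f (enum_tuple (mem I)).
have spX : utilde n x n (nbseq M n) \in <<X>>%VS by exact: sp.
pose be (l : 'I_#|I|) : R := coord X l (utilde n x n (nbseq M n)).
have XE (l : 'I_#|I|) : X`_l = f (enum_val l).
  rewrite (nth_map n) ?size_tuple//; congr f; rewrite /enum_val.
  by apply: set_nth_default; rewrite -cardE.
have vE : utilde n x n (nbseq M n) = \sum_l be l *: f (enum_val l).
  by rewrite (coord_span spX); apply: eq_bigr => l _; rewrite XE.
have donor (l : 'I_#|I|) : [/\ uniq [seq p (enum_val l) j | j <- nbseq M (enum_val l)],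
    [seq p (enum_val l) j | j <- nbseq M (enum_val l)] =i nbhd (edge M) (enum_val l) &
    size [seq p (enum_val l) j | j <- nbseq M (enum_val l)] = c].
  have iI := enum_valP l; set i := enum_val l in iI *.
  have /and3P[po _ _] := pI iI.
  have /and3P[_ /eqP cE _] : [&& i != n, #|nbhd (edge M) i| == c &
      [exists q : {perm unit}, matching n atilde x i q]] by move: iI; rewrite inE.
  split.
  - by rewrite map_inj_uniq ?nbseq_uniq//; exact: perm_inj.
  - move=> j; apply/mapP/idP => [[j' + ->]|jN].
      by rewrite mem_nbseq (perm_closed _ po).
    exists ((p i)^-1%g j); last by rewrite permKV.
    by rewrite mem_nbseq -(perm_closed _ po) permKV.
  - by rewrite size_map size_nbseq.
have sn := size_nbseq n.
exists be; split => t t'.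
  rewrite (factor_mean_loading _ (assign M x t' n) (nbseq_uniq n) (@mem_nbseq _ M n) sn erefl).
  rewrite vE loading_sum; apply: eq_bigr => l _; congr (_ * _).
  have [ul ml sl] := donor l; have /and3P[_ /forallP/(_ t)/eqP ml' _] := pI (enum_valP l).
  by rewrite (factor_mean_loading t' (assign M x t' n) ul ml sl (a := assign M x t') (bs := [seq assign M x t' j | j <- nbseq M n]))// -map_comp.
rewrite (factor_mean_loading _ (atilde n) (nbseq_uniq n) (@mem_nbseq _ M n) sn erefl).
rewrite vE loading_sum; apply: eq_bigr => l _; congr (_ * _).
have [ul ml sl] := donor l; have /and3P[_ _ /eqP ml'] := pI (enum_valP l).
by rewrite (factor_mean_loading t' (atilde n) ul ml sl (a := assign M x t') (bs := [seq atilde j | j <- nbseq M n]))// -map_comp assign_apr.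
Qed.

End Target.
End Donors.

Section Spectrum.
Context {R : realType}.

(** With [r] nonzero singular values the squared Frobenius norm is at most [r s_1^2], so
    [s_r >= xi1 s_1 >= xi1 sqrt (xi2 p q / r)], which is [sqrt (p q) / g]. Since [s_r <= s_1] and
    entries are bounded by 1, both parameters are at most 1, whence [g >= sqrt r]. *)
Lemma spectrum_bounds p q (E : 'M[R]_(p, q)) (S : svd E) (xi1 xi2 g : R) :
  (0 < p)%N -> (0 < q)%N -> (forall i j, `|E i j| <= 1) -> 0 < xi1 -> 0 < xi2 ->
  xi1 <= (sv S)`_((\rank E).-1) / (sv S)`_0 ->
  xi2 * p%:R * q%:R <= frobenius_sq E ->
  g = Num.sqrt (\rank E)%:R / (xi1 * Num.sqrt xi2) ->
  [/\ (0 < \rank E <= minn p q)%N, 1 <= g, Num.sqrt (\rank E)%:R <= g &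
      forall l : 'I_(minn p q), (l < \rank E)%N ->
        Num.sqrt p%:R * Num.sqrt q%:R / g <= tnth (sv S) l].
Proof.
move=> p0 q0 E1 x10 x20 h1 h2 gE; set r := \rank E in h1 gE *.
have pp : 0 < p%:R :> R by rewrite ltr0n.
have qq : 0 < q%:R :> R by rewrite ltr0n.
have m0 : (0 < minn p q)%N by rewrite leq_min p0.
have rm : (r <= minn p q)%N by rewrite leq_min rank_leq_row rank_leq_col.
have f0 : 0 < frobenius_sq E by apply: lt_le_trans h2; rewrite !mulr_gt0.
pose l0 := Ordinal m0; pose s0 := tnth (sv S) l0.
have s00 : 0 <= s0 by exact: sv_ge0.
have s0E : (sv S)`_0 = s0 by rewrite /s0 (tnth_nth 0).
have frs : frobenius_sq E <= r%:R * s0 ^+ 2.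
  rewrite -(sum_sqr_sv S) (bigID (fun l : 'I_(minn p q) => (l < r)%N))/=.
  rewrite [X in _ + X]big1 ?addr0 => [|l]; last first.
    by rewrite -leqNgt => /sv_rank0 ->; rewrite expr0n.
  apply: (@le_trans _ _ (\sum_(l < minn p q | (l < r)%N) s0 ^+ 2)).
    by apply: ler_sum => l _; rewrite ler_sqr ?nnegrE ?sv_ge0//; exact: sv_le.
  by rewrite sumr_const card_ltn_ord// mulr_natl.
have r0 : (0 < r)%N.
  rewrite lt0n; apply: contraTneq f0 => rE; rewrite rE mul0r in frs.
  by rewrite -leNgt.
have rr : 0 < r%:R :> R by rewrite ltr0n.
have s0p : 0 < s0.
  rewrite lt_neqAle s00 andbT; apply: contraTneq f0 => sE.
  by rewrite -leNgt (le_trans frs)// -sE expr0n mulr0.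
have rlt : (r.-1 < minn p q)%N by rewrite prednK.
pose l1 := Ordinal rlt.
have s1E : (sv S)`_(r.-1) = tnth (sv S) l1 by rewrite (tnth_nth 0).
rewrite s0E s1E ler_pdivlMr// in h1.
have s1s0 : tnth (sv S) l1 <= s0 by exact: sv_le.
have x11 : xi1 <= 1 by rewrite -(ler_pM2r s0p) mul1r (le_trans h1).
have x21 : xi2 <= 1.
  rewrite -(ler_pM2r (mulr_gt0 pp qq)) mul1r mulrA.
  exact: le_trans h2 (frobenius_sq_le E1).
have sx0 : 0 < Num.sqrt xi2 by rewrite sqrtr_gt0.
have sx1 : Num.sqrt xi2 <= 1 by rewrite -[leRHS]sqrtr1 ler_wsqrtr.
have x30 : 0 < xi1 * Num.sqrt xi2 by rewrite mulr_gt0.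
have x31 : xi1 * Num.sqrt xi2 <= 1 by rewrite -[leRHS]mulr1 ler_pM// ltW.
have sr1 : 1 <= Num.sqrt r%:R :> R by rewrite -[leLHS]sqrtr1 ler_wsqrtr// ler1n.
have srg : Num.sqrt r%:R <= g.
  by rewrite gE ler_pdivlMr// ler_piMr// sqrtr_ge0.
split; [by rewrite r0|exact: le_trans srg|exact: srg|].
move=> l lr; apply: (@le_trans _ _ (tnth (sv S) l1)); last first.
  by apply: sv_le; rewrite /= -ltnS prednK.
apply: le_trans h1; rewrite gE invf_div.
have sr0 : 0 < Num.sqrt r%:R :> R by rewrite sqrtr_gt0.
rewrite mulrA ler_pdivrMr// -[leRHS]mulrA.
rewrite mulrCA ler_pM2l//.
rewrite -[leRHS]ger0_norm ?mulr_ge0 ?(ltW sr0)// -sqrtr_sqr -sqrtrM// [_ * Num.sqrt xi2]mulrC.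
rewrite -sqrtrM ?(ltW x20)// ler_wsqrtr// exprMn sqr_sqrtr//.
by rewrite mulrA [s0 ^+ 2 * _]mulrC (le_trans h2).
Qed.

End Spectrum.

Section AtRegularPoint.
Context {R : realType} (M : instance R) (sigma xi : R).
Context (hY : no_outside_interference M) (hL : latent_factor_model M).
Context (x : Om M) (hx : regular sigma xi x).
Context (K : R) (K0 : 0 < K) (KS : xi * sigma < K).
Local Notation unit := 'I_(units M).
Local Notation time := 'I_(Ttr M + Tpr M).
Local Notation Q := (condLFA M x).

Definition realised (t : time) (i : unit) : outcome_index M :=
  outcome_at t i (assign M x t).

Lemma measurable_Z t i : measurable_fun setT (@Z R M t i).
Proof.
move=> _ B mB; rewrite setTI.
have -> : @Z R M t i @^-1` B = \bigcup_(a in [set: {ffun time -> treatment (units M) (levels M)}])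
    ((assign M @^-1` [set a]) `&` (Y M t i (a t) @^-1` B)).
  apply/seteqP; split => [y By|y [a _ [/= ay]]]; last by rewrite /Z -ay.
  by exists (assign M y).
apply: fin_bigcup_measurable => [|a _]; last apply: measurableI.
- exact: (@finite_finset {ffun time -> treatment (units M) (levels M)}).
- exact: assign_measurable.
- by rewrite -[X in measurable X]setTI; exact: measurable_funPT.
Qed.

Lemma ae_Z : {ae Q, forall y, forall t i,
  Z t i y = omean x (realised t i) + centered x (realised t i) y}.
Proof.
apply: filterS (reg_assign hx) => y ay t i.
by rewrite /Z ay hY /centered addrC subrK.
Qed.

Lemma mean_Z t i : fine ('E_Q[Z t i])%E = omean x (realised t i).
Proof.
have sg := centered_subgauss_outcome hx hL K0 KS (realised t i).
have [mc _ c0] := sg; have int_c := integrable_subgauss K0 sg.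
rewrite unlock.
transitivity (\int[Q]_y (omean x (realised t i) + centered x (realised t i) y)).
  rewrite /Rintegral; congr fine; apply: ae_eq_integral => //.
  - by apply/measurable_EFinP; exact: measurable_Z.
  - by apply/measurable_EFinP; exact: measurable_funD.
  - by apply: filterS ae_Z => y -> _.
rewrite RintD//; last exact: integrable_cst_fun.
by rewrite Rint_cst c0 addr0.
Qed.

End AtRegularPoint.

(** * From the matrix estimate to the estimator and its rate *)

Section Assembly.
Context {R : realType}.

Lemma row_averageE P q (F : 'M[R]_(P, q)) (v : 'cV[R]_q) :
  P%:R^-1 * ((const_mx 1 : 'rV[R]_P) *m F *m v) 0 0 = dot (row_average F) v.
Proof.
rewrite dot_row_average -mulmxA mxE; congr (_ * _).
by apply: eq_bigr => t _; rewrite mxE mul1r.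
Qed.

(** [C] and [N] are chosen before the instance, from [sigma], [xi] and [eps] only: this is the
    uniformity that boundedness in probability along a sequence requires. *)
Lemma ipo_whp (sigma xi eps : R) : 0 < xi -> 0 < eps ->
  exists C N : R, forall (M : instance R) (x : Om M) (n : 'I_(units M))
    (atilde : treatment (units M) (levels M)),
  no_outside_interference M -> latent_factor_model M -> regular sigma xi x ->
  forall (p : 'I_(units M) -> {perm 'I_(units M)})
    (S : svd (EZtr (donors n atilde x) x))
    (Shat : forall y, svd (Ztr (donors n atilde x) y)) (xi1 xi2 : R),
  (forall i, i \in donors n atilde x -> matching n atilde x i (p i)) ->
  donors_span n atilde x p ->
  (EZpr (donors n atilde x) x <= EZtr (donors n atilde x) x)%MS ->
  0 < xi1 -> 0 < xi2 ->
  xi1 <= (sv S)`_((\rank (EZtr (donors n atilde x) x)).-1) / (sv S)`_0 ->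
  xi2 * (Ttr M)%:R * #|donors n atilde x|%:R <= frobenius_sq (EZtr (donors n atilde x) x) ->
  (0 < Ttr M)%N -> (0 < #|donors n atilde x|)%N ->
  N <= (Ttr M)%:R -> N <= #|donors n atilde x|%:R ->
  whp (condLFA M x) eps (fun y =>
    `|IPO_hat n Shat (\rank (EZtr (donors n atilde x) x)) y - IPO n atilde x| <=
    C * (Num.sqrt (\rank (EZtr (donors n atilde x) x))%:R / (xi1 * Num.sqrt xi2)) ^+ 4 /
      Num.sqrt (minn (Ttr M) #|donors n atilde x|)%:R).
Proof.
(* Adding 1 keeps [K] positive when [sigma = 0] and strictly above [xi * sigma]; the absolute value
   covers a negative [sigma]. *)
move=> xi0 eps0; pose K := xi * `|sigma| + 1.
have K0 : 0 < K by rewrite ltr_pwDr// mulr_ge0// ltW.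
have KS : xi * sigma < K.
  by rewrite (@le_lt_trans _ _ (xi * `|sigma|)) ?ltrDl// ler_pM2l// ler_norm.
have [C [N hC]] := finite_sample K0 (sqr_ge0 sigma) eps0.
exists C, N => M x n atilde hY hL hx p S Shat xi1 xi2 pI sp FE x10 x20 h1 h2 T0 I0 NT NI.
set I := donors n atilde x in S Shat pI sp FE h1 h2 I0 NI *.
set Q := condLFA M x.
set E := EZtr I x in S FE h1 h2 *; set F := EZpr I x in FE *.
pose rl t i := realised x t i.
have EE i j : E i j = omean x (rl (lshift (Tpr M) i) (enum_val j)).
  by rewrite mxE (mean_Z hY hL hx K0 KS).
have FF i j : F i j = omean x (rl (rshift (Ttr M) i) (enum_val j)).
  by rewrite mxE (mean_Z hY hL hx K0 KS).
have E1 i j : `|E i j| <= 1 by rewrite EE (omean_le1 hx).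
have F1 i j : `|F i j| <= 1 by rewrite FF (omean_le1 hx).
have om t i a : omean x (outcome_at t i a) = factor_mean x t i a.
  by have [] := omeanE hx hL K0 KS t i a.
have [be [be1 be2]] := donors_combination pI sp.
pose bv : 'cV[R]_#|I| := \col_l be l.
have Ebe t : (E *m bv) t 0 = omean x (rl (lshift (Tpr M) t) n).
  rewrite om be1 mxE; apply: eq_bigr => l _.
  by rewrite EE mxE mulrC om.
have Fbe t : (F *m bv) t 0 = omean x (outcome_at (rshift (Ttr M) t) n atilde).
  rewrite om be2 mxE; apply: eq_bigr => l _.
  by rewrite FF mxE mulrC om.
have [hr g1 rg svr] := spectrum_bounds T0 I0 E1 x10 x20 h1 h2 erefl.
set r := \rank E in h1 hr g1 rg svr *; set g := Num.sqrt r%:R / _ in g1 rg svr *.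
pose W (i : 'I_(Ttr M)) (j : 'I_#|I|) := centered x (rl (lshift (Tpr M) i) (enum_val j)).
pose nz (i : 'I_(Ttr M)) := centered x (rl (lshift (Tpr M) i) n).
pose et (i : 'I_(Tpr M)) (j : 'I_#|I|) := centered x (rl (rshift (Ttr M) i) (enum_val j)).
have sg := centered_subgauss_outcome hx hL K0 KS.
have ind := centered_indep hx hL K0 KS.
(* The index [rl t i] determines [t] and [i], so each of the three noise families is an injectively
   indexed subfamily of the independent centered outcomes. *)
have iW : mutually_independent Q (fun ij : 'I_(Ttr M) * 'I_#|I| => W ij.1 ij.2).
  apply: (mutually_independent_inj
    (f := fun ij : 'I_(Ttr M) * 'I_#|I| => rl (lshift (Tpr M) ij.1) (enum_val ij.2)) _ ind).
  move=> [a b] [a' b'] /= H; congr (_, _).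
    by apply: (@lshift_inj _ (Tpr M)); exact: (congr1 fst H).
  by apply: enum_val_inj; exact: (congr1 (fun o => tag o.2) H).
have iN : mutually_independent Q nz.
  apply: (mutually_independent_inj (f := fun i => rl (lshift (Tpr M) i) n) _ ind).
  by move=> a a' /= H; apply: (@lshift_inj _ (Tpr M)); exact: (congr1 fst H).
have iet : mutually_independent Q (fun ij : 'I_(Tpr M) * 'I_#|I| => et ij.1 ij.2).
  apply: (mutually_independent_inj
    (f := fun ij : 'I_(Tpr M) * 'I_#|I| => rl (rshift (Ttr M) ij.1) (enum_val ij.2)) _ ind).
  move=> [a b] [a' b'] /= H; congr (_, _).
    by apply: (@rshift_inj (Ttr M)); exact: (congr1 fst H).
  by apply: enum_val_inj; exact: (congr1 (fun o => tag o.2) H).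
have Ebe1 t : `|(E *m bv) t 0| <= 1 by rewrite Ebe (omean_le1 hx).
have Fbe1 t : `|(F *m bv) t 0| <= 1 by rewrite Fbe (omean_le1 hx).
have key := hC _ _ Q (Ttr M) (Tpr M) #|I| r W nz et E F S g bv T0 I0 (Tpr_gt0 M) hr NT NI g1 rg
  (fun i j => sg _) (fun i j => centered_sqr hx hL K0 KS _) iW (fun i => sg _) iN
  (fun i j => sg _) iet E1 F1 svr (fun l => @sv_rank0 _ _ _ E S l) FE Ebe1 Fbe1.
have [B [mB QB hB]] := key; have [Nz [mNz Nz0 hNz]] := ae_Z hY hx.
exists (B `|` Nz); split.
- exact: measurableU.
- by rewrite (le_trans (measureU2 _ mB mNz))//= [X in (_ + X)%E]Nz0 adde0.
move=> y yBN.
have {hB} hB := hB y (fun yB => yBN (or_introl yB)).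
have Zy : forall t i, Z t i y = omean x (rl t i) + centered x (rl t i) y.
  by apply: contrapT => nZ; apply: yBN; right; exact: hNz.
have ZtrE : Ztr I y = E + rmx W y.
  by apply/matrixP => i j; rewrite mxE Zy [RHS]mxE EE [in RHS]mxE.
have ztrE : ztr n y = E *m bv + \col_t nz t y.
  by apply/matrixP => i j; rewrite ord1 mxE Zy [RHS]mxE Ebe [in RHS]mxE.
have ZprE : Zpr I y = F + rmx et y.
  by apply/matrixP => i j; rewrite mxE Zy [RHS]mxE FF [in RHS]mxE.
have hIPO : IPO n atilde x = (Tpr M)%:R^-1 * \sum_t (F *m bv) t 0.
  by congr (_ * _); apply: eq_bigr => t _; rewrite Fbe.
rewrite /IPO_hat row_averageE hIPO ZprE ztrE.
move: (Shat y); rewrite ZtrE => T; exact: hB.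
Qed.

End Assembly.

(** The maximum dominates [1 / sqrt (min T I)], the other summand is nonnegative, and the logarithm
    is at least 1 once [T * I] is at least [e]. *)
Lemma rate_ge (R : realType) (T I r : nat) (xi3 : R) :
  (0 < T)%N -> (0 < I)%N -> expR 1 <= (T * I)%:R :> R -> 0 < xi3 ->
  (Num.sqrt r%:R / xi3) ^+ 4 / Num.sqrt (minn T I)%:R <= rate T I r xi3.
Proof.
move=> T0 I0 e1 x0; rewrite /rate.
set A := (X in _ * (X + _)); set mx := Num.max _ _.
have A0 : 0 <= A by rewrite divr_ge0 ?mulr_ge0 ?powR_ge0.
have l1 : 1 <= ln (T * I)%:R :> R.
  by rewrite -[leLHS](@expRK R) ler_ln ?posrE ?expR_gt0// ltr0n muln_gt0 T0.
have gE : (Num.sqrt r%:R / xi3) ^+ 4 = r%:R ^+ 2 / xi3 ^+ 4.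
  by rewrite expr_div_n; congr (_ / _); rewrite -[4%N]/(2 * 2)%N exprM sqr_sqrtr.
have g0 : 0 <= r%:R ^+ 2 / xi3 ^+ 4 by rewrite divr_ge0// exprn_ge0// ltW.
have mxE : (Num.sqrt (minn T I)%:R)^-1 <= mx.
  by rewrite /mx !le_max; case: leqP => _; rewrite lexx ?orbT.
have mx0 : 0 <= mx by rewrite (le_trans _ mxE)// invr_ge0 sqrtr_ge0.
rewrite gE; apply: (@le_trans _ _ (A + r%:R ^+ 2 / xi3 ^+ 4 * mx)).
  by rewrite ler_wpDl// ler_wpM2l.
by rewrite ler_peMl// addr_ge0// mulr_ge0.
Qed.

Theorem theorem2 (R : realType) (sigma xi : R)
    (M : nat -> instance R)
    (n : forall m, 'I_(units (M m)))
    (atilde : forall m, treatment (units (M m)) (levels (M m))) :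
  0 < xi ->
  (forall m, no_outside_interference (M m)) ->
  (forall m, latent_factor_model (M m)) ->
  (forall m, cond_ignorability (M m)) ->
  (forall m, subgaussian_noise (M m) sigma xi) ->
  (forall m, bounded_cond_mean (M m)) ->
  (* almost every realization of the latent factors and of the treatments *)
  exists F : forall m, set (Om (M m)),
    (forall m, (Pr (M m)).-negligible (F m)) /\
    forall (x : forall m, Om (M m)), (forall m, ~ F m (x m)) ->
    let I m := donors (n m) (atilde m) (x m) in
    let rtr m := \rank (EZtr (I m) (x m)) in
    forall (p : forall m, 'I_(units (M m)) -> {perm 'I_(units (M m))})
      (S : forall m, svd (EZtr (I m) (x m)))
      (Shat : forall m (y : Om (M m)), svd (Ztr (I m) y))
      (kappa : nat -> nat) (xi1 xi2 : nat -> R),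
    (forall m i, i \in I m -> matching (n m) (atilde m) (x m) i (p m i)) ->
    (forall m, donors_span (n m) (atilde m) (x m) (p m)) ->
    (forall m, (EZpr (I m) (x m) <= EZtr (I m) (x m))%MS) ->
    (forall m, 0 < xi1 m /\ 0 < xi2 m) ->
    (forall m, xi1 m <= (sv (S m))`_((rtr m).-1) / (sv (S m))`_0) ->
    (forall m, xi2 m * (Ttr (M m))%:R * #|I m|%:R
                 <= frobenius_sq (EZtr (I m) (x m))) ->
    (forall m, kappa m = rtr m) ->
    (forall m, (rtr m <= lrank (M m) * #|nbhd (edge (M m)) (n m)|)%N) ->
    (forall m,
       measurable_fun [set: Om (M m)] (IPO_hat (n m) (Shat m) (kappa m))) ->
    Ttr (M m) @[m --> \oo] --> \oo ->
    #|I m| @[m --> \oo] --> \oo ->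
    bigO_P (fun m => condLFA (M m) (x m))
      (fun m y => IPO_hat (n m) (Shat m) (kappa m) y
                  - IPO (n m) (atilde m) (x m))
      (fun m => rate (Ttr (M m)) #|I m| (rtr m)
                  (xi1 m * Num.sqrt (xi2 m))).
Proof.
move=> xi0 hY hL hI hS hB.
(* The exceptional sets depend on the models only, and so are fixed before the permutations, the
   decompositions and the parameters. *)
exists (fun m => [set x | ~ regular sigma xi x]); split.
  by move=> m; exact: ae_regular (hL m) (hI m) (hS m) (hB m).
move=> x xF I rtr p S Shat kappa xi1 xi2 pI sp FE x0 h1 h2 kE _ mIPO Tinf Iinf eps eps0.
(* Half of [eps], because [bigO_P] asks for a strict inequality. *)
have e20 : 0 < eps / 2 by rewrite divr_gt0.
have [C [N hC]] := ipo_whp sigma xi0 e20.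
(* Beyond this threshold both dimensions exceed [N], and their product exceeds [e] as [rate_ge]
   requires. *)
pose A := (Num.truncn (`|N| + expR 1)).+1.
have hA : `|N| + expR 1 < A%:R by exact: truncnS_gt.
have [m1 _ hm1] := (cvgnyPge _).1 Tinf A.
have [m2 _ hm2] := (cvgnyPge _).1 Iinf A.
exists `|C|, (maxn m1 m2) => m; rewrite geq_max => /andP[/hm1/= TA /hm2/= IA].
have [x10 x20] := x0 m.
have T0 : (0 < Ttr (M m))%N by exact: leq_trans TA.
have I0 : (0 < #|I m|)%N by exact: leq_trans IA.
have TR : `|N| + expR 1 <= (Ttr (M m))%:R.
  by rewrite (le_trans (ltW hA))// ler_nat.
have IR : `|N| + expR 1 <= #|I m|%:R.
  by rewrite (le_trans (ltW hA))// ler_nat.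
have n1 := normr_ge0 N; have n2 := ler_norm N; have e0 := expR_gt0 (1 : R).
have reg : regular sigma xi (x m) by apply: contrapT; exact: xF.
have [B [mB QB hBw]] := hC (M m) (x m) (n m) (atilde m) (hY m) (hL m) reg (p m) (S m)
  (Shat m) (xi1 m) (xi2 m) (pI m) (sp m) (FE m) x10 x20 (h1 m) (h2 m) T0 I0
  ltac:(lra) ltac:(lra).
have x30 : 0 < xi1 m * Num.sqrt (xi2 m) by rewrite mulr_gt0// sqrtr_gt0.
have TI : expR 1 <= (Ttr (M m) * #|I m|)%:R :> R.
  rewrite natrM; apply: (@le_trans _ _ (Ttr (M m))%:R); first lra.
  by rewrite ler_peMr// ler1n.
have rt := rate_ge (rtr m) T0 I0 TI x30.
apply: (@le_lt_trans _ _ (eps / 2)%:E); last by rewrite lte_fin; lra.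
apply: le_trans QB; apply: le_measure; rewrite ?inE//.
  rewrite [X in measurable X](_ : _ = setT `&` (fun y => `|IPO_hat (n m) (Shat m) (kappa m) y -
      IPO (n m) (atilde m) (x m)|) @^-1`
      `]`|C| * rate (Ttr (M m)) #|I m| (rtr m) (xi1 m * Num.sqrt (xi2 m)), +oo[%classic).
    have : measurable_fun [set: Om (M m)] (fun y => `|IPO_hat (n m) (Shat m) (kappa m) y -
      IPO (n m) (atilde m) (x m)|).
      by apply: measurableT_comp => //; apply: measurable_funB => //; exact: mIPO.
    by apply => //; exact: measurable_itv.
  by apply/seteqP; split => y /=; rewrite in_itv/= andbT; [split|case].
move=> y /= hy; apply: contrapT => yB; have := hBw y yB; apply/negP; rewrite -ltNge.
rewrite kE in hy; apply: le_lt_trans hy.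
have g0 : 0 <= (Num.sqrt (rtr m)%:R / (xi1 m * Num.sqrt (xi2 m))) ^+ 4 /
    Num.sqrt (minn (Ttr (M m)) #|I m|)%:R.
  by rewrite divr_ge0 ?sqrtr_ge0// exprn_ge0// divr_ge0 ?sqrtr_ge0// ltW.
rewrite -mulrA (le_trans (ler_wpM2r g0 (ler_norm C)))// ler_wpM2l//.
Qed.
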